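(* Let $C:f=0$ be a reduced plane curve of degree $d$ in $\mathbb{P}^2$, not a union of lines passing through one point, and suppose that the minimal graded free resolution of $M(f)$ has the form $$0 \to S(-b-2(d-1)) \to \bigoplus_{i=1}^{3}S(-d_i-(d-1)) \to S^3(-d+1) \to S$$ with $d_1=1$ and $d_2=d_3=d-1$. Then $C$ is nearly free; more precisely, $\dim N(f)_k=1$ for $d-2\leq k\leq 2d-4$ and $N(f)_k=0$ otherwise. In addition $b=1$, $\tau(C)=(d-1)(d-2)$, $mdr(f)=1$, $ct(f)=d-1$ and $st(f)=2d-3$.
   Context: $S=\mathbb{C}[x,y,z]$ with its standard grading, $f\in S$ is homogeneous of degree $d$, and $C\subset\mathbb{P}^2$ is the curve $f=0$. $J_f=(f_x,f_y,f_z)$ is the Jacobian ideal, $M(f)=S/J_f$ is the graded Milnor algebra, $I_f$ is the saturation of $J_f$ with respect to $\mathbf{m}=(x,y,z)$, and $N(f)=I_f/J_f$ (a graded $S$-module). $b$ is an integer. $\tau(C)$ is the total Tjurina number of $C$, i.e. the sum of the local Tjurina numbers of $C$ at its singular points. $C$ is nearly free if $N(f)\neq 0$ and $\dim N(f)_k\leq 1$ for all $k$. Invariants: let $f_s\in S$ be homogeneous of degree $d$ with $f_s=0$ a smooth curve. - Coincidence threshold: $ct(f)=\max\{q:\dim M(f)_k=\dim M(f_s)_k \text{ for all } k\leq q\}$. - Stability threshold: $st(f)=\min\{q:\dim M(f)_k=\tau(C)\text{ for all }k\geq q\}$. - Minimal degree of a nontrivial (essential) syzygy: $mdr(f)=\min\{q: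 H^2(K^*(f))_{q+2}\neq 0\}$, where $K^*(f)$ is the Koszul complex of $f_x,f_y,f_z$ with its natural grading. Concretely, $H^2(K^*(f))_{q+2}$ is the space of triples $(a,b,c)\in S_q^3$ with $af_x+bf_y+cf_z=0$, modulo the Koszul relations, i.e. those lying in the $S$-submodule generated by $(f_y,-f_x,0)$, $(f_z,0,-f_x)$, $(0,f_z,-f_y)$.
   Formalization: The claims mdr(f)=1 and ct(f)=d-1 are asserted only for d>2: when d=2 the curve is a smooth conic (e.g. x^2+y^2+z^2), which satisfies all the hypotheses but has no essential syzygy and unbounded coincidence, so mdr(f) and ct(f) are undefined. *)

(* Defs.v *)
From HB Require Import structures.
From mathcomp Require Import all_boot all_order all_algebra.
From mathcomp Require Import fraction complex reals mpoly.

Set Implicit Arguments.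
Unset Strict Implicit.
Unset Printing Implicit Defensive.

Import GRing.Theory.
Local Open Scope ring_scope.

Section Dimension.
Variables (K : fieldType) (L : comNzRingType) (iota : K -> L).

(* [dim_quot iota V W n]: for subspaces W, V of the K-algebra L (with structure
   map iota), the K-vector space V / (V :&: W) has dimension n, i.e. some n
   elements of V induce a basis of it.  It holds for no n when the dimension is
   infinite. *)
Definition dim_quot (V W : L -> Prop) (n : nat) : Prop :=
  exists e : 'I_n -> L,
    [/\ forall i, V (e i),
        forall c : 'I_n -> K, W (\sum_i iota (c i) * e i) -> forall i, c i = 0
      & forall v, V v -> exists c : 'I_n -> K, W (v - \sum_i iota (c i) * e i)].

End Dimension.

Definition is_min (P : nat -> Prop) (q : nat) : Prop :=
  P q /\ forall q', P q' -> (q <= q')%N.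

Definition is_max (P : nat -> Prop) (q : nat) : Prop :=
  P q /\ forall q', P q' -> (q' <= q)%N.

Section PlaneCurves.
Variable K : fieldType.

Local Notation S := {mpoly K[3]}.
Local Notation A := {mpoly K[2]}.

Definition jacobian_ideal (f h : S) : Prop :=
  exists a : 'I_3 -> S, h = \sum_i a i * f^`M(i).

(* The saturation (J_f : m^oo): m^n is generated by the monomials of degree n. *)
Definition saturated_jacobian (f h : S) : Prop :=
  exists n : nat,
    forall m : 'X_{1..3}, mdeg m = n -> jacobian_ideal f ('X_[m] * h).

(* dim_K (V / W)_k for homogeneous ideals W, V. *)
Definition graded_dim (V W : S -> Prop) (k n : nat) : Prop :=
  dim_quot (@mpolyC 3 K) (fun h => V h /\ h \is k.-homog) W n.

Definition dim_M (f : S) : nat -> nat -> Prop :=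
  graded_dim (fun _ => True) (jacobian_ideal f).

Definition dim_N (f : S) : nat -> nat -> Prop :=
  graded_dim (saturated_jacobian f) (jacobian_ideal f).

Definition nearly_free (f : S) : Prop :=
  (exists h, saturated_jacobian f h /\ ~ jacobian_ideal f h) /\
  (forall k, exists n, dim_N f k n /\ (n <= 1)%N).

(* Points of P^2 are represented by nonzero vectors of homogeneous coordinates. *)
Definition nonzero_vec (p : 'I_3 -> K) : Prop := exists i, p i != 0.

Definition proportional (p q : 'I_3 -> K) : Prop :=
  exists2 c : K, c != 0 & forall i, p i = c * q i.

Definition reduced_curve (f : S) : Prop :=
  f != 0 /\ forall g h : S, f = g ^+ 2 * h -> (msize g <= 1)%N.

Definition union_of_concurrent_lines (f : S) : Prop :=
  exists p : 'I_3 -> K, exists ls : seq S,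
    [/\ nonzero_vec p,
        forall l, l \in ls -> [/\ l != 0, l \is 1.-homog & l.@[p] = 0]
      & forall v, nonzero_vec v ->
          (f.@[v] = 0 <-> exists2 l, l \in ls & l.@[v] = 0)].

Definition singular_point (f : S) (p : 'I_3 -> K) : Prop :=
  [/\ nonzero_vec p, f.@[p] = 0 & forall i, (f^`M(i)).@[p] = 0].

Definition smooth_curve (f : S) : Prop := forall p, ~ singular_point f p.

(* Local equation at p, p i != 0: restriction of f to the affine chart
   x_i = p i, with the origin of the two remaining coordinates moved to p. *)
Definition local_equation (f : S) (p : 'I_3 -> K) (i : 'I_3) : A :=
  f \mPo [tuple (p j)%:MP + oapp (fun k : 'I_2 => 'X_k) 0 (unlift i j) | j < 3].

(* The local ring of the affine plane at the origin, inside K(u, v). *)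
Definition local_ring (x : {fraction A}) : Prop :=
  exists a s : A, s.@[fun _ => 0] != 0 /\ x = tofrac a / tofrac s.

Definition tjurina_ideal (g : A) (x : {fraction A}) : Prop :=
  exists a b c : {fraction A},
    [/\ local_ring a, local_ring b, local_ring c
      & x = a * tofrac g + b * tofrac g^`M(0) + c * tofrac g^`M(1)].

Definition local_tjurina (f : S) (p : 'I_3 -> K) (t : nat) : Prop :=
  exists2 i : 'I_3, p i != 0 &
    dim_quot (fun c : K => tofrac (c%:MP : A)) local_ring
      (tjurina_ideal (local_equation f p i)) t.

(* P lists every singular point of f = 0 exactly once, as a point of P^2. *)
Definition total_tjurina (f : S) (tau : nat) : Prop :=
  exists n, exists P : 'I_n -> 'I_3 -> K, exists t : 'I_n -> nat,
    [/\ forall i, singular_point f (P i),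
        forall i j, proportional (P i) (P j) -> i = j,
        forall p, singular_point f p -> exists i, proportional p (P i),
        forall i, local_tjurina f (P i) (t i)
      & tau = (\sum_i t i)%N].

(* On a smooth curve all q qualify, so no threshold exists (it is infinite). *)
Definition coincidence_threshold (d : nat) (f : S) (q : nat) : Prop :=
  forall fs : S, fs \is d.-homog -> smooth_curve fs ->
    is_max (fun q => forall k, (k <= q)%N ->
              exists n, dim_M f k n /\ dim_M fs k n) q.

Definition stability_threshold (f : S) (q : nat) : Prop :=
  is_min (fun q => forall k, (q <= k)%N ->
            exists tau, total_tjurina f tau /\ dim_M f k tau) q.

Definition koszul_relation (f a b c : S) : Prop :=
  let fx := f^`M(0) in let fy := f^`M(1) in let fz := f^`M(2%:R) in
  exists u v w : S, [/\ a = u * fy + v * fz,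
                        b = - (u * fx) + w * fz
                      & c = - (v * fx) - w * fy].

Definition essential_syzygy (f : S) (q : nat) : Prop :=
  exists a b c : S,
    [/\ [/\ a \is q.-homog, b \is q.-homog & c \is q.-homog],
        a * f^`M(0) + b * f^`M(1) + c * f^`M(2%:R) = 0
      & ~ koszul_relation f a b c].

(* On a smooth curve there is no essential syzygy, hence no such q. *)
Definition mdr (f : S) (q : nat) : Prop := is_min (essential_syzygy f) q.

Definition is_form (k : int) (p : S) : Prop :=
  match k with Posz n => p \is n.-homog | Negz _ => p = 0 end.

(* phi, acting on row vectors, is a degree 0 map (+)_i S(-a i) -> (+)_j S(-b j)
   with image inside the maximal ideal times the target. *)
Definition minimal_graded_map m n (a : 'I_m -> int) (b : 'I_n -> int)
    (phi : 'M[S]_(m, n)) : Prop :=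
  forall i j, is_form (a i - b j) (phi i j) /\ (phi i j).@[fun _ => 0] = 0.

(* A minimal graded free resolution of S / I
     0 -> S(-c) -> (+)_i S(-b i) -> (+)_j S(-a j) -> S. *)
Definition minimal_resolution (I : S -> Prop) n m
    (c : int) (b : 'I_n -> int) (a : 'I_m -> int) : Prop :=
  exists (phi3 : 'M[S]_(1, n)) (phi2 : 'M[S]_(n, m)) (phi1 : 'M[S]_(m, 1)),
    [/\ [/\ minimal_graded_map (fun _ => c) b phi3,
            minimal_graded_map b a phi2
          & minimal_graded_map a (fun _ => 0) phi1],
        forall v : 'rV_1, v *m phi3 = 0 -> v = 0,
        forall v : 'rV_n, v *m phi2 = 0 <-> exists w : 'rV_1, v = w *m phi3,
        forall v : 'rV_m, v *m phi1 = 0 <-> exists w : 'rV_n, v = w *m phi2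
      & forall h : S, I h <-> exists w : 'rV_m, h%:M = w *m phi1].

End PlaneCurves.

(* Main.v *)
Require Import Defs.
From HB Require Import structures.
From mathcomp Require Import all_boot all_order all_algebra.
From mathcomp Require Import fraction complex reals mpoly.
From mathcomp Require Import ring zify boolp.

(** The whole theorem is read off from the linear syzygy l of the generators
    of J_f.  Let L be the matrix of its three linear coefficients.

    If L were invertible, the generators F would satisfy x F_0 + y F_1 + z F_2
    = 0 after a change of basis, hence F = X x G for a vector G of forms of
    degree d - 2 by exactness of the Koszul complex.  Then G is a syzygy of
    degree d - 2, so by the resolution a multiple of l, that is of X, and F = 0.
    If L had rank one, a combination of the generators would vanish.  So L has
    rank two, and after a constant change of generators the syzygy is a F_0 +
    b F_1 = 0 with independent linear forms a, b.  Hence F_0 = b h and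
    F_1 = - a h, and
         J_f = (a h, b h, g)   with deg h = d - 2 and deg g = d - 1.
    The resolution also forces h and g to be coprime, g not to vanish at the
    common zero e of a and b, and the last shift to be given by the relation
    (g, a, b) up to signs, so that it is 1.  This is pencil_structure.

    Everything else follows from this presentation.  The complete intersection
    ideal (h, g) is saturated (Koszul again) and it is the saturation of J_f,
    because h m^(d-1) lies in J_f.  The quotient N(f) = (h, g) / J_f is
    generated by h and isomorphic to S / (a, b, g) = K[t] / (t^(d-1)) shifted by
    d - 2, which gives its dimensions.  The Hilbert function of (h, g) is known
    in large degrees, which gives dim M(f)_k = (d-1)(d-2) for k >= 2d - 3, and
    one more for k = 2d - 4.

    That this stable value is the total Tjurina number is a general fact about
    Jacobian ideals whose quotients have constant dimension and no socle in large
    degrees, proved by linear algebra.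
    The restriction maps S_k -> O_p / T_p to the singular points are jointly
    surjective by the Chinese remainder theorem (chinese_remainder), because
    each O_p / T_p is Artinian (local_artinian).  Their common kernel is (J_f)_k
    (zero_lemma): a form F outside J_f has a multiple G outside J_f that is
    annihilated modulo J_f by two independent linear forms, since binary forms
    split into linear factors; the common zero of these two forms is then a
    singular point at which F is not in the local ideal.

    Finally the coincidence threshold compares J_f with the Jacobian ideal of a
    smooth curve.  They have the same dimension up to degree d - 1, and differ
    in degree d because a smooth curve of degree at least 3 has no linear
    syzygy (vfield_trivial).  Such a syzygy is a linear vector field B killing
    the equation; the gradient at an eigenvector of B for l is an eigenvector of
    the transpose for - (d - 1) l, so B is nilpotent, and nonzero nilpotent fields
    are excluded by evaluating second and third derivatives of the invariance at
    a point of the image of B. *)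

Set Implicit Arguments.
Unset Strict Implicit.
Unset Printing Implicit Defensive.

Import Order.TTheory GRing.Theory Num.Theory.
Local Open Scope ring_scope.

(** * Polynomials, linear forms and Koszul relations *)

Lemma mpoly_ring_ind (n : nat) (K : comNzRingType) (P : {mpoly K[n]} -> Prop) :
  (forall c, P c%:MP) -> (forall i, P 'X_i) ->
  (forall p q, P p -> P q -> P (p + q)) ->
  (forall p q, P p -> P q -> P (p * q)) -> forall p, P p.
Proof.
move=> PC PX PD PM; elim/mpolyind => [|c m p _ _ IH]; first by rewrite -mpolyC0.
apply: (PD) => //; rewrite -mul_mpolyC; apply: (PM) => //.
rewrite mpolyXE_id.
elim/big_ind: _ => [||i _]; [by rewrite -mpolyC1 | exact: (PM) | ].
by elim: (m i) => [|k IHk]; [rewrite expr0 -mpolyC1 | rewrite exprS; exact: (PM)].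
Qed.

(** Two substitutions that agree modulo an ideal I agree modulo I on every
    polynomial.  This gives division with remainder by a linear form, by a
    variable, and by the ideal of a point. *)
Lemma mmap_congr (n : nat) (K T : comNzRingType) (f : {rmorphism K -> T})
    (I : T -> Prop) (h h' : 'I_n -> T) :
  I 0 -> (forall x y, I x -> I y -> I (x + y)) -> (forall a x, I x -> I (a * x)) ->
  (forall i, I (h i - h' i)) ->
  forall p, I (mmap f h p - mmap f h' p).
Proof.
move=> I0 ID IM Ih; elim/mpoly_ring_ind => [c|i|p q Ip Iq|p q Ip Iq].
- by rewrite !mmapC subrr.
- by rewrite !mmapX !mmap1U.
- by rewrite !mmapD opprD addrACA; exact: ID.
rewrite !rmorphM /=.
set a := mmap f h p; set b := mmap f h q; set c := mmap f h' p; set d := mmap f h' q.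
have -> : a * b - c * d = b * (a - c) + c * (b - d) by ring.
by apply: ID; apply: IM.
Qed.

Lemma mmap_homog (n : nat) (K T : comNzRingType) (f : {rmorphism K -> T})
    (h : 'I_n -> T) (a : T) (k : nat) (p : {mpoly K[n]}) :
  p \is k.-homog -> mmap f (fun i => a * h i) p = a ^+ k * mmap f h p.
Proof.
move=> /dhomogP hp; rewrite /mmap mulr_sumr; apply: eq_big_seq => m /hp hm.
have {hm}-> : k = mdeg m by rewrite -hm.
rewrite /mmap1 mdegE -prodrXr mulrCA -big_split /=.
by congr (_ * _); apply: eq_bigr => i _; rewrite exprMn.
Qed.

Lemma meval_homog (n : nat) (K : comNzRingType) k (p : {mpoly K[n]}) c v :
  p \is k.-homog -> p.@[fun i => c * v i] = c ^+ k * p.@[v].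
Proof. exact: mmap_homog. Qed.

Lemma mmap_id (n : nat) (K : comNzRingType) (p : {mpoly K[n]}) :
  mmap (@mpolyC n K) (fun i => 'X_i) p = p.
Proof.
elim/mpoly_ring_ind: p => [c|i|p q hp hq|p q hp hq].
- by rewrite mmapC.
- by rewrite mmapX mmap1U.
- by rewrite mmapD hp hq.
- by rewrite rmorphM /= hp hq.
Qed.

Lemma mmap_meval (n : nat) (K T : comNzRingType) (f : {rmorphism K -> T})
    (v : 'I_n -> K) (p : {mpoly K[n]}) :
  mmap f (fun i => f (v i)) p = f p.@[v].
Proof.
elim/mpoly_ring_ind: p => [c|i|p q hp hq|p q hp hq].
- by rewrite mmapC mevalC.
- by rewrite mmapX mmap1U mevalXU.
- by rewrite mmapD mevalD rmorphD /= hp hq.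
- by rewrite rmorphM mevalM rmorphM /= hp hq.
Qed.

Lemma ord3P (P : 'I_3 -> Prop) : P 0 -> P 1 -> P 2%:R -> forall i, P i.
Proof.
move=> P0 P1 P2 [[|[|[|//]]] hi].
- by have -> : Ordinal hi = 0 by exact: val_inj.
- by have -> : Ordinal hi = 1 by exact: val_inj.
- by have -> : Ordinal hi = 2%:R by exact: val_inj.
Qed.

Lemma sum3 (V : nmodType) (F : 'I_3 -> V) : \sum_i F i = F 0 + F 1 + F 2%:R.
Proof.
rewrite !big_ord_recl big_ord0 addr0 addrA.
by congr (F _ + F _ + F _); apply: val_inj.
Qed.

Lemma Xn_homog (n : nat) (K : comNzRingType) (k : 'I_n) m :
  ('X_k ^+ m : {mpoly K[n]}) \is m.-homog.
Proof.
have h1 : ('X_k : {mpoly K[n]}) \is 1.-homog by rewrite dhomogX /= mdeg1.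
by have := dhomogMn m h1; rewrite mul1n.
Qed.

Section LinearForms.
Variables (K : fieldType) (n : nat).
Local Notation S := {mpoly K[n]}.

Definition lform (a : 'rV[K]_n) : S := \sum_i a 0 i *: 'X_i.

Lemma lform_is_linear : linear lform.
Proof.
move=> c a b; rewrite /lform scaler_sumr -big_split /=.
by apply: eq_bigr => i _; rewrite !mxE scalerA -scalerDl.
Qed.
HB.instance Definition _ :=
  GRing.isLinear.Build K 'rV[K]_n S _ lform lform_is_linear.

Lemma lformX i : lform (delta_mx 0 i) = 'X_i.
Proof.
rewrite /lform (bigD1 i) //= mxE !eqxx scale1r big1 ?addr0 // => j /negbTE ji.
by rewrite mxE eqxx ji scale0r.
Qed.

Lemma lform_homog a : lform a \is 1.-homog.
Proof. by apply: rpred_sum => i _; apply: rpredZ; rewrite dhomogX /= mdeg1. Qed.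

Lemma mcoeff_lform a i : (lform a)@_U_(i) = a 0 i.
Proof.
rewrite /lform raddf_sum (bigD1 i) //= mcoeffZ mcoeffXU eqxx mulr1 big1 ?addr0 //.
by move=> j ji; rewrite mcoeffZ mcoeffXU (negbTE ji) mulr0.
Qed.

Lemma lform_inj : injective lform.
Proof. by move=> a b ab; apply/rowP=> i; rewrite -!mcoeff_lform ab. Qed.

Lemma lform_eq0 a : (lform a == 0) = (a == 0).
Proof. by rewrite -(inj_eq lform_inj) raddf0. Qed.

Lemma homog1_lform (p : S) : p \is 1.-homog -> p = lform (\row_i p@_U_(i)).
Proof.
move=> hp; apply/mpolyP => m; have [/mdeg1P[i /eqP->]|h] := boolP (mdeg m == 1%N).
  by rewrite mcoeff_lform mxE.
rewrite (dhomog_nemf_coeff hp h).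
by rewrite (dhomog_nemf_coeff (lform_homog _) h).
Qed.

Lemma homog0_const (p : S) : p \is 0.-homog -> p = (p@_0%MM)%:MP.
Proof.
move=> hp; apply/mpolyP => m; rewrite mcoeffC.
have [->|h] := eqVneq m 0%MM; first by rewrite mulr1.
by rewrite mulr0 (dhomog_nemf_coeff hp) // mdeg_eq0.
Qed.

(** Together with pihomogMr_small, this is how degree arguments are carried out:
    coefficients of a relation between forms are replaced by their components of
    the right degree. *)
Lemma pihomogMr (k j : nat) (p q : S) : q \is j.-homog ->
  pihomog mdeg (k + j) (p * q) = pihomog mdeg k p * q.
Proof.
move=> hq; elim/mpolyind: p => [|c m p _ _ IH].
  by rewrite !(mul0r, pihomog0).
rewrite mulrDl !pihomogD mulrDl IH; congr (_ + _).
rewrite -scalerAl !linearZ /= -scalerAl; congr (_ *: _).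
have hm : 'X_[m] * q \is (mdeg m + j).-homog.
  by apply: dhomogM => //; rewrite dhomogX.
rewrite pihomogX; case: eqVneq => [e|ne].
  by rewrite pihomog_dE // -e.
by rewrite mul0r (pihomog_ne0 _ hm) // eqn_add2r.
Qed.

Lemma pihomogMr_small (k j : nat) (p q : S) : q \is j.-homog -> (k < j)%N ->
  pihomog mdeg k (p * q) = 0.
Proof.
move=> hq kj; elim/mpolyind: p => [|c m p _ _ IH].
  by rewrite !(mul0r, pihomog0).
rewrite mulrDl !pihomogD IH addr0 -scalerAl !linearZ /=.
have hm : 'X_[m] * q \is (mdeg m + j).-homog.
  by apply: dhomogM => //; rewrite dhomogX.
rewrite (pihomog_ne0 _ hm) ?scaler0 //; lia.
Qed.

Lemma pencil_free (a b : 'rV[K]_n) (c c' : K) :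
  (forall c, a != c *: b) -> b != 0 -> c *: a + c' *: b = 0 -> c = 0 /\ c' = 0.
Proof.
move=> ab b0 E; have c0 : c = 0.
  have [//|c0] := eqVneq c 0; have /eqP[] := ab (- (c^-1 * c')).
  apply: (scalerI c0); rewrite scalerA mulrN mulrA mulfV // mul1r scaleNr.
  by apply/eqP; rewrite -addr_eq0 E.
split=> //; move: E; rewrite c0 scale0r add0r => /eqP.
by rewrite scaler_eq0 (negbTE b0) orbF => /eqP.
Qed.

(** The relations between two independent linear forms are the Koszul ones.
    Eliminate from the polynomial ring a variable occurring in b: this is
    reduction modulo b, its target is a domain, and a does not map to 0. *)
Lemma pencil_syz (a b : 'rV[K]_n) (A B : S) :
  (forall c, a != c *: b) -> b != 0 -> lform a * A = lform b * B ->
  exists C, A = lform b * C /\ B = lform a * C.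
Proof.
move=> ab b0 AB; case/rV0Pn: b0 => j bj.
have b0 : lform b != 0 by rewrite lform_eq0; apply: contraNneq bj => ->; rewrite mxE.
pose h (i : 'I_n) : S := 'X_i - ((i == j)%:R / b 0 j) *: lform b.
pose I (x : S) := exists C, x = lform b * C.
have hI p : I (p - mmap (@mpolyC n K) h p).
  rewrite -{1}[p]mmap_id; apply: mmap_congr.
  - by exists 0; rewrite mulr0.
  - by move=> x y [C ->] [D ->]; exists (C + D); rewrite mulrDr.
  - by move=> x y [C ->]; exists (x * C); rewrite mulrCA.
  move=> i; rewrite /h opprB addrCA subrr addr0.
  exists ((i == j)%:R / b 0 j)%:MP; by rewrite [RHS]mulrC mul_mpolyC.
have pil c : mmap (@mpolyC n K) h (lform c) = lform (c - (c 0 j / b 0 j) *: b).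
  rewrite {1}/lform raddf_sum /= linearB linearZ /=.
  under eq_bigr => i _ do rewrite mmapZ mmapX mmap1U /h /= mulrBr mul_mpolyC.
  rewrite sumrB -/(lform c); congr (_ - _).
  rewrite (bigD1 j) //= big1 ?addr0 ?eqxx => [|i /negbTE->].
    by rewrite mul_mpolyC scalerA mul1r.
  by rewrite mul0r scale0r mulr0.
have A0 : mmap (@mpolyC n K) h A = 0.
  have /eqP := congr1 (mmap (@mpolyC n K) h) AB.
  rewrite !rmorphM /= !pil divff // scale1r subrr linear0 mul0r mulf_eq0.
  rewrite lform_eq0 subr_eq0 (negbTE (ab _)) => /eqP //.
have [C AC] := hI A; rewrite A0 subr0 in AC; exists C; split=> //.
by apply: (mulfI b0); rewrite -AB AC mulrCA.
Qed.

Lemma meval_lform (a : 'rV[K]_n) v : (lform a).@[v] = \sum_i a 0 i * v i.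
Proof.
rewrite /lform raddf_sum; apply: eq_bigr => i _ /=.
by rewrite mevalZ mevalXU.
Qed.

(** The linear forms vanishing at p; those with fixed i span all of them when
    p i is nonzero, and in the chart of p they are the affine coordinates. *)
Definition pt_form (p : 'I_n -> K) (i a : 'I_n) : S := p i *: 'X_a - p a *: 'X_i.

Lemma pt_formE p i a :
  pt_form p i a = lform (p i *: delta_mx 0 a - p a *: delta_mx 0 i).
Proof. by rewrite /pt_form -!lformX linearB !linearZ. Qed.

Lemma pt_form_homog p i a : pt_form p i a \is 1.-homog.
Proof. by rewrite pt_formE lform_homog. Qed.

Lemma meval_pt_form p i a : (pt_form p i a).@[p] = 0.
Proof. by rewrite mevalB !mevalZ !mevalXU mulrC subrr. Qed.

(** By homogeneity the substitutions X_a -> p_i X_a and X_a -> p_a X_i send F to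
    p_i^k F and to F(p) X_i^k, and they agree modulo the forms vanishing at p. *)
Lemma homog_mod_pt (p : 'I_n -> K) i k (F : S) : F \is k.-homog ->
  exists c : 'I_n -> S,
    p i ^+ k *: F - F.@[p] *: 'X_i ^+ k = \sum_a c a * pt_form p i a.
Proof.
move=> hF; pose I (x : S) := exists c : 'I_n -> S, x = \sum_a c a * pt_form p i a.
have -> : p i ^+ k *: F - F.@[p] *: 'X_i ^+ k =
  mmap (@mpolyC n K) (fun a => (p i)%:MP * 'X_a) F
  - mmap (@mpolyC n K) (fun a => 'X_i * (p a)%:MP) F.
  rewrite !(mmap_homog _ _ _ hF) mmap_id mmap_meval -rmorphXn /= mul_mpolyC.
  by rewrite ['X_i ^+ k * _]mulrC mul_mpolyC.
apply: (@mmap_congr _ _ _ _ I).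
- by exists (fun=> 0); rewrite big1 // => a _; rewrite mul0r.
- move=> x y [c ->] [c' ->]; exists (fun a => c a + c' a).
  by rewrite -big_split; apply: eq_bigr => a _; rewrite mulrDl.
- move=> x y [c ->]; exists (fun a => x * c a).
  by rewrite mulr_sumr; apply: eq_bigr => a _; rewrite mulrA.
move=> a; exists (fun b => (a == b)%:R).
rewrite (bigD1 a) //= big1 ?addr0 => [|b ba]; last first.
  by rewrite eq_sym (negbTE ba) mul0r.
by rewrite eqxx mul1r mul_mpolyC mulrC mul_mpolyC.
Qed.

End LinearForms.

Section Koszul.
Variables (K : fieldType).
Local Notation S := {mpoly K[3]}.
Local Notation X := ('X_(0 : 'I_3) : S).
Local Notation Y := ('X_(1 : 'I_3) : S).
Local Notation Z := ('X_(2%:R : 'I_3) : S).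

Lemma X_neq0 (n : nat) (i : 'I_n) : 'X_i != 0 :> {mpoly K[n]}.
Proof. by rewrite -lformX lform_eq0; apply/rV0Pn; exists i; rewrite mxE !eqxx oner_neq0. Qed.

Lemma X_pencil (n : nat) (i j : 'I_n) (A B : {mpoly K[n]}) : i != j ->
  'X_i * A = 'X_j * B -> exists C, A = 'X_j * C /\ B = 'X_i * C.
Proof.
move=> ij; rewrite -!lformX; apply: pencil_syz.
  move=> c; apply/eqP => /rowP/(_ i)/eqP; rewrite !mxE !eqxx (negbTE ij) mulr0.
  by rewrite oner_eq0.
by rewrite -lform_eq0 lformX X_neq0.
Qed.

Lemma mod_var (n : nat) (i : 'I_n) (p : {mpoly K[n]}) :
  exists q, p = mmap (@mpolyC n K) (fun a => if a == i then 0 else 'X_a) p + 'X_i * q.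
Proof.
pose I (x : {mpoly K[n]}) := exists q, x = 'X_i * q.
have : I ( p - mmap (@mpolyC n K) (fun a => if a == i then 0 else 'X_a) p).
  rewrite -{1}[p]mmap_id; apply: mmap_congr.
  - by exists 0; rewrite mulr0.
  - by move=> x y [C ->] [D ->]; exists (C + D); rewrite mulrDr.
  - by move=> x y [C ->]; exists (x * C); rewrite mulrCA.
  move=> a; case: eqP => [->|_]; first by exists 1; rewrite subr0 mulr1.
  by exists 0; rewrite subrr mulr0.
by case=> q hq; exists q; rewrite -hq addrC subrK.
Qed.

(** Exactness of the Koszul complex of (x, y, z) in the middle, that is, c = X x e.
    Modulo z the relation involves x and y only, which is X_pencil; lifting it
    leaves a multiple of z, which is cancelled. *)
Lemma koszul_middle (c0 c1 c2 : S) : X * c0 + Y * c1 + Z * c2 = 0 ->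
  exists e0 e1 e2, [/\ c0 = Y * e2 - Z * e1, c1 = Z * e0 - X * e2 & c2 = X * e1 - Y * e0].
Proof.
move=> h.
have [q0] := mod_var 2%:R c0; have [q1] := mod_var 2%:R c1.
set pi := mmap _ _ => E1 E0.
have : X * pi c0 = Y * (- pi c1).
  have := congr1 pi h; rewrite /pi rmorph0 !rmorphD !rmorphM /= !mmapX !mmap1U /=.
  by rewrite mul0r addr0 mulrN => /eqP; rewrite addr_eq0 => /eqP.
case/(X_pencil (isT : (0 : 'I_3) != 1)) => e [e0 e1].
have {}e1 : pi c1 = - (X * e) by rewrite -e1 opprK.
exists q1, (- q0), e; split.
- by rewrite E0 e0; ring.
- by rewrite E1 e1; ring.
apply: (mulfI (X_neq0 2%:R)).
have -> : Z * c2 = - (X * c0 + Y * c1) by apply/eqP; rewrite -addr_eq0 addrC h.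
by rewrite E0 e0 E1 e1; ring.
Qed.

Lemma koszul_last (c0 c1 c2 : S) : X * c1 = Y * c0 -> X * c2 = Z * c0 ->
  exists e, [/\ c0 = X * e, c1 = Y * e & c2 = Z * e].
Proof.
move=> h1 h2; have [e [e1 e0]] := X_pencil (isT : (0 : 'I_3) != 1) h1.
exists e; split=> //; apply: (mulfI (X_neq0 0)).
by rewrite h2 e0; ring.
Qed.

End Koszul.

Lemma pencil_span (K : fieldType) (a b v : 'rV[K]_3) (e : 'I_3 -> K) :
  (forall c, a != c *: b) -> b != 0 -> nonzero_vec e ->
  (lform a).@[e] = 0 -> (lform b).@[e] = 0 -> (lform v).@[e] = 0 ->
  exists c c', lform v = c *: lform a + c' *: lform b.
Proof.
move=> ab b0 [i ei]; rewrite !meval_lform => ha hb hv.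
pose E := \col_i e i.
have ker (w : 'rV_3) : \sum_i w 0 i * e i = 0 -> (w <= kermx E)%MS.
  move=> hw; apply/sub_kermxP/rowP => j; rewrite !mxE -[RHS]hw.
  by apply: eq_bigr => k _; rewrite mxE.
have rE : \rank (kermx E) = 2.
  rewrite mxrank_ker; suff -> : \rank E = 1%N by [].
  apply/eqP; rewrite eqn_leq rank_leq_col lt0n mxrank_eq0.
  by apply: contraNneq ei => /colP/(_ i); rewrite !mxE => ->.
have rab : (2 <= \rank (a + b)%MS)%N.
  suff: (\rank b < \rank (a + b)%MS)%N by rewrite rank_rV b0.
  apply: rank_ltmx; rewrite ltmxE addsmxSr addsmx_sub submx_refl andbT.
  by apply/negP => /sub_rVP[c abs]; move: (ab c); rewrite abs eqxx.
have sab : (a + b <= kermx E)%MS by rewrite addsmx_sub !ker.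
have : (v <= a + b)%MS.
  apply: submx_trans (ker _ hv) _.
  by rewrite -(mxrank_leqif_sup sab) eqn_leq mxrankS // rE.
case/sub_addsmxP => -[u w] /= ->.
exists (u 0 0), (w 0 0); rewrite linearD /= -!linearZ /=.
by rewrite {1}[u]mx11_scalar {1}[w]mx11_scalar !mul_scalar_mx.
Qed.

(** Nullstellensatz for the ideal of one point: modulo the forms vanishing at e,
    the form F is its value at e times a power of a variable. *)
Lemma homog_vanish_pencil (K : fieldType) (a b : 'rV[K]_3) (e : 'I_3 -> K) k
    (F : {mpoly K[3]}) :
  (forall c, a != c *: b) -> b != 0 -> nonzero_vec e ->
  (lform a).@[e] = 0 -> (lform b).@[e] = 0 ->
  F \is k.-homog -> F.@[e] = 0 ->
  exists A B, F = lform a * A + lform b * B.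
Proof.
move=> ab b0 en ha hb hF Fe; case: (en) => i ei.
have [c hc] := homog_mod_pt e i hF.
pose I (x : {mpoly K[3]}) := exists A B, x = lform a * A + lform b * B.
have : I (e i ^+ k *: F).
  move: hc; rewrite Fe scale0r subr0 => ->.
  elim/big_ind: _.
  - by exists 0, 0; ring.
  - by move=> x y [A [B ->]] [A' [B' ->]]; exists (A + A'), (B + B'); ring.
  move=> j _; have hv := meval_pt_form e i j; rewrite pt_formE in hv *.
  have [c1 [c2 ->]] := pencil_span ab b0 en ha hb hv.
  exists (c j * c1%:MP), (c j * c2%:MP); rewrite -!mul_mpolyC; ring.
case=> A [B hAB]; exists ((e i ^- k) *: A), ((e i ^- k) *: B).
by rewrite -!scalerAr -scalerDr -hAB scalerA mulVf ?scale1r ?expf_neq0.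
Qed.

Lemma pencil_zero (K : fieldType) (a b : 'rV[K]_3) :
  exists e, [/\ nonzero_vec e, (lform a).@[e] = 0 & (lform b).@[e] = 0].
Proof.
pose M := row_mx a^T b^T.
have : kermx M != 0.
  by rewrite -mxrank_eq0 mxrank_ker -lt0n subn_gt0 (leq_ltn_trans (rank_leq_col _)).
case/matrix0Pn => i [j hij]; exists (kermx M i); split; first by exists j.
all: have /sub_kermxP := row_sub i (kermx M).
all: rewrite mul_mx_row -[0]row_mx0 => /eq_row_mx[h1 h2]; rewrite meval_lform.
  move/matrixP/(_ 0 0): h1; rewrite !mxE => h; rewrite -[RHS]h.
  by apply: eq_bigr => k _; rewrite !mxE mulrC.
move/matrixP/(_ 0 0): h2; rewrite !mxE => h; rewrite -[RHS]h.
by apply: eq_bigr => k _; rewrite !mxE mulrC.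
Qed.

(** * Subspaces and dimensions of quotients *)

Section Subspaces.
Variables (K : fieldType).

(** Turns the ideals and submodules given by predicates into subspaces with a
    dimension: take a subspace of maximal dimension on which P holds. *)
Lemma subspace_vspace (E : vectType K) (P : E -> Prop) :
  P 0 -> (forall c x y, P x -> P y -> P (c *: x + y)) ->
  exists U : {vspace E}, forall v, v \in U <-> P v.
Proof.
move=> P0 PL.
pose Q n := `[< exists U : {vspace E}, (forall v, v \in U -> P v) /\ \dim U = n >].
have exQ : exists n, Q n.
  exists 0%N; apply/asboolP; exists 0%VS; split; last exact: dimv0.
  by move=> v; rewrite memv0 => /eqP ->.
have bQ n : Q n -> (n <= \dim {:E})%N.
  by move=> /asboolP[U [_ <-]]; apply/dimvS/subvf.
case: (ex_maxnP exQ bQ) => n /asboolP[U [UP Un]] nmax.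
exists U => v; split; [exact: UP | move=> Pv].
have : Q (\dim (<[v]> + U)).
  apply/asboolP; exists (<[v]> + U)%VS; split=> // w /memv_addP[x].
  by case/vlineP=> c -> [y /UP Py ->]; exact: PL.
move=> /nmax; rewrite -Un => h; have : (U == <[v]> + U)%VS.
  by rewrite -(geq_leqif (dimv_leqif_eq _)) // addvSr.
by move=> /eqP ->; rewrite memvE addvSl.
Qed.

Variables (L : comNzRingType) (iota : K -> L).

Lemma dim_quot_dep (V W : L -> Prop) (m n : nat) (x : 'I_n -> L) :
  W 0 -> (forall x y, W x -> W y -> W (x + y)) ->
  (forall c x, W x -> W (iota c * x)) ->
  (forall c c', iota (c + c') = iota c + iota c') ->
  (forall c c', iota (c * c') = iota c * iota c') ->
  dim_quot iota V W m -> (forall i, V (x i)) -> (m < n)%N ->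
  exists2 c : 'I_n -> K, (exists i, c i != 0) & W (\sum_i iota (c i) * x i).
Proof.
move=> W0 WD WZ iD iM [e [Ve _ eS]] Vx mn.
have [A hA] : exists A : 'M[K]_(n, m), forall i,
    W (x i - \sum_j iota (A i j) * e j).
  have /choice[c hc] i := eS _ (Vx i).
  exists (\matrix_(i, j) c i j) => i.
  by under eq_bigr do rewrite mxE; exact: hc.
have : kermx A != 0.
  by rewrite -mxrank_eq0 mxrank_ker -lt0n subn_gt0 (leq_ltn_trans (rank_leq_col _)).
case/matrix0Pn => i [j hij]; exists (kermx A i); first by exists j.
have -> : \sum_k iota (kermx A i k) * x k =
  \sum_k iota (kermx A i k) * (x k - \sum_l iota (A k l) * e l).
  have i0 : iota 0 = 0 by apply: (@addIr _ (iota 0)); rewrite -iD !add0r.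
  have iS (r : seq 'I_n) (F : 'I_n -> K) : iota (\sum_(k <- r) F k) = \sum_(k <- r) iota (F k).
    by rewrite (big_morph iota iD i0).
  under [RHS]eq_bigr do rewrite mulrBr.
  rewrite sumrB -[LHS]subr0; congr (_ - _); apply/esym.
  under eq_bigr do rewrite mulr_sumr.
  rewrite exchange_big big1 //= => l _.
  under eq_bigr do rewrite mulrA -iM.
  rewrite -mulr_suml -iS.
  have /matrixP/(_ i l) := mulmx_ker A; rewrite !mxE => ->.
  by rewrite i0 mul0r.
by elim/big_ind: _ => // k _; apply: WZ.
Qed.

Lemma dim_quot_le (V W : L -> Prop) (m n : nat) :
  W 0 -> (forall x y, W x -> W y -> W (x + y)) ->
  (forall c x, W x -> W (iota c * x)) ->
  (forall c c', iota (c + c') = iota c + iota c') ->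
  (forall c c', iota (c * c') = iota c * iota c') ->
  dim_quot iota V W m -> dim_quot iota V W n -> (n <= m)%N.
Proof.
move=> W0 WD WZ iD iM hm [e' [Ve' eF' _]]; rewrite leqNgt; apply/negP => mn.
have [c [i ci]] := dim_quot_dep W0 WD WZ iD iM hm Ve' mn.
by move=> /eF' c0; rewrite c0 eqxx in ci.
Qed.

Lemma dim_quot_uniq (V W : L -> Prop) (m n : nat) :
  W 0 -> (forall x y, W x -> W y -> W (x + y)) ->
  (forall c x, W x -> W (iota c * x)) ->
  (forall c c', iota (c + c') = iota c + iota c') ->
  (forall c c', iota (c * c') = iota c * iota c') ->
  dim_quot iota V W m -> dim_quot iota V W n -> n = m.
Proof.
by move=> W0 WD WZ iD iM h h'; apply/eqP; rewrite eqn_leq !(@dim_quot_le V W).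
Qed.

(** Computes dimensions of quotients in an arbitrary algebra L by a finite
    dimensional parametrization phi : E -> L of V modulo W.  It is applied with
    E = S_k both to graded pieces and to the local rings at the singular points. *)
Lemma dim_quot_vspace (E : vectType K) (phi : {additive E -> L})
    (D U : {vspace E}) (V W : L -> Prop) (n : nat) :
  (forall c x, phi (c *: x) = iota c * phi x) ->
  W 0 -> (forall x y, W x -> W y -> W (x + y)) ->
  (forall c x, W x -> W (iota c * x)) ->
  (forall v, v \in D -> V (phi v)) ->
  (forall x, V x -> exists2 v, v \in D & W (x - phi v)) ->
  (forall v, v \in U <-> v \in D /\ W (phi v)) ->
  (\dim D = n + \dim U)%N -> dim_quot iota V W n.
Proof.
move=> phiZ W0 WD WZ VD hS hU dimD.
have UD : (U <= D)%VS by apply/subvP => v /hU[].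
have dC : \dim (D :\: U) = n.
  by apply/eqP; rewrite -(eqn_add2l (\dim U)) -{1}(capv_idPr UD) dimv_cap_compl dimD addnC.
subst n; set C := (D :\: U)%VS; pose b := vbasis C.
have bC (i : 'I_(\dim C)) : b`_i \in C.
  by rewrite vbasis_mem ?mem_nth ?size_tuple.
have phiS (c : 'I_(\dim C) -> K) : \sum_i iota (c i) * phi b`_i = phi (\sum_i c i *: b`_i).
  by rewrite raddf_sum; apply: eq_bigr => i _; rewrite phiZ.
have CD : (C <= D)%VS by apply: diffvSl.
exists (fun i => phi b`_i); split=> [i|c|x Vx].
- by apply: VD; apply: (subvP CD); apply: bC.
- rewrite phiS => Wc i.
  have hC : \sum_i c i *: b`_i \in C.
    by apply: rpred_sum => j _; rewrite rpredZ ?bC.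
  have : \sum_i c i *: b`_i \in (C :&: U)%VS.
    by rewrite memv_cap hC; apply/hU; split=> //; apply: (subvP CD).
  have -> : (C :&: U = 0)%VS by exact: capv_diff.
  rewrite memv0 => /eqP c0.
  by have /freeP := basis_free (vbasisP C); apply.
have [v vD Wv] := hS x Vx.
move: (vD); rewrite -(addv_diff_cap D U) => /memv_addP[y yC [z zU vE]].
exists (fun i => coord b i y); rewrite phiS -coord_vbasis //.
have -> : x - phi y = (x - phi v) + phi z by rewrite vE raddfD opprD addrA addrNK.
by apply: WD => //; have /hU[] : z \in U by move: zU; rewrite memv_cap => /andP[].
Qed.
End Subspaces.

(** * Graded pieces in three variables *)

Section Graded.
Variable K : fieldType.
Local Notation S := {mpoly K[3]}.
Local Notation E := (dhomog 3 K).

Definition lin_closed (P : S -> Prop) : Prop :=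
  P 0 /\ forall c x y, P x -> P y -> P (c *: x + y).

Definition graded_piece (P : S -> Prop) (hP : lin_closed P) (k : nat) : {vspace E k} :=
  sval (cid (@subspace_vspace K (E k) (fun v => P (val v)) (proj1 hP)
               (fun c x y => proj2 hP c (val x) (val y)))).

Lemma graded_pieceP P (hP : lin_closed P) k (v : E k) : v \in graded_piece hP k <-> P (val v).
Proof. by rewrite /graded_piece; case: cid. Qed.

Lemma dim_dhomog k : \dim {:E k} = 'C(k.+2, 2).
Proof. by rewrite dimvf /dim /= addn2 -[RHS]bin_sub // subn2. Qed.

Lemma lin_closedD P x y : lin_closed P -> P x -> P y -> P (x + y).
Proof. by move=> [_ h] Px Py; rewrite -[x]scale1r; exact: h. Qed.

Lemma lin_closedZ P c x : lin_closed P -> P x -> P (c *: x).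
Proof. by move=> [P0 h] Px; rewrite -[_ *: _]addr0; exact: h. Qed.

Lemma graded_dimE V W (hV : lin_closed V) (hW : lin_closed W) k n :
  (forall h, h \is k.-homog -> W h -> V h) ->
  graded_dim V W k n <-> (\dim (graded_piece hV k) = n + \dim (graded_piece hW k))%N.
Proof.
move=> WV.
have build m : (\dim (graded_piece hV k) = m + \dim (graded_piece hW k))%N -> graded_dim V W k m.
  apply: (@dim_quot_vspace K S (@mpolyC 3 K) (E k) (val : {additive E k -> S}) (graded_piece hV k) (graded_piece hW k)).
  - by move=> c x; rewrite mul_mpolyC.
  - exact: (proj1 hW).
  - by move=> x y; exact: lin_closedD.
  - by move=> c x Wx; rewrite mul_mpolyC; exact: lin_closedZ.
  - by move=> v /graded_pieceP Vv; split=> //; exact: dhomog_is_dhomog.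
  - move=> x [Vx hx]; exists (DHomog hx); first exact/graded_pieceP.
    by rewrite /= subrr; exact: (proj1 hW).
  move=> v; split=> [/graded_pieceP Wv|[_ Wv]]; last exact/graded_pieceP.
  by split=> //; apply/graded_pieceP; apply: WV => //; exact: dhomog_is_dhomog.
split; last exact: build.
have le : (\dim (graded_piece hW k) <= \dim (graded_piece hV k))%N.
  apply: dimvS; apply/subvP => v /graded_pieceP Wv; apply/graded_pieceP; apply: WV => //.
  exact: dhomog_is_dhomog.
have := build _ (esym (subnK le)) => h1 h2.
suff -> : n = (\dim (graded_piece hV k) - \dim (graded_piece hW k))%N by rewrite subnK.
move: h1 h2; apply: dim_quot_uniq.
- exact: (proj1 hW).
- by move=> x y; exact: lin_closedD.
- by move=> c x Wx; rewrite mul_mpolyC; exact: lin_closedZ.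
- by move=> c c'; rewrite mpolyCD.
- by move=> c c'; rewrite mpolyCM.
Qed.

Lemma lin_closedT : lin_closed (fun _ => True).
Proof. by []. Qed.

Lemma dim_graded_pieceT k : \dim (graded_piece lin_closedT k) = 'C(k.+2, 2).
Proof.
rewrite -dim_dhomog; congr (\dim _); apply/vspaceP => v; rewrite memvf.
by apply/graded_pieceP.
Qed.

Lemma pihomog_mulr k e (A h : S) : h \is e.-homog ->
  exists2 A', A' \is (k - e).-homog & pihomog mdeg k (A * h) = A' * h.
Proof.
move=> hh; have [ek|ke] := leqP e k.
  exists (pihomog mdeg (k - e) A); first exact: pihomogP.
  by rewrite -(pihomogMr _ _ hh) subnK.
by exists 0; rewrite ?rpred0 // mul0r (pihomogMr_small _ hh).
Qed.

Definition multiple_of (h F : S) : Prop := exists A, F = h * A.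

Lemma multiple_closed h : lin_closed (multiple_of h).
Proof.
split; first by exists 0; rewrite mulr0.
by move=> c x y [A ->] [B ->]; exists (c *: A + B); rewrite mulrDr -scalerAr.
Qed.

Lemma dim_multiple h e k : h \is e.-homog -> h != 0 ->
  \dim (graded_piece (multiple_closed h) k) = if (e <= k)%N then 'C((k - e).+2, 2) else 0%N.
Proof.
move=> hh h0; case: leqP => [ek|ke]; last first.
  apply/eqP; rewrite dimv_eq0; apply/eqP/vspaceP => v; rewrite memv0.
  apply/idP/eqP => [/graded_pieceP[A vA]|->]; last by rewrite mem0v.
  have hv := dhomog_is_dhomog v.
  apply: val_inj; rewrite /= -(pihomog_dE hv) vA mulrC.
  by rewrite (pihomogMr_small _ hh).
have hA (A : E (k - e)) : h * val A \is k.-homog.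
  by have := dhomogM hh (dhomog_is_dhomog A); rewrite subnKC.
pose phi (A : E (k - e)) : E k := DHomog (hA A).
have phil : linear phi.
  by move=> c A B; apply: val_inj; rewrite /= mulrDr -scalerAr.
pose phiL := GRing.isLinear.Build K (E (k - e)) (E k) _ phi phil.
pose phi' : {linear E (k - e) -> E k} := HB.pack phi phiL.
pose f := linfun phi'.
rewrite -(dim_dhomog (k - e)) -(limg_dim_eq (f := f)); last first.
  apply/eqP; rewrite capfv; apply/lker0P => A B; rewrite !lfunE => /(congr1 val) /=.
  by move/(mulfI h0)/val_inj.
congr (\dim _); apply/vspaceP => v; apply/idP/idP => [/graded_pieceP[A vA]|/memv_imgP[A _ ->]].
  have hv := dhomog_is_dhomog v.
  have [A' hA' vA'] := pihomog_mulr k A hh.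
  apply/memv_imgP; exists (DHomog hA'); first exact: memvf.
  by apply: val_inj; rewrite lfunE /= mulrC -vA' mulrC -vA pihomog_dE.
by apply/graded_pieceP; rewrite lfunE /=; exists (val A).
Qed.

End Graded.

(** * Ideals generated by a h, b h and g for linear forms a, b *)

(** Saturation of an arbitrary ideal predicate; for the Jacobian ideal it unfolds
    to the saturated Jacobian ideal. *)
Definition saturation (K : fieldType) (J : {mpoly K[3]} -> Prop) (h : {mpoly K[3]}) :=
  exists n : nat, forall m : 'X_{1..3}, mdeg m = n -> J ('X_[m] * h).

Lemma bin2_double n : (2 * 'C(n.+1, 2) = n.+1 * n)%N.
Proof. by rewrite -[LHS](mul_bin_diag n.+1 1) bin1. Qed.

Section Pencil.
Variables (K : fieldType) (d : nat).
Local Notation S := {mpoly K[3]}.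
Variables (a b : 'rV[K]_3) (h g : S) (e : 'I_3 -> K) (i0 : 'I_3) (J : S -> Prop).
Hypothesis d_ge2 : (2 <= d)%N.
Hypothesis ab : forall c, a != c *: b.
Hypothesis b0 : b != 0.
Hypothesis ei0 : e i0 != 0.
Hypothesis ae : (lform a).@[e] = 0.
Hypothesis be : (lform b).@[e] = 0.
Hypothesis hh : h \is (d - 2).-homog.
Hypothesis hg : g \is (d - 1).-homog.
Hypothesis h_neq0 : h != 0.
Hypothesis ge : g.@[e] != 0.
Hypothesis gh_coprime : forall u v, g * u = h * v -> exists w, u = h * w.
Hypothesis JE : forall F, J F <->
  exists A B C, F = lform a * h * A + lform b * h * B + g * C.

Let g_neq0 : g != 0.
Proof. by apply: contraNneq ge => ->; rewrite meval0. Qed.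

Let en : nonzero_vec e. Proof. by exists i0. Qed.

Definition hg_ideal (F : S) : Prop := exists A B, F = h * A + g * B.

Lemma pencil_ideal_closed : lin_closed J.
Proof.
split; first by apply/JE; exists 0, 0, 0; rewrite !mulr0 !addr0.
move=> c x y /JE[A [B [C ->]]] /JE[A' [B' [C' ->]]]; apply/JE.
exists (c *: A + A'), (c *: B + B'), (c *: C + C').
rewrite -!mul_mpolyC; ring.
Qed.

Lemma pencil_ideal_mul p F : J F -> J (p * F).
Proof.
move=> /JE[A [B [C ->]]]; apply/JE; exists (p * A), (p * B), (p * C); ring.
Qed.

Lemma hg_ideal_closed : lin_closed hg_ideal.
Proof.
split; first by exists 0, 0; rewrite !mulr0 addr0.
move=> c x y [A [B ->]] [A' [B' ->]].
exists (c *: A + A'), (c *: B + B'); rewrite -!mul_mpolyC; ring.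
Qed.

Lemma pencil_ideal_sub_hg F : J F -> hg_ideal F.
Proof.
move=> /JE[A [B [C ->]]]; exists (lform a * A + lform b * B), C; ring.
Qed.

(** The ring S / (h, g) has positive depth.  Writing X_i F = h A_i + g B_i, the
    two expressions of X_i X_j F give, by coprimality, X_i B_j - X_j B_i = h w_ij
    and X_j A_i - X_i A_j = g w_ij.  The antisymmetric w satisfies a Koszul
    relation, so w_ij = X_i e_j - X_j e_i; then B - h e and A + g e are
    proportional to X, and this gives F. *)
Lemma hg_saturated1 F : (forall i, hg_ideal ('X_i * F)) -> hg_ideal F.
Proof.
move=> hF; have [A0 [B0 E0]] := hF 0; have [A1 [B1 E1]] := hF 1.
have [A2 [B2 E2]] := hF 2%:R.
set X := 'X_0 in E0; set Y := 'X_1 in E1; set Z := 'X_2%:R in E2.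
have cop i j (A A' B B' : S) : 'X_i * F = h * A + g * B -> 'X_j * F = h * A' + g * B' ->
  exists w, 'X_i * B' - 'X_j * B = h * w /\ 'X_j * A - 'X_i * A' = g * w.
  move=> EA EB.
  have e1 : g * ('X_i * B' - 'X_j * B) = h * ('X_j * A - 'X_i * A').
    have : 'X_i * ('X_j * F) = 'X_j * ('X_i * F) by ring.
    rewrite EA EB => /eqP; rewrite -subr_eq0 => /eqP e1.
    apply/eqP; rewrite -subr_eq0 -[0]e1; apply/eqP; ring.
  have [w ew] := gh_coprime e1; exists w; split=> //.
  by apply: (mulfI h_neq0); rewrite -e1 ew; ring.
have [w01 [u01 v01]] := cop _ _ _ _ _ _ E0 E1.
have [w02 [u02 v02]] := cop _ _ _ _ _ _ E0 E2.
have [w12 [u12 v12]] := cop _ _ _ _ _ _ E1 E2.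
have : X * w12 + Y * (- w02) + Z * w01 = 0.
  apply: (mulfI h_neq0); rewrite mulr0.
  have -> : h * (X * w12 + Y * - w02 + Z * w01) =
    X * (h * w12) - Y * (h * w02) + Z * (h * w01) by ring.
  rewrite -u01 -u02 -u12 -/X -/Y -/Z; ring.
move=> /koszul_middle[e0 [e1 [e2 [_ w02E w01E]]]].
have {}w02E : w02 = X * e2 - Z * e0 by rewrite -[w02]opprK w02E opprB.
have sub0 (x y : S) : x - y = 0 -> x = y by move=> /eqP; rewrite subr_eq0 => /eqP.
have [||q [q0 q1 q2]] := @koszul_last _ (B0 - h * e0) (B1 - h * e1) (B2 - h * e2).
- apply: sub0; move: u01; rewrite w01E -/X -/Y => u.
  have -> : X * (B1 - h * e1) - Y * (B0 - h * e0) =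
     (X * B1 - Y * B0) - h * (X * e1 - Y * e0) by ring.
  by rewrite u subrr.
- apply: sub0; move: u02; rewrite w02E -/X -/Z => u.
  have -> : X * (B2 - h * e2) - Z * (B0 - h * e0) =
     (X * B2 - Z * B0) - h * (X * e2 - Z * e0) by ring.
  by rewrite u subrr.
have [||r [r0 r1 r2]] := @koszul_last _ (A0 + g * e0) (A1 + g * e1) (A2 + g * e2).
- apply: sub0; move: v01; rewrite w01E -/X -/Y => u.
  have -> : X * (A1 + g * e1) - Y * (A0 + g * e0) =
     g * (X * e1 - Y * e0) - (Y * A0 - X * A1) by ring.
  by rewrite u subrr.
- apply: sub0; move: v02; rewrite w02E -/X -/Z => u.
  have -> : X * (A2 + g * e2) - Z * (A0 + g * e0) =
     g * (X * e2 - Z * e0) - (Z * A0 - X * A2) by ring.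
  by rewrite u subrr.
exists r, q; apply: (mulfI (X_neq0 K (0 : 'I_3))).
rewrite E0.
have -> : A0 = X * r - g * e0 by rewrite -r0; ring.
have -> : B0 = X * q + h * e0 by rewrite -q0; ring.
by rewrite /X; ring.
Qed.

Lemma sat_sub_hg F : saturation J F -> hg_ideal F.
Proof.
case=> n hF; suff : forall m : 'X_{1..3}, mdeg m = 0%N -> hg_ideal ('X_[m] * F).
  by move=> /(_ 0%MM (mdeg0 (n:=3))); rewrite mpolyX0 mul1r.
have : forall m : 'X_{1..3}, mdeg m = n -> hg_ideal ('X_[m] * F).
  by move=> m /hF /pencil_ideal_sub_hg.
elim: n {hF} => // n IH hn; apply: IH => m hm; apply: hg_saturated1 => i.
by rewrite mulrA -mpolyXD; apply: hn; rewrite mdegD mdeg1 hm add1n.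
Qed.

(** The reason for the structure of (h, g) / J : h is killed by a and b, which
    generate the ideal of e. *)
Lemma h_mul_vanishing (k : nat) F : F \is k.-homog -> F.@[e] = 0 -> J (h * F).
Proof.
move=> hF Fe; have [A [B ->]] := homog_vanish_pencil ab b0 en ae be hF Fe.
by apply/JE; exists A, B, 0; ring.
Qed.

Lemma h_mod_pencil_ideal m F : F \is m.-homog ->
  J (h * F - (F.@[e] / e i0 ^+ m) *: (h * 'X_i0 ^+ m)).
Proof.
move=> hF; rewrite scalerAr -mulrBr; apply: (@h_mul_vanishing m).
  apply: rpredB => //; apply: rpredZ.
  exact: Xn_homog.
by rewrite mevalB mevalZ rmorphXn /= mevalXU divfK ?subrr // expf_neq0.
Qed.

(** As g does not vanish at e, the form F can be corrected by a multiple of g so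
    that it vanishes at e. *)
Lemma h_mul_high m F : F \is m.-homog -> (d - 1 <= m)%N -> J (h * F).
Proof.
move=> hF dm; pose c := F.@[e] / (g.@[e] * e i0 ^+ (m - (d - 1))).
have -> : h * F = h * (F - c *: (g * 'X_i0 ^+ (m - (d - 1)))) + g * (c *: (h * 'X_i0 ^+ (m - (d - 1)))).
  rewrite -!mul_mpolyC; ring.
apply: lin_closedD; first exact: pencil_ideal_closed.
  apply: (@h_mul_vanishing m).
    apply: rpredB => //; apply: rpredZ.
    by have := dhomogM hg (Xn_homog K i0 (m - (d - 1))); rewrite subnKC.
  rewrite mevalB mevalZ mevalM rmorphXn /= mevalXU divfK ?subrr //.
  by rewrite mulf_neq0 // expf_neq0.
apply/JE; eexists 0, 0, _; rewrite !mulr0 !add0r; reflexivity.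
Qed.

(** By coprimality, a membership of c h X^m in J gives a congruence of c X^m with a
    multiple of g modulo (a, b).  In degrees below that of g the multiple is 0,
    and evaluation at e gives c = 0. *)
Lemma h_mul_low m c : (m < d - 1)%N -> J (c *: (h * 'X_i0 ^+ m)) -> c = 0.
Proof.
move=> md /JE[A [B [C EC]]].
have hX := Xn_homog K i0 m.
have : g * C = h * (c *: 'X_i0 ^+ m - lform a * A - lform b * B).
  have -> : g * C = c *: (h * 'X_i0 ^+ m) - lform a * h * A - lform b * h * B.
    by rewrite EC; ring.
  rewrite -!mul_mpolyC; ring.
move=> E; have [w Cw] := gh_coprime E; move: E; rewrite Cw mulrCA => /(mulfI h_neq0).
move=> /(congr1 (pihomog mdeg m)); rewrite mulrC (pihomogMr_small _ hg md).
rewrite !pihomogB linearZ /= (pihomog_dE hX) => /esym /(congr1 (meval e)).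
have ev (l : 'rV[K]_3) (D : S) : (lform l).@[e] = 0 -> (pihomog mdeg m (lform l * D)).@[e] = 0.
  move=> le; have [D' _] := pihomog_mulr m D (lform_homog l); rewrite mulrC => ->.
  by rewrite mevalM le mulr0.
rewrite !mevalB !ev // mevalZ rmorphXn /= mevalXU meval0 !subr0 => /eqP.
by rewrite mulf_eq0 expf_eq0 (negbTE ei0) andbF orbF => /eqP.
Qed.

Lemma hg_homogP k F : F \is k.-homog -> hg_ideal F ->
  exists A B, [/\ A \is (k - (d - 2)).-homog, (k < d - 2)%N -> A = 0 & F = h * A + g * B].
Proof.
move=> hF [A [B EF]]; move: (pihomog_dE hF); rewrite EF pihomogD.
have [B' _] := pihomog_mulr k B hg; rewrite [B * g]mulrC => ->.
have [ke|ek] := ltnP k (d - 2).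
  rewrite mulrC (pihomogMr_small _ hh ke) add0r => <-.
  by exists 0, B'; split=> //; rewrite ?rpred0 // mulr0 add0r mulrC.
have [A' hA'] := pihomog_mulr k A hh; rewrite [A * h]mulrC => -> <-.
exists A', B'; split; [exact: hA' | by [] | by rewrite [h * _]mulrC [g * _]mulrC].
Qed.

Lemma hg_mod_pencil_ideal k F : (d - 2 <= k)%N -> F \is k.-homog -> hg_ideal F ->
  exists c, J (F - c *: (h * 'X_i0 ^+ (k - (d - 2)))).
Proof.
move=> dk hF hgF; have [A [B [hA _ ->]]] := hg_homogP hF hgF.
exists (A.@[e] / e i0 ^+ (k - (d - 2))); rewrite addrAC.
apply: lin_closedD; [exact: pencil_ideal_closed | exact: h_mod_pencil_ideal |].
by apply/JE; exists 0, 0, B; rewrite !mulr0 !add0r.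
Qed.

Lemma hg_sub_pencil_ideal k F : ~~ (d - 2 <= k <= 2 * d - 4)%N -> F \is k.-homog ->
  hg_ideal F -> J F.
Proof.
move=> hk hF hgF; have [A [B [hA A0 ->]]] := hg_homogP hF hgF.
apply: lin_closedD; first exact: pencil_ideal_closed; last first.
  by apply/JE; exists 0, 0, B; rewrite !mulr0 !add0r.
have [kd|dk] := ltnP k (d - 2); first by rewrite A0 // mulr0; case: pencil_ideal_closed.
apply: h_mul_high hA _; lia.
Qed.

Lemma sat_h m : saturation J (h * 'X_i0 ^+ m).
Proof.
exists (d - 1)%N => m' hm'; have -> : 'X_[m'] * (h * 'X_i0 ^+ m) = 'X_i0 ^+ m * (h * 'X_[m']) by ring.
by apply/pencil_ideal_mul/(@h_mul_high (d - 1)) => //; rewrite dhomogX /= hm'.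
Qed.

Lemma sat_hgE F : saturation J F <-> hg_ideal F.
Proof.
split; first exact: sat_sub_hg.
case=> A [B ->]; have [n hn] := sat_h 0; exists n => m /hn.
rewrite expr0 mulr1 => Jh.
have -> : 'X_[m] * (h * A + g * B) = A * ('X_[m] * h) + 'X_[m] * B * g by ring.
apply: lin_closedD; [exact: pencil_ideal_closed | exact: pencil_ideal_mul | apply: pencil_ideal_mul].
by apply/JE; exists 0, 0, 1; rewrite !mulr0 !add0r mulr1.
Qed.

Lemma dim_sat_quot1 k : (d - 2 <= k <= 2 * d - 4)%N -> graded_dim (saturation J) J k 1.
Proof.
move=> /andP[k1 k2]; exists (fun _ => h * 'X_i0 ^+ (k - (d - 2))); split.
- move=> _; split; first exact: sat_h.
  by have := dhomogM hh (Xn_homog K i0 (k - (d - 2))); rewrite subnKC.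
- move=> c; rewrite big_ord1 mul_mpolyC => /h_mul_low c0 i; rewrite (ord1 i) c0 //; lia.
move=> F [/sat_hgE hgF hF]; have [c hc] := hg_mod_pencil_ideal k1 hF hgF.
by exists (fun _ => c); rewrite big_ord1 mul_mpolyC.
Qed.

Lemma dim_sat_quot0 k : ~~ (d - 2 <= k <= 2 * d - 4)%N -> graded_dim (saturation J) J k 0.
Proof.
move=> hk; exists (fun _ => 0); split; first by case.
  by move=> c _; case.
move=> F [/sat_hgE hgF hF]; exists (fun _ => 0).
by rewrite big_ord0 subr0; exact: hg_sub_pencil_ideal hk hF hgF.
Qed.

Lemma saturation_proper : exists F, saturation J F /\ ~ J F.
Proof.
exists h; have := sat_h 0; rewrite expr0 mulr1 => hs; split=> // Jh.
have d1 : (0 < d - 1)%N by rewrite subn_gt0.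
have := h_mul_low d1 (c := 1); rewrite expr0 mulr1 scale1r => /(_ Jh) /eqP.
by rewrite oner_eq0.
Qed.

(** The dimension of S_(k - e'), with the convention that it is 0 for k < e'. *)
Let shifted_dim e' k := if (e' <= k)%N then 'C((k - e').+2, 2) else 0%N.

(** Inclusion-exclusion for the multiples of h and of g, whose intersection
    consists of the multiples of h g by coprimality. *)
Lemma dim_hg_ideal k :
  (\dim (graded_piece hg_ideal_closed k) + shifted_dim (2 * d - 3) k =
   shifted_dim (d - 2) k + shifted_dim (d - 1) k)%N.
Proof.
rewrite /shifted_dim -(dim_multiple k hh h_neq0) -(dim_multiple k hg g_neq0).
have hgh : h * g \is (2 * d - 3).-homog.
  by have := dhomogM hh hg; rewrite (_ : d - 2 + (d - 1) = 2 * d - 3)%N //; lia.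
rewrite -(dim_multiple k hgh (mulf_neq0 h_neq0 g_neq0)).
rewrite -[RHS]dimv_sum_cap; congr (_ + _)%N; congr (\dim _); apply/vspaceP => v.
  apply/idP/idP => [/graded_pieceP hv|/memv_addP[x /graded_pieceP[A xA] [y /graded_pieceP[B yB] ->]]]; last first.
    by apply/graded_pieceP; exists A, B; rewrite /= xA yB.
  have hvk := dhomog_is_dhomog v; case: hv => A [B vE].
  have [A' _ eA] := pihomog_mulr k A hh; have [B' _ eB] := pihomog_mulr k B hg.
  have hA' : A' * h \is k.-homog by rewrite -eA pihomogP.
  have hB' : B' * g \is k.-homog by rewrite -eB pihomogP.
  apply/memv_addP; exists (DHomog hA'); first by apply/graded_pieceP; exists A'; rewrite /= mulrC.
  exists (DHomog hB'); first by apply/graded_pieceP; exists B'; rewrite /= mulrC.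
  by apply: val_inj; rewrite /= -eA -eB -(pihomog_dE hvk) vE pihomogD ![_ * A]mulrC ![_ * B]mulrC.
rewrite memv_cap; apply/idP/andP => [/graded_pieceP[A vA]|[/graded_pieceP[A vA] /graded_pieceP[B vB]]].
  by split; apply/graded_pieceP; [exists (g * A) | exists (h * A)]; rewrite vA; ring.
have E : g * B = h * A by rewrite -vB -vA.
by have [w Bw] := gh_coprime E; apply/graded_pieceP; exists w; rewrite vB Bw; ring.
Qed.

Lemma dim_hg_ideal_split k n : graded_dim (saturation J) J k n ->
  (\dim (graded_piece hg_ideal_closed k) = n + \dim (graded_piece pencil_ideal_closed k))%N.
Proof.
move=> H; apply/(graded_dimE hg_ideal_closed pencil_ideal_closed); first by move=> F _; exact: pencil_ideal_sub_hg.
case: H => v [H1 H2 H3]; exists v; split=> //.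
  by move=> i; have [/sat_hgE ? ?] := H1 i.
by move=> F [/sat_hgE ? ?]; apply: H3.
Qed.

(** From degree 2d - 4 on, the Hilbert function of S / (h, g) has its final value
    (d - 1)(d - 2); in degree 2d - 4 the quotient (h, g) / J still adds one. *)
Lemma dim_quot_high k : (2 * d - 4 <= k)%N ->
  graded_dim (fun _ => True) J k ((d - 1) * (d - 2) + (k <= 2 * d - 4)%N).
Proof.
move=> kd; apply/(graded_dimE (lin_closedT K) pencil_ideal_closed) => //; rewrite dim_graded_pieceT.
have : (\dim (graded_piece hg_ideal_closed k) = (k <= 2 * d - 4)%N + \dim (graded_piece pencil_ideal_closed k))%N.
  apply: dim_hg_ideal_split; case: leqP => hk; last by apply: dim_sat_quot0; lia.
  by apply: dim_sat_quot1; lia.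
have := dim_hg_ideal k; rewrite /shifted_dim.
set D := (d - 2)%N; pose j := (k - 2 * D)%N.
have -> : (d - 1 = D.+1)%N by lia.
have -> : (2 * d - 3 = (2 * D).+1)%N by lia.
have kE : k = (2 * D + j)%N by lia.
(* The conventional value 0 agrees with the binomial formula just below the
   degree of h g, which is why the formula holds from k = 2d - 4 on. *)
have -> : (if ((2 * D).+1 <= k)%N then 'C((k - (2 * D).+1).+2, 2) else 0%N) = 'C(j.+1, 2).
  case: leqP => h1; first by have -> : j = 0%N by lia.
  by congr 'C(_, 2); lia.
have -> : (if (D <= k)%N then 'C((k - D).+2, 2) else 0%N) = 'C((D + j).+2, 2).
  by rewrite ifT; [congr 'C(_, 2) |]; lia.
have -> : (if (D < k)%N then 'C((k - D.+1).+2, 2) else 0%N) = 'C((D + j).+1, 2).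
  case: ltnP => h1; last by have -> : (D + j = 0)%N by lia.
  by congr 'C(_, 2); lia.
have := bin2_double j; have := bin2_double (D + j); have := bin2_double (D + j).+1.
have := bin2_double k.+1; rewrite kE; nia.
Qed.

Lemma pencil_ideal_socle k F : (2 * d - 3 <= k)%N -> F \is k.-homog ->
  (forall i, J ('X_i * F)) -> J F.
Proof.
move=> kd hF JF; apply: (@hg_sub_pencil_ideal k) => //; first lia.
by apply: hg_saturated1 => i; apply: pencil_ideal_sub_hg.
Qed.

End Pencil.

(** * From the resolution to a pencil of linear forms *)

Section Resolution.
Variables (K : fieldType) (d : nat) (bz : int).
Local Notation S := {mpoly K[3]}.
Variables (phi3 : 'M[S]_(1, 3)) (phi2 : 'M[S]_(3, 3)) (phi1 : 'M[S]_(3, 1)).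
Variable (I : S -> Prop).
Hypothesis d_ge2 : (2 <= d)%N.
Hypothesis phi1_homog : forall i, phi1 i 0 \is (d - 1).-homog.
Hypothesis phi2_homog0 : forall j, phi2 0 j \is 1.-homog.
Hypothesis phi2_homog : forall i j, i != 0 -> phi2 i j \is (d - 1).-homog.
Hypothesis phi3_homog : forall i, i != 0 -> is_form bz (phi3 0 i).
Hypothesis phi2_min : forall i j, (phi2 i j).@[fun _ => 0] = 0.
Hypothesis phi3_min : forall j, (phi3 0 j).@[fun _ => 0] = 0.
Hypothesis ex2 : forall v : 'rV_3, v *m phi2 = 0 <-> exists w : 'rV_1, v = w *m phi3.
Hypothesis ex1 : forall v : 'rV_3, v *m phi1 = 0 <-> exists w : 'rV_3, v = w *m phi2.
Hypothesis ex0 : forall h : S, I h <-> exists w : 'rV_3, h%:M = w *m phi1.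

Local Notation cst := (map_mx (@mpolyC 3 K)).

(** The generators are linearly independent because the resolution is minimal:
    a constant syzygy is a combination of syzygies vanishing at the origin. *)
Lemma gens_free (c : 'rV[K]_3) : cst c *m phi1 = 0 -> c = 0.
Proof.
move=> /ex1[w hw]; apply/rowP => j; rewrite mxE.
have /rowP/(_ j)/(congr1 (meval (fun _ => 0))) := hw.
rewrite !mxE mevalC raddf_sum /= => ->; apply: big1 => i _.
by rewrite mevalM phi2_min mulr0.
Qed.

Lemma row0_neq0 : row 0 phi2 != 0.
Proof.
apply/eqP => l0; have : (delta_mx 0 0 : 'rV[S]_3) *m phi2 = 0 by rewrite -rowE.
move=> /ex2[w] /rowP/(_ 0)/(congr1 (meval (fun _ => 0))).
rewrite !mxE big_ord1 mevalM phi3_min mulr0 meval1 => /eqP.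
by rewrite oner_eq0.
Qed.

(** The other two generating syzygies have degree d - 1, hence cannot contribute
    in lower degrees. *)
Lemma low_syz k (s : 'rV[S]_3) : (k < d - 1)%N -> (forall j, s 0 j \is k.-homog) ->
  s *m phi1 = 0 -> exists q, s = q *: row 0 phi2.
Proof.
move=> kd hs /ex1[w sE].
exists (if k is k'.+1 then pihomog mdeg k' (w 0 0) else 0).
apply/rowP => j; rewrite !mxE -(pihomog_dE (hs j)) sE mxE raddf_sum /=.
rewrite (bigD1 0) //= big1 ?addr0 => [|i i0]; last first.
  by rewrite (pihomogMr_small _ (phi2_homog j i0)).
case: k {kd hs} => [|k']; first by rewrite (pihomogMr_small _ (phi2_homog0 j)) // mul0r.
by rewrite -(pihomogMr _ _ (phi2_homog0 j)) addn1.
Qed.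

(** Column j holds the coefficients of the j-th entry of the linear syzygy, so
    that the syzygy is the row of variables times this matrix. *)
Definition lin_syz : 'M[K]_3 := \matrix_(i, j) (phi2 0 j)@_U_(i).

Let XV : 'rV[S]_3 := \row_i 'X_i.

Lemma lin_syzE : row 0 phi2 = XV *m cst lin_syz.
Proof.
apply/rowP => j; rewrite !mxE [LHS](homog1_lform (phi2_homog0 j)) /lform.
by apply: eq_bigr => i _; rewrite !mxE mulrC mul_mpolyC.
Qed.

Lemma row0_syz : row 0 phi2 *m phi1 = 0.
Proof. by apply/ex1; exists (delta_mx 0 0); rewrite -rowE. Qed.

Lemma cst_unit (A : 'M[K]_3) : A \in unitmx -> cst A *m cst (invmx A) = 1%:M.
Proof. by move=> uA; rewrite -map_mxM mulmxV // map_mx1. Qed.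

Lemma cst_unitV (A : 'M[K]_3) : A \in unitmx -> cst (invmx A) *m cst A = 1%:M.
Proof. by move=> uA; rewrite -map_mxM mulVmx // map_mx1. Qed.

(** Otherwise the new generators F satisfy X . F = 0, so F = X x e with e of degree
    d - 2.  Then e . F = 0 is a syzygy of degree d - 2, so e is a multiple of X by
    low_syz, and F = 0. *)
Lemma lin_syz_singular : lin_syz \notin unitmx.
Proof.
apply/negP => uL; have [F FE] : exists F, F = cst lin_syz *m phi1 by eexists.
have hF i : F i 0 \is (d - 1).-homog.
  rewrite FE mxE; apply: rpred_sum => j _; rewrite mxE mul_mpolyC.
  by apply: rpredZ; apply: phi1_homog.
have XF : XV *m F = 0 by rewrite FE mulmxA -lin_syzE row0_syz.
have : 'X_0 * F 0 0 + 'X_1 * F 1 0 + 'X_(2%:R) * F 2%:R 0 = 0.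
  by have /matrixP/(_ 0 0) := XF; rewrite !mxE sum3 !mxE.
move=> /koszul_middle[e0 [e1 [e2 [E0 E1 E2]]]].
have dE : (d - 1 = d - 2 + 1)%N by lia.
have X1 i : ('X_i : S) \is 1.-homog by rewrite dhomogX /= mdeg1.
have pX i (p : S) : pihomog mdeg (d - 1) ('X_i * p) = 'X_i * pihomog mdeg (d - 2) p.
  by rewrite dE ['X_i * p]mulrC (pihomogMr _ _ (X1 i)) mulrC.
have {}E0 := congr1 (pihomog mdeg (d - 1)) E0.
have {}E1 := congr1 (pihomog mdeg (d - 1)) E1.
have {}E2 := congr1 (pihomog mdeg (d - 1)) E2.
rewrite !pihomogB !pX !(pihomog_dE (hF _)) in E0 E1 E2.
pose s : 'rV[S]_3 := \row_i pihomog mdeg (d - 2) (tnth [tuple e0; e1; e2] i).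
have sF : s *m F = 0.
  apply/matrixP => i j; rewrite !ord1 !mxE sum3 !mxE.
  by rewrite E0 E1 E2 /tnth /=; ring.
have hs j : (s *m cst lin_syz) 0 j \is (d - 2).-homog.
  rewrite mxE; apply: rpred_sum => i _; rewrite !mxE mulrC mul_mpolyC.
  by apply: rpredZ; apply: pihomogP.
have d1 : (d - 2 < d - 1)%N by lia.
have [|q hq] := low_syz d1 hs; first by rewrite -mulmxA -FE.
have {hq} sE : s = q *: XV.
  by rewrite -[s]mulmx1 -(cst_unit uL) mulmxA hq lin_syzE -scalemxAl -mulmxA cst_unit // mulmx1.
have F0 : F = 0.
  apply/matrixP => i j; rewrite (ord1 j) [RHS]mxE; move: i; apply: ord3P.
  all: have /rowP/(_ 0) := sE; have /rowP/(_ 1) := sE; have /rowP/(_ 2%:R) := sE.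
  all: rewrite !mxE /tnth /= => s2 s1 s0.
  - by rewrite E0 s1 s2; ring.
  - by rewrite E1 s0 s2; ring.
  - by rewrite E2 s0 s1; ring.
have P0 : phi1 = 0.
  by have := congr1 (mulmx (cst (invmx lin_syz))) F0; rewrite FE mulmxA cst_unitV // mul1mx mulmx0.
have /gens_free/eqP : cst (delta_mx 0 0 : 'rV[K]_3) *m phi1 = 0 by rewrite P0 mulmx0.
by move=> /eqP/rowP/(_ 0)/eqP; rewrite !mxE oner_eq0.
Qed.
Lemma gens_row_neq0 (A : 'M[K]_3) i : A \in unitmx -> (cst A *m phi1) i 0 != 0.
Proof.
move=> uA; apply/eqP => Ai.
have /gens_free r0 : cst (row i A) *m phi1 = 0.
  by apply/matrixP => k j; rewrite !ord1 map_row -row_mul mxE Ai mxE.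
have : (delta_mx 0 i : 'rV[K]_3) *m A = 0 by rewrite -rowE r0.
move=> /(congr1 (mulmx^~ (invmx A))); rewrite mulmxK // mul0mx => /rowP/(_ i)/eqP.
by rewrite !mxE !eqxx oner_eq0.
Qed.

(** Gaussian elimination on the columns of lin_syz.  Its rank is at most 2 by
    lin_syz_singular, and at least 2 because otherwise the syzygy would reduce to
    the vanishing of one generator. *)
Lemma pencil_exists : exists (A : 'M[K]_3) (a b : 'rV[K]_3),
  [/\ A \in unitmx, forall c, a != c *: b, b != 0 &
      row 0 phi2 *m cst (invmx A) = \row_j tnth [tuple lform a; lform b; 0] j].
Proof.
pose A := row_ebase lin_syz; pose C := col_ebase lin_syz; pose r := \rank lin_syz.
have uA : A \in unitmx by exact: row_ebase_unit.
have uC : C \in unitmx by exact: col_ebase_unit.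
have r2 : (r <= 2)%N.
  rewrite -ltnS ltn_neqAle rank_leq_row andbT.
  by apply: contra lin_syz_singular => r3; rewrite -row_free_unit.
have NE : lin_syz *m invmx A = C *m pid_mx r.
  by have h := mulmx_ebase lin_syz; rewrite -{1}h mulmxK.
have rowE j : (row 0 phi2 *m cst (invmx A)) 0 j = if (j < r)%N then lform (col j C)^T else 0.
  rewrite lin_syzE -mulmxA -map_mxM NE mxE.
  under eq_bigr => i _.
    rewrite !mxE (bigD1 j) //= mxE eqxx /= big1 ?addr0; last first.
      by move=> k kj; rewrite mxE (_ : (k == j :> nat) = false) ?mulr0 //; apply/negbTE.
    over.
  case: ifP => jr; last by rewrite big1 // => i _; rewrite mulr0 mpolyC0 mulr0.
  by apply: eq_bigr => i _; rewrite mulr1 !mxE mulrC mul_mpolyC.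
have prod0 : (row 0 phi2 *m cst (invmx A)) *m (cst A *m phi1) = 0.
  by rewrite mulmxA -[_ *m cst A]mulmxA cst_unitV // mulmx1 row0_syz.
have r1 : (1 < r)%N.
  rewrite ltnNge; apply/negP => rle.
  have nz j : j != 0 :> 'I_3 -> (row 0 phi2 *m cst (invmx A)) 0 j = 0.
    by move=> j0; rewrite rowE ifF //; case: j j0 => -[|j] //= ? _; lia.
  have /matrixP/(_ 0 0) := prod0; rewrite mxE (bigD1 0) //= big1 ?addr0; last first.
    by move=> j j0; rewrite nz // mul0r.
  rewrite [RHS]mxE => /eqP; rewrite mulf_eq0 (negbTE (gens_row_neq0 0 uA)) orbF => /eqP l0.
  have lz : row 0 phi2 *m cst (invmx A) = 0.
    by apply/rowP => j; rewrite [RHS]mxE; have [->|/nz] := eqVneq j 0.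
  have := row0_neq0; rewrite -[row 0 phi2]mulmx1 -(cst_unitV uA) mulmxA lz mul0mx eqxx //.
have {r1 r2} rE : r = 2 by apply/eqP; rewrite eqn_leq r2.
have Cinj (v : 'cV_3) : C *m v = 0 -> v = 0.
  by move=> Cv; rewrite -[v](mulKmx uC) Cv mulmx0.
exists A, (col 0 C)^T, (col 1 C)^T; split=> //.
- move=> c; apply/eqP => /(congr1 trmx); rewrite linearZ /= !trmxK => E.
  have /Cinj : C *m (delta_mx 0 0 - c *: delta_mx 1 0 : 'cV_3) = 0.
    by rewrite mulmxBr -scalemxAr -!colE E subrr.
  by move=> /matrixP/(_ 0 0)/eqP; rewrite !mxE mulr0 subr0 oner_eq0.
- apply/eqP => /(congr1 trmx); rewrite trmxK trmx0 => E.
  have /Cinj : C *m (delta_mx 1 0 : 'cV_3) = 0 by rewrite -colE.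
  by move=> /matrixP/(_ 1 0)/eqP; rewrite !mxE oner_eq0.
apply/rowP => j; rewrite rowE rE mxE; move: j; apply: ord3P => //=.
Qed.

Lemma pihomog_lform_quot (b : 'rV[K]_3) (C : S) k : b != 0 ->
  lform b * C \is k.+1.-homog -> C \is k.-homog.
Proof.
move=> b0 hbC; rewrite homog_piE; apply/eqP.
have lb : lform b != 0 by rewrite lform_eq0.
apply: (mulfI lb); rewrite -[RHS](pihomog_dE hbC) -(addn1 k) mulrC.
by rewrite -(pihomogMr _ _ (lform_homog b)) mulrC.
Qed.

(** The generators become b h, - a h, g, and the coprimality and non-vanishing
    conditions express that no syzygy of degree less than d - 1 exists besides
    the multiples of the linear one. *)
Theorem pencil_structure : exists (a b : 'rV[K]_3) (h g : S) (e : 'I_3 -> K) (i0 : 'I_3),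
  [/\ [/\ forall c, a != c *: b, b != 0, e i0 != 0, (lform a).@[e] = 0 & (lform b).@[e] = 0],
      [/\ h \is (d - 2).-homog, g \is (d - 1).-homog, h != 0, g.@[e] != 0 &
          forall u v, g * u = h * v -> exists w, u = h * w],
      forall F, I F <-> exists A B C, F = lform a * h * A + lform b * h * B + g * C
    & bz = 1].
Proof.
have dE : (d - 1 = (d - 2).+1)%N by move: d_ge2; case: (d) => [|[|n]] // _; rewrite !subSS !subn0.
have d1 : (d - 2 < d - 1)%N by rewrite dE.
have [A [a [b [uA ab b0 lE]]]] := pencil_exists.
have [G GE] : exists G : 'cV[S]_3, G = cst A *m phi1 by eexists.
have GV : cst (invmx A) *m G = phi1 by rewrite GE mulmxA cst_unitV // mul1mx.
have hG i : G i 0 \is (d - 1).-homog.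
  rewrite GE mxE; apply: rpred_sum => j _; rewrite mxE mul_mpolyC.
  by apply: rpredZ; apply: phi1_homog.
have la0 : lform a != 0.
  by rewrite lform_eq0; have := ab 0; rewrite scale0r.
have lb0 : lform b != 0 by rewrite lform_eq0.
have [M ME] : exists M, M = phi2 *m cst (invmx A) by eexists.
have M0 : row 0 M = \row_j tnth [tuple lform a; lform b; 0] j.
  by rewrite ME row_mul -lE.
have hM i j : i != 0 -> M i j \is (d - 1).-homog.
  move=> i0; rewrite ME mxE; apply: rpred_sum => k _; rewrite mxE mulrC mul_mpolyC.
  by apply: rpredZ; apply: phi2_homog.
have synth (s : 'rV[S]_3) : s *m G = 0 -> exists w : 'rV_3, s = w *m M.
  move=> sG; have /ex1[w hw] : s *m cst A *m phi1 = 0 by rewrite -mulmxA -GE.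
  exists w; rewrite ME mulmxA -hw -mulmxA cst_unit // mulmx1 //.
have row1 j : M 0 j = tnth [tuple lform a; lform b; 0] j.
  by have /rowP/(_ j) := M0; rewrite !mxE.
have M02 : M 0 2%:R = 0 by rewrite row1.
have third (s : 'rV[S]_3) : s *m G = 0 -> exists w1 w2, s 0 2%:R = w1 * M 1 2%:R + w2 * M 2%:R 2%:R.
  move=> /synth[w ->]; exists (w 0 1), (w 0 2%:R).
  by rewrite mxE sum3 M02 mulr0 add0r.
have third_homog (s : 'rV[S]_3) : s *m G = 0 -> s 0 2%:R \is (d - 1).-homog ->
   exists p q, s 0 2%:R = p *: M 1 2%:R + q *: M 2%:R 2%:R.
  move=> /third[w1 [w2 sE]] hs.
  exists (pihomog mdeg 0 w1)@_0%MM, (pihomog mdeg 0 w2)@_0%MM.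
  rewrite -!mul_mpolyC -!homog0_const ?pihomogP // -(pihomog_dE hs) sE pihomogD.
  by rewrite -[(d - 1)%N]add0n !(pihomogMr _ _ (hM _ _ _)).
(* The linear syzygy is now a G_0 + b G_1 = 0. *)
have syz0 : lform a * G 0 0 = lform b * (- G 1 0).
  have : row 0 M *m G = 0.
    by rewrite ME row_mul -mulmxA GV row0_syz.
  move=> /matrixP/(_ 0 0); rewrite !mxE sum3 mxE row1 mxE row1 mxE row1 /tnth /=.
  by rewrite mul0r addr0 mulrN => /eqP; rewrite addr_eq0 => /eqP.
have [h [G0 G1]] := pencil_syz ab b0 syz0.
have {}G1 : G 1 0 = - (lform a * h) by rewrite -G1 opprK.
have [g gE] : exists g, g = G 2%:R 0 by eexists.
have hg : g \is (d - 1).-homog by rewrite gE.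
have hh : h \is (d - 2).-homog.
  by apply: (@pihomog_lform_quot b) => //; rewrite -G0 -dE.
have h0 : h != 0.
  apply: contraNneq (gens_row_neq0 0 uA) => h0.
  by rewrite -GE G0 h0 mulr0.
have vecG (x y z : S) : x * (lform b * h) - y * (lform a * h) + z * g = 0 ->
    (\row_j tnth [tuple x; y; z] j) *m G = 0.
  move=> E; apply/matrixP => i j; rewrite !ord1 mxE sum3 !mxE /tnth /= G0 G1 -gE.
  by rewrite -[RHS]E; ring.
have v2 (x y z : S) : (\row_j tnth [tuple x; y; z] j) 0 2%:R = z by rewrite mxE.
have hl (l : 'rV[K]_3) : lform l * h \is (d - 1).-homog.
  by rewrite dE -(add1n (d - 2)); apply: dhomogM => //; exact: lform_homog.
(* The third components of syzygies form the ideal generated by the two forms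
   M_12 and M_22 of degree d - 1.  It contains a h and b h by the Koszul
   syzygies, so these span the same plane, and h divides both generators. *)
have [p [q pq]] : exists p q, lform a * h = p *: M 1 2%:R + q *: M 2%:R 2%:R.
  have /vecG/third_homog : 0 * (lform b * h) - g * (lform a * h) + (lform a * h) * g = 0 by ring.
  by rewrite v2; apply.
have [p' [q' pq']] : exists p q, lform b * h = p *: M 1 2%:R + q *: M 2%:R 2%:R.
  have /vecG/third_homog : (- g) * (lform b * h) - 0 * (lform a * h) + (lform b * h) * g = 0 by ring.
  by rewrite v2; apply.
have lcomb (c c' : K) : c *: (lform a * h) = c' *: (lform b * h) -> c = 0 /\ c' = 0.
  move=> E; have : (c *: lform a - c' *: lform b) * h = 0.
    by rewrite mulrBl -!scalerAl E subrr.
  move/eqP; rewrite mulf_eq0 (negbTE h0) orbF -!linearZ -linearB lform_eq0 -scaleNr => /eqP.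
  by move=> /(pencil_free ab b0)[-> /eqP]; rewrite oppr_eq0 => /eqP.
pose D := p * q' - p' * q.
have D0 : D != 0.
  apply/eqP => D0.
  have E1 : q' *: (lform a * h) = q *: (lform b * h).
    rewrite pq pq' !scalerDr !scalerA; congr (_ + _); last by rewrite mulrC.
    by congr (_ *: _); apply/eqP; rewrite -subr_eq0 mulrC [q * _]mulrC -/D D0.
  have E2 : p' *: (lform a * h) = p *: (lform b * h).
    rewrite pq pq' !scalerDr !scalerA; congr (_ + _); first by rewrite mulrC.
    by congr (_ *: _); apply/eqP; rewrite eq_sym -subr_eq0 -/D D0.
  have [q'0 q0] := lcomb _ _ E1; have [p'0 p0] := lcomb _ _ E2.
  move: pq; rewrite q0 p0 !scale0r addr0 => /eqP.
  by rewrite mulf_eq0 (negbTE la0) (negbTE h0).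
have hM1 : exists c, M 1 2%:R = h * c.
  exists (D^-1 *: (q' *: lform a - q *: lform b)).
  apply: (scalerI D0); rewrite -scalerAr scalerA mulfV // scale1r mulrBr -!scalerAr.
  rewrite ![h * _]mulrC pq pq' !scalerDr !scalerA opprD addrACA -!scalerBl.
  by rewrite [q' * q]mulrC subrr scale0r addr0 /D; congr (_ *: _); ring.
have hM2 : exists c, M 2%:R 2%:R = h * c.
  exists (D^-1 *: (p *: lform b - p' *: lform a)).
  apply: (scalerI D0); rewrite -scalerAr scalerA mulfV // scale1r mulrBr -!scalerAr.
  rewrite ![h * _]mulrC pq pq' !scalerDr !scalerA opprD addrACA -!scalerBl.
  by rewrite [p' * p]mulrC subrr scale0r add0r /D; congr (_ *: _); ring.
have hdvd (x y z : S) : x * (lform b * h) - y * (lform a * h) + z * g = 0 -> exists c, z = h * c.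
  move=> /vecG/third[w1 [w2]]; rewrite v2 => ->.
  case: hM1 => c1 ->; case: hM2 => c2 ->; exists (w1 * c1 + w2 * c2); ring.
(* If g u = h v, then b u and a u are third components of syzygies, hence
   multiples of h; independence of a and b makes u itself a multiple of h. *)
have cop u v : g * u = h * v -> exists w, u = h * w.
  move=> E.
  have [A1 EA] : exists c, lform b * u = h * c.
    apply: (@hdvd (- v) 0); rewrite mul0r subr0.
    have -> : lform b * u * g = lform b * (g * u) by ring.
    rewrite E; ring.
  have [B1 EB] : exists c, lform a * u = h * c.
    apply: (@hdvd 0 v).
    have -> : lform a * u * g = lform a * (g * u) by ring.
    rewrite E; ring.
  have : lform a * A1 = lform b * B1.
    apply: (mulfI h0); have -> : h * (lform a * A1) = lform a * (h * A1) by ring.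
    have -> : h * (lform b * B1) = lform b * (h * B1) by ring.
    rewrite -EA -EB; ring.
  move=> /(pencil_syz ab b0)[C [CA _]]; exists C.
  apply: (mulfI lb0); rewrite EA CA; ring.
have [e [en ae be]] := pencil_zero a b.
case: (en) => i0 ei0.
(* If g = a X + b Y, then - h is a third component of a syzygy, which is
   impossible as its degree is less than d - 1. *)
have ge : g.@[e] != 0.
  apply/eqP => ge.
  have [X [Y gXY]] := homog_vanish_pencil ab b0 en ae be hg ge.
  have /vecG/third[w1 [w2]] : Y * (lform b * h) - (- X) * (lform a * h) + (- h) * g = 0.
    by rewrite gXY; ring.
  rewrite v2 => /(congr1 (pihomog mdeg (d - 2))).
  rewrite pihomogN (pihomog_dE hh) pihomogD.
  rewrite !(pihomogMr_small _ (hM _ _ _) d1) // addr0 => /eqP.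
  by rewrite oppr_eq0 (negbTE h0).
exists a, b, h, g, e, i0; split=> //.
  move=> F; split.
    move=> /ex0[w]; rewrite -GV mulmxA => /matrixP/(_ 0 0).
    rewrite mxE eqxx mulr1n mxE sum3 G0 G1 -gE => ->.
    set w' := w *m _; exists (- w' 0 1), (w' 0 0), (w' 0 2%:R); ring.
  case=> x [y [z ->]]; apply/ex0.
  exists ((\row_j tnth [tuple y; - x; z] j) *m cst A); rewrite -mulmxA -GE.
  apply/matrixP => i j; rewrite !ord1 mxE eqxx mulr1n mxE sum3 !mxE /tnth /= G0 G1 -gE; ring.
(* The Koszul syzygies (g, 0, - b h) and (0, g, a h) have coordinates W and W' on
   the generating syzygies, and a W + b W' - g e_0 is a second syzygy, hence a
   multiple t of phi3.  Outside row 0 the coordinates of W and W' are constants,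
   so there the multiple is linear; being nonzero, it bounds the degree bz of
   phi3 from above, and minimality bounds it from below. *)
have [w wE] : exists w : 'rV_3, \row_j tnth [tuple g; 0; - (lform b * h)] j = w *m M.
  by apply/synth/vecG; ring.
have [w' wE'] : exists w : 'rV_3, \row_j tnth [tuple 0; g; lform a * h] j = w *m M.
  by apply/synth/vecG; ring.
pose c i := (pihomog mdeg 0 (w 0 i))@_0%MM; pose c' i := (pihomog mdeg 0 (w' 0 i))@_0%MM.
have cE (u : 'rV_3) (s : 'I_3 -> S) : (forall j, s j \is (d - 1).-homog) -> \row_j s j = u *m M ->
   \row_j s j = (\row_i (if i == 0 then pihomog mdeg (d - 2) (u 0 0)
                         else ((pihomog mdeg 0 (u 0 i))@_0%MM)%:MP)) *m M.
  move=> hs E; apply/rowP => j; have /rowP/(_ j) := E.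
  rewrite !mxE => Ej; rewrite -(pihomog_dE (hs j)) Ej raddf_sum; apply: eq_bigr => i _ /=.
  rewrite !mxE; case: eqVneq => [->|i0'].
    rewrite dE -(addn1 (d - 2)) (@pihomogMr _ _ _ 1) // row1.
    by move: (j); apply: ord3P; rewrite /tnth /= ?lform_homog ?rpred0.
  by rewrite -homog0_const ?pihomogP // -[(d - 1)%N]add0n (pihomogMr _ _ (hM _ _ i0')).
have {}wE := cE _ _ _ wE; have {}wE' := cE _ _ _ wE'.
have {}wE : \row_j tnth [tuple g; 0; - (lform b * h)] j = (\row_i (if i == 0 then pihomog mdeg (d - 2) (w 0 0) else (c i)%:MP)) *m M.
  by apply: wE; apply: ord3P; rewrite /tnth /= ?rpred0 ?rpredN.
have {}wE' : \row_j tnth [tuple 0; g; lform a * h] j = (\row_i (if i == 0 then pihomog mdeg (d - 2) (w' 0 0) else (c' i)%:MP)) *m M.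
  by apply: wE'; apply: ord3P; rewrite /tnth /= ?rpred0.
set W := \row_i (if _ then _ else _) in wE; set W' := \row_i (if _ then _ else _) in wE'.
have : (lform a *: W + lform b *: W' - g *: delta_mx 0 0) *m phi2 = 0.
  suff : (lform a *: W + lform b *: W' - g *: delta_mx 0 0) *m M = 0.
    rewrite ME mulmxA => /(congr1 (mulmx^~ (cst A))).
    by rewrite mul0mx -mulmxA cst_unitV // mulmx1.
  have e1 : W *m M = _ := esym wE; have e2 : W' *m M = _ := esym wE'.
  rewrite mulmxBl mulmxDl -!scalemxAl e1 e2 -rowE M0.
  apply/rowP => j; rewrite !mxE; move: j; apply: ord3P; rewrite /tnth /=; ring.
move=> /ex2[t tE].
have [i [i_neq0 ci]] : exists i, i != 0 /\ c i != 0.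
  apply: contrapT => nc.
  have c0 i : i != 0 -> c i = 0.
    by move=> i00; apply: contrapT => /eqP ci; apply: nc; exists i.
  have /rowP/(_ 2%:R) := wE; rewrite mxE mxE sum3 M02 !mxE /tnth /= !c0 // mpolyC0 mulr0 !mul0r !addr0.
  by move/eqP; rewrite oppr_eq0 mulf_eq0 (negbTE lb0) (negbTE h0).
have tEi : lform (c i *: a + c' i *: b) = t 0 0 * phi3 0 i.
  have /rowP/(_ i) := tE; rewrite [RHS]mxE big_ord1 => <-.
  rewrite !mxE (negbTE i_neq0) mulr0 subr0 linearD !linearZ /=.
  by rewrite [lform a * _]mulrC [lform b * _]mulrC !mul_mpolyC.
have lnz : lform (c i *: a + c' i *: b) != 0.
  rewrite lform_eq0; apply/eqP => /(pencil_free ab b0)[c0 _].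
  by rewrite c0 eqxx in ci.
have := phi3_homog i_neq0; case: bz => [n|n] /= hphi; last first.
  by move: lnz; rewrite tEi hphi mulr0 eqxx.
have n_gt0 : n != 0%N.
  apply/eqP => n0; move: hphi; rewrite n0 => /homog0_const E.
  have := phi3_min i; rewrite E mevalC => E0.
  by move: lnz; rewrite tEi E E0 mpolyC0 mulr0 eqxx.
have n_le1 : (n <= 1)%N.
  rewrite leqNgt; apply/negP => n1; move: lnz.
  by rewrite -(pihomog_dE (lform_homog _)) tEi (pihomogMr_small _ hphi n1) eqxx.
by congr Posz; apply/eqP; rewrite eqn_leq n_le1 lt0n.
Qed.
End Resolution.

(** * Affine charts *)

Section Euler.
Variables (K : comNzRingType) (n : nat).
Lemma euler (d : nat) (f : {mpoly K[n]}) : f \is d.-homog ->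
  \sum_i 'X_i * f^`M(i) = d%:R *: f.
Proof.
move=> /dhomogP hf; rewrite {2}[f]mpolyE scaler_sumr.
under eq_bigr => i _.
  rewrite [X in X^`M(i)]mpolyE raddf_sum mulr_sumr.
  over.
rewrite exchange_big; apply: eq_big_seq => m /hf hm /=.
have {hm}-> : d = mdeg m by rewrite -hm.
under eq_bigr => i _.
  rewrite linearZ /= mderivX -!scalerAr scalerA [_ * _%:R]mulrC -scalerA.
  have -> : (m i)%:R *: (f@_m *: ('X_i * 'X_[m - U_(i)])) = (m i)%:R *: (f@_m *: 'X_[m]).
    case: (posnP (m i)) => [->|mi]; first by rewrite !scale0r.
    by rewrite -mpolyXD addmC submK // lep1mP -lt0n.
  over.
by rewrite -scaler_suml -natr_sum mdegE.
Qed.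

Lemma mderiv_homog (d : nat) (f : {mpoly K[n]}) i : f \is d.-homog -> f^`M(i) \is d.-1.-homog.
Proof.
move=> hf; apply/dhomogP => m; rewrite mcoeff_msupp mcoeff_deriv => h.
have : f@_(m + U_(i)) != 0 by apply: contraNneq h => ->; rewrite mul0rn.
move=> h'; have : mdeg (m + U_(i)) = d.
  by apply/eqP; apply: contraNT h' => /(dhomog_nemf_coeff hf) ->.
by rewrite mdegD mdeg1 addn1 => <-.
Qed.
End Euler.

Lemma sum2 (V : nmodType) (F : 'I_2 -> V) : \sum_j F j = F 0 + F 1.
Proof.
rewrite !big_ord_recl big_ord0 addr0.
by congr (F _ + F _); apply: val_inj.
Qed.

Lemma prod2 (R : comNzRingType) (F : 'I_2 -> R) : \prod_j F j = F 0 * F 1.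
Proof.
rewrite !big_ord_recl big_ord0 mulr1.
by congr (F _ * F _); apply: val_inj.
Qed.

Section Chart.
Variable K : fieldType.
Local Notation S := {mpoly K[3]}.
Local Notation A := {mpoly K[2]}.
Variables (p : 'I_3 -> K) (i : 'I_3).
Hypothesis pi0 : p i != 0.

Local Notation chart F := (local_equation F p i).
(** The affine coordinates at p in the chart i, indexed by the projective ones. *)
Definition chart_coord (j : 'I_3) : A := oapp (fun k : 'I_2 => 'X_k) 0 (unlift i j).

Lemma chartE F :
  local_equation F p i = mmap (@mpolyC 2 K) (fun j => (p j)%:MP + chart_coord j) F.
Proof.
rewrite /local_equation /comp_mpoly /mmap; apply: eq_bigr => m _; congr (_ * _).
by apply: eq_bigr => j _; rewrite tnth_mktuple.
Qed.

Lemma chart0 : chart 0 = 0. Proof. by rewrite chartE rmorph0. Qed.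
Lemma chartD F G : chart (F + G) = chart F + chart G. Proof. by rewrite !chartE rmorphD. Qed.
Lemma chartB F G : chart (F - G) = chart F - chart G. Proof. by rewrite !chartE rmorphB. Qed.
Lemma chartM F G : chart (F * G) = chart F * chart G. Proof. by rewrite !chartE rmorphM. Qed.
Lemma chartC c : chart c%:MP = c%:MP. Proof. by rewrite !chartE mmapC. Qed.
Lemma chartZ c F : chart (c *: F) = c *: chart F. Proof. by rewrite -!mul_mpolyC chartM chartC. Qed.
Lemma chartX j : chart 'X_j = (p j)%:MP + chart_coord j. Proof. by rewrite !chartE mmapX mmap1U. Qed.
Lemma chartXn F n : chart (F ^+ n) = chart F ^+ n. Proof. by rewrite !chartE rmorphXn. Qed.
Lemma chart_sum (I : Type) (r : seq I) P (F : I -> S) :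
  chart (\sum_(k <- r | P k) F k) = \sum_(k <- r | P k) chart (F k).
Proof. by rewrite (big_morph (fun F => chart F) chartD chart0). Qed.

Lemma chart_coord_i : chart_coord i = 0.
Proof. by rewrite /chart_coord unlift_none. Qed.

Lemma chart_coord_lift k : chart_coord (lift i k) = 'X_k.
Proof. by rewrite /chart_coord liftK. Qed.

Lemma chart_center : chart 'X_i = (p i)%:MP.
Proof. by rewrite chartX chart_coord_i addr0. Qed.

Lemma chart_eval0 F : (chart F).@[fun _ => 0] = F.@[p].
Proof.
rewrite /local_equation comp_mpoly_meval; apply: meval_eq => j.
rewrite tnth_mktuple mevalD mevalC -/(chart_coord j).
case: (unliftP i j) => [k ->|->]; last by rewrite chart_coord_i meval0 addr0.
by rewrite chart_coord_lift mevalXU addr0.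
Qed.

Lemma chart_deriv F k : (chart F)^`M(k) = chart F^`M(lift i k).
Proof.
elim/mpoly_ring_ind: F => [c|j|F G hF hG|F G hF hG].
- by rewrite chartC !mderivC chart0.
- rewrite chartX mderivD mderivC add0r.
  have -> : ('X_j : S)^`M(lift i k) = (j == lift i k)%:R%:MP.
    rewrite mderivX mnm1E; case: eqP => [->|_]; last by rewrite scale0r mpolyC0.
    rewrite (_ : (U_(lift i k) - U_(lift i k))%MM = 0%MM); last first.
      by apply/mnmP => l; rewrite mnmBE subnn mnm0E.
    by rewrite mpolyX0 scale1r mpolyC1.
  rewrite chartC; case: (unliftP i j) => [l ->|->]; last first.
    by rewrite chart_coord_i mderiv0 (negbTE (neq_lift i k)) mpolyC0.
  rewrite chart_coord_lift (inj_eq (@lift_inj _ i)) mderivX mnm1E.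
  case: eqP => [->|_]; last by rewrite scale0r mpolyC0.
  rewrite (_ : (U_(k) - U_(k))%MM = 0%MM); last first.
    by apply/mnmP => l'; rewrite mnmBE subnn mnm0E.
  by rewrite mpolyX0 scale1r mpolyC1.
- by rewrite chartD !mderivD chartD hF hG.
- by rewrite chartM !mderivM chartD !chartM hF hG.
Qed.

(** Restriction to the chart is undone by substituting the rational functions
    (p_i X_a - p_a X_i) / X_i for the affine coordinates, up to the factor
    (p_i / X_i)^n. *)
Lemma chart_inj_homog n F : F \is n.-homog -> chart F = 0 -> F = 0.
Proof.
move=> hF sF0.
pose X := tofrac ('X_i : S); have X0 : X != 0 by rewrite tofrac_eq0 X_neq0.
pose T := {fraction S}.
pose c : {rmorphism K -> T} := (@tofrac S \o @mpolyC 3 K).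
pose h (k : 'I_2) : T := tofrac (pt_form p i (lift i k)) / X.
have : mmap c h (chart F) = mmap c (fun j => (c (p i) / X) * tofrac 'X_j) F.
  elim/mpoly_ring_ind: {hF sF0} F => [a|j|F G hF hG|F G hF hG].
  - by rewrite chartC !mmapC.
  - rewrite chartX mmapD mmapC mmapX mmap1U.
    case: (unliftP i j) => [k ->|->]; last first.
      by rewrite chart_coord_i mmap0 addr0 divfK.
    rewrite chart_coord_lift mmapX mmap1U /h /pt_form -!mul_mpolyC rmorphB !rmorphM /= mulrBl.
    by rewrite mulfK // addrCA subrr addr0 mulrAC.
  - by rewrite chartD !mmapD hF hG.
  - by rewrite chartM !rmorphM /= hF hG.
rewrite sF0 rmorph0 (mmap_homog _ _ _ hF) => /esym/eqP; rewrite mulf_eq0.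
rewrite expf_eq0 mulf_eq0 invr_eq0 (negbTE X0) orbF /c /= tofrac_eq0 mpolyC_eq0 (negbTE pi0) andbF /=.
have -> : mmap c (fun j => tofrac 'X_j) F = tofrac F.
  elim/mpoly_ring_ind: {hF sF0} F => [a|j|F G hF hG|F G hF hG].
  - by rewrite !mmapC.
  - by rewrite mmapX mmap1U.
  - by rewrite mmapD rmorphD /= hF hG.
  - by rewrite !rmorphM /= hF hG.
by rewrite tofrac_eq0 => /eqP.
Qed.

Definition liftable n (a : A) := exists2 F, F \is n.-homog & chart F = a.

Lemma liftable1 n : liftable n 1.
Proof.
exists (p i ^- n *: 'X_i ^+ n); first by apply: rpredZ; exact: Xn_homog.
by rewrite chartZ chartXn chart_center -rmorphXn /= -mul_mpolyC -mpolyCM mulVf ?expf_neq0 // mpolyC1.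
Qed.

Lemma liftableM n n' a b : liftable n a -> liftable n' b -> liftable (n + n') (a * b).
Proof.
move=> [F hF <-] [G hG <-]; exists (F * G); last by rewrite chartM.
exact: dhomogM.
Qed.

Lemma liftable_le n n' a : (n <= n')%N -> liftable n a -> liftable n' a.
Proof.
move=> nn' ha; rewrite -(subnKC nn') -[a]mulr1; apply: liftableM => //; exact: liftable1.
Qed.

Lemma liftableD n a b : liftable n a -> liftable n b -> liftable n (a + b).
Proof.
by move=> [F hF <-] [G hG <-]; exists (F + G); [exact: rpredD | rewrite chartD].
Qed.

Lemma liftableZ n c a : liftable n a -> liftable n (c *: a).
Proof.
by move=> [F hF <-]; exists (c *: F); [exact: rpredZ | rewrite chartZ].
Qed.

Lemma liftable0 n : liftable n 0.
Proof. by exists 0; [exact: rpred0 | exact: chart0]. Qed.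

Lemma chart_pt_form k : chart (pt_form p i (lift i k)) = p i *: 'X_k.
Proof.
rewrite chartB !chartZ chart_center chartX chart_coord_lift scalerDr -!mul_mpolyC -!mpolyCM.
by rewrite mulrC addrAC subrr add0r.
Qed.

Lemma liftableX k : liftable 1 'X_k.
Proof.
exists ((p i)^-1 *: pt_form p i (lift i k)).
  by apply: rpredZ; rewrite pt_formE lform_homog.
by rewrite chartZ chart_pt_form scalerA mulVf // scale1r.
Qed.

Lemma liftableXn k n : liftable n ('X_k ^+ n).
Proof.
elim: n => [|n IH]; first exact: liftable1.
by rewrite exprS -add1n; apply: liftableM => //; exact: liftableX.
Qed.

Lemma monomial2 (m : 'X_{1..2}) : 'X_[m] = 'X_0 ^+ m 0 * 'X_1 ^+ m 1 :> A.
Proof. by rewrite mpolyXE_id prod2. Qed.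

Lemma liftable_monomial (m : 'X_{1..2}) : liftable (mdeg m) 'X_[m].
Proof.
rewrite monomial2 mdegE (bigD1 0) //= (bigD1 1) //= big1 ?addn0; last first.
  by case=> -[|[|//]].
by apply: liftableM; exact: liftableXn.
Qed.

Lemma liftable_msize a n : (msize a <= n)%N -> liftable n a.
Proof.
move=> an; rewrite [a]mpolyE big_seq; elim/big_ind: _ => [||m hm].
- exact: liftable0.
- exact: liftableD.
apply: liftableZ; apply: (@liftable_le (mdeg m)); last exact: liftable_monomial.
by apply: leq_trans an; apply: ltnW; exact: msize_mdeg_lt.
Qed.
End Chart.

(** * The local Tjurina ideal *)

Lemma clear_denominators (F : fieldType) (a b c s t u x y z : F) :
  s != 0 -> t != 0 -> u != 0 ->
  s * t * u * (a / s * x + b / t * y + c / u * z) = a * t * u * x + s * b * u * y + s * t * c * z.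
Proof. by move=> s0 t0 u0; field; rewrite s0 t0 u0. Qed.

Section LocalTjurina.
Variables (K : fieldType) (d : nat).
Local Notation S := {mpoly K[3]}.
Local Notation A := {mpoly K[2]}.
Local Notation Frac := {fraction {mpoly K[2]}}.
Variable f : S.
Hypothesis d_gt0 : (0 < d)%N.
Hypothesis d_neq0 : d%:R != 0 :> K.
Hypothesis f_homog : f \is d.-homog.
Local Notation J := (jacobian_ideal f).

Lemma jac_closed : lin_closed J.
Proof.
split; first by exists (fun=> 0); rewrite big1 // => i _; rewrite mul0r.
move=> c x y [a ->] [b ->]; exists (fun i => c *: a i + b i).
rewrite scaler_sumr -big_split; apply: eq_bigr => i _.
by rewrite mulrDl scalerAl.
Qed.

Lemma jac_mul q F : J F -> J (q * F).
Proof.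
move=> [a ->]; exists (fun i => q * a i).
by rewrite mulr_sumr; apply: eq_bigr => i _; rewrite mulrA.
Qed.

Lemma jac_deriv i : J f^`M(i).
Proof.
exists (fun j => (j == i)%:R); rewrite (bigD1 i) //= eqxx mul1r big1 ?addr0 //.
by move=> j /negbTE ->; rewrite mul0r.
Qed.

Lemma jac_f : J f.
Proof.
have := @lin_closedZ _ J d%:R^-1 (d%:R *: f) jac_closed.
rewrite scalerA mulVf // scale1r; apply.
by rewrite -(euler f_homog); exists (fun i => 'X_i).
Qed.

Section AtPoint.
Variables (p : 'I_3 -> K) (i : 'I_3).
Hypothesis pi0 : p i != 0.
Local Notation chart F := (local_equation F p i).
Local Notation T := (tjurina_ideal (chart f)).

Lemma local_ring_frac (a : A) : local_ring (tofrac a).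
Proof. by exists a, 1; rewrite meval1 oner_eq0 rmorph1 divr1. Qed.

Lemma local_ring_inv (s : A) : s.@[fun=> 0] != 0 -> local_ring (tofrac s)^-1.
Proof. by move=> s0; exists 1, s; rewrite rmorph1 div1r. Qed.

Lemma den_neq0 (s : A) : s.@[fun=> 0] != 0 -> tofrac s != 0.
Proof. by move=> s0; rewrite tofrac_eq0; apply: contraNneq s0 => ->; rewrite meval0. Qed.

Lemma local_ringD x y : local_ring x -> local_ring y -> local_ring (x + y : Frac).
Proof.
move=> [a [s [s0 ->]]] [b [t [t0 ->]]]; exists (a * t + b * s), (s * t).
rewrite mevalM mulf_neq0 //; split=> //.
by rewrite rmorphD !rmorphM /= addf_div // den_neq0.
Qed.

Lemma local_ringM x y : local_ring x -> local_ring y -> local_ring (x * y : Frac).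
Proof.
move=> [a [s [s0 ->]]] [b [t [t0 ->]]]; exists (a * b), (s * t).
rewrite mevalM mulf_neq0 //; split=> //.
by rewrite !rmorphM /= mulf_div.
Qed.

Lemma tjurina_ideal0 : T 0.
Proof.
have h : local_ring (0 : Frac) by rewrite -(rmorph0 (@tofrac A)); exact: local_ring_frac.
by exists 0, 0, 0; split=> //; rewrite !mul0r !addr0.
Qed.

Lemma tjurina_idealD x y : T x -> T y -> T (x + y).
Proof.
move=> [a [b [c [la lb lc ->]]]] [a' [b' [c' [la' lb' lc' ->]]]].
exists (a + a'), (b + b'), (c + c'); split; try exact: local_ringD.
ring.
Qed.

Lemma tjurina_idealMl z x : local_ring z -> T x -> T (z * x).
Proof.
move=> lz [a [b [c [la lb lc ->]]]].
exists (z * a), (z * b), (z * c); split; try exact: local_ringM.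
ring.
Qed.

Lemma tjurina_idealMpoly a x : T x -> T (tofrac a * x).
Proof. by apply: tjurina_idealMl; exact: local_ring_frac. Qed.

Lemma tjurina_idealN x : T x -> T (- x).
Proof.
move=> Tx; have -> : - x = tofrac (- 1 : A) * x by rewrite rmorphN rmorph1 mulN1r.
exact: tjurina_idealMpoly.
Qed.

Lemma tjurina_idealB x y : T x -> T y -> T (x - y).
Proof. by move=> Tx Ty; apply: tjurina_idealD => //; exact: tjurina_idealN. Qed.

Lemma tjurina_ideal_eqn : T (tofrac (chart f)).
Proof.
exists 1, 0, 0; rewrite !mul0r !addr0 mul1r; split=> //.
all: by rewrite -?(rmorph1 (@tofrac A)) -?(rmorph0 (@tofrac A)); exact: local_ring_frac.
Qed.

Lemma tjurina_ideal_chart_deriv k : T (tofrac (chart f^`M(lift i k))).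
Proof.
have h0 : local_ring (0 : Frac) by rewrite -(rmorph0 (@tofrac A)); exact: local_ring_frac.
have h1 : local_ring (1 : Frac) by rewrite -(rmorph1 (@tofrac A)); exact: local_ring_frac.
rewrite -chart_deriv //; case: k => -[|[|//]] hk.
  exists 0, 1, 0; rewrite !mul0r add0r addr0 mul1r; split=> //.
  by congr (tofrac (_^`M(_))); apply: val_inj.
exists 0, 0, 1; rewrite !mul0r !add0r mul1r; split=> //.
by congr (tofrac (_^`M(_))); apply: val_inj.
Qed.

(** Two of the partial derivatives restrict to the derivatives of the local
    equation; the third one is recovered from Euler's formula, as X_i restricts to
    a nonzero constant. *)
Lemma tjurina_ideal_deriv j : T (tofrac (chart f^`M(j))).
Proof.
case: (unliftP i j) => [k ->|->]; first exact: tjurina_ideal_chart_deriv.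
have pF : tofrac (p i)%:MP != 0 :> Frac by rewrite tofrac_eq0 mpolyC_eq0.
have -> : tofrac (chart f^`M(i)) = tofrac (p i)^-1%:MP * (tofrac d%:R%:MP * tofrac (chart f)
   - \sum_k tofrac (chart 'X_(lift i k)) * tofrac (chart f^`M(lift i k))) :> Frac.
  have := congr1 (fun F => chart F) (euler f_homog).
  rewrite (bigD1_ord i) //= chartD chartM chart_center chartZ -mul_mpolyC => /(canRL (addrK _)) /(congr1 (@tofrac A)).
  rewrite rmorphB !rmorphM /= => E.
  have -> : tofrac (chart f^`M(i)) = tofrac (p i)^-1%:MP * (tofrac (p i)%:MP * tofrac (chart f^`M(i))).
    by rewrite mulrA -rmorphM -mpolyCM mulVf // mpolyC1 rmorph1 mul1r.
  rewrite E; congr (_ * (_ - _)); rewrite chart_sum rmorph_sum.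
  by apply: eq_bigr => k _; rewrite chartM rmorphM.
apply: tjurina_idealMpoly; apply: tjurina_idealB; first by apply: tjurina_idealMpoly; exact: tjurina_ideal_eqn.
elim/big_ind: _ => [||k _]; [exact: tjurina_ideal0 | exact: tjurina_idealD | apply: tjurina_idealMpoly; exact: tjurina_ideal_chart_deriv].
Qed.

Lemma tjurina_ideal_jac F : J F -> T (tofrac (chart F)).
Proof.
move=> [a ->]; rewrite chart_sum rmorph_sum.
elim/big_ind: _ => [||j _]; [exact: tjurina_ideal0 | exact: tjurina_idealD |].
by rewrite chartM rmorphM; apply: tjurina_idealMpoly; exact: tjurina_ideal_deriv.
Qed.

(** Local membership in global terms: F lies in the local ideal at p if and only if
    s F lies in the Jacobian ideal for some form s not vanishing at p.  From left
    to right, denominators are cleared and the coefficients are homogenized, in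
    degrees chosen so that the resulting relation is homogeneous. *)
Lemma tjurina_idealP k F : F \is k.-homog ->
  T (tofrac (chart F)) <-> exists m s, [/\ s \is m.-homog, s.@[p] != 0 & J (s * F)].
Proof.
move=> hF; split; last first.
  move=> [m [s [hs sp JsF]]].
  have s0 : (chart s).@[fun=> 0] != 0 by rewrite chart_eval0.
  have -> : tofrac (chart F) = (tofrac (chart s))^-1 * tofrac (chart (s * F)) :> Frac.
    by rewrite chartM rmorphM /= mulKf // den_neq0.
  by apply: tjurina_idealMl; [exact: local_ring_inv | exact: tjurina_ideal_jac].
move=> [_ [_ [_ [[a [s [s0 ->]]] [b [t [t0 ->]]] [c [u [u0 ->]]] E]]]].
have E1 : s * t * u * chart F = a * t * u * chart f + s * b * u * (chart f)^`M(0) + s * t * c * (chart f)^`M(1).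
  have sF := den_neq0 s0; have tF := den_neq0 t0; have uF := den_neq0 u0.
  apply/eqP; rewrite -tofrac_eq; apply/eqP; rewrite !(rmorphD, rmorphM) /= E.
  move: sF tF uF; move: (tofrac s) (tofrac t) (tofrac u) (tofrac a) (tofrac b) (tofrac c) => s1 t1 u1 a1 b1 c1.
  move: (tofrac (chart f)) (tofrac (chart f)^`M(0)) (tofrac (chart f)^`M(1)) => x y z.
  move=> sF tF uF; rewrite clear_denominators; [reflexivity | exact: sF | exact: tF | exact: uF].
rewrite !chart_deriv // in E1.
pose N := (msize (s * t * u) + msize (a * t * u) + msize (s * b * u) + msize (s * t * c))%N.
have [s' hs' s'E] : liftable p i (N + d) (s * t * u) by apply: liftable_msize => //; rewrite /N; clear; lia.
have [a' ha' a'E] : liftable p i (N + k) (a * t * u) by apply: liftable_msize => //; rewrite /N; clear; lia.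
have [b' hb' b'E] : liftable p i (N + k).+1 (s * b * u) by apply: liftable_msize => //; rewrite /N; clear; lia.
have [c' hc' c'E] : liftable p i (N + k).+1 (s * t * c) by apply: liftable_msize => //; rewrite /N; clear; lia.
exists (N + d)%N, s'; split=> //.
  by rewrite -(chart_eval0 _ i) s'E !mevalM !mulf_neq0.
have -> : s' * F = a' * f + b' * f^`M(lift i 0) + c' * f^`M(lift i 1).
  apply/eqP; rewrite -subr_eq0; apply/eqP; apply: (chart_inj_homog pi0 (n := N + d + k)).
    have hd j := mderiv_homog j f_homog.
    have e2 (x : S) j : x \is (N + k).+1.-homog -> x * f^`M(j) \is (N + d + k).-homog.
      move=> hx; have := dhomogM hx (hd j).
      by rewrite addSnnS prednK // addnAC.
    apply: rpredB; first exact: dhomogM.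
    apply: rpredD; last exact: e2.
    apply: rpredD; last exact: e2.
    by have := dhomogM ha' f_homog; rewrite addnAC.
  by rewrite chartB !chartD !chartM s'E a'E b'E c'E E1 subrr.
have [J0 JL] := jac_closed.
apply: (@lin_closedD _ J _ _ jac_closed); last by apply: jac_mul; exact: jac_deriv.
apply: (@lin_closedD _ J _ _ jac_closed); last by apply: jac_mul; exact: jac_deriv.
by apply: jac_mul; exact: jac_f.
Qed.

Lemma tjurina_lin_closed : lin_closed (fun F => T (tofrac (chart F))).
Proof.
split; first by rewrite chart0 rmorph0; exact: tjurina_ideal0.
move=> c x y Tx Ty; rewrite chartD chartZ rmorphD; apply: tjurina_idealD => //.
by rewrite -mul_mpolyC rmorphM; apply: tjurina_idealMpoly.
Qed.

End AtPoint.
End LocalTjurina.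

(** * The total Tjurina number as a value of the Hilbert function *)

Lemma geometric_identity (F : fieldType) (a g c s : F) : c != 0 -> s != 0 ->
  a / s - c * (a * g) = c * a / (c * s) * (1 - c * s * g).
Proof. by move=> c0 s0; field; rewrite c0 s0. Qed.

(** From here to total_tjurina_ex, the Jacobian ideal J is only supposed to have
    quotients of constant dimension tau in degrees at least k0, and no socle
    there.  The total Tjurina number is then tau. *)
Section TotalTjurina.
Variables (K : closedFieldType) (d tau k0 : nat).
Local Notation S := {mpoly K[3]}.
Local Notation A := {mpoly K[2]}.
Local Notation Frac := {fraction {mpoly K[2]}}.
Variable f : S.
Hypothesis d_gt0 : (0 < d)%N.
Hypothesis d_neq0 : d%:R != 0 :> K.
Hypothesis f_homog : f \is d.-homog.
Local Notation J := (jacobian_ideal f).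
Hypothesis dimJ : forall k, (k0 <= k)%N -> graded_dim (fun _ => True) J k tau.
Hypothesis socle : forall k F, (k0 <= k)%N -> F \is k.-homog ->
  (forall i, J ('X_i * F)) -> J F.

Let Jcl : lin_closed J := jac_closed f.

Lemma dependent k n (x : 'I_n -> S) : (k0 <= k)%N -> (tau < n)%N ->
  (forall i, x i \is k.-homog) ->
  exists2 c : 'I_n -> K, (exists i, c i != 0) & J (\sum_i c i *: x i).
Proof.
move=> kk tn hx.
have [] := @dim_quot_dep K S (@mpolyC 3 K) (fun h => True /\ h \is k.-homog) J tau n x.
- exact: (proj1 Jcl).
- by move=> ? ?; exact: lin_closedD.
- by move=> c y Jy; exact: jac_mul.
- by move=> c c'; rewrite mpolyCD.
- by move=> c c'; rewrite mpolyCM.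
- exact: dimJ.
- by [].
- by [].
move=> c cn Jc; exists c => //; move: Jc; congr J.
by apply: eq_bigr => i _; rewrite mul_mpolyC.
Qed.

(** The n + 1 products v^j X_i^(n - j) are dependent modulo J for n >= tau.  In a
    dependence relation, the smallest power of v that occurs has a cofactor that
    does not vanish at p. *)
Lemma local_nilpotent (p : 'I_3 -> K) (i : 'I_3) (v : S) :
  p i != 0 -> v \is 1.-homog -> v.@[p] = 0 ->
  exists b m s, [/\ s \is m.-homog, s.@[p] != 0 & J (s * v ^+ b)].
Proof.
move=> pi0 hv vp; pose n := (k0 + tau)%N.
have hx (j : 'I_n.+1) : v ^+ j * 'X_i ^+ (n - j) \is n.-homog.
  have hj : (j <= n)%N by rewrite -ltnS.
  have := dhomogM (dhomogMn j hv) (Xn_homog K i (n - j)).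
  by rewrite mul1n subnKC.
have [|c [j0 cj0] Jc] := dependent (leq_addr tau k0) _ hx; first by rewrite ltnS leq_addl.
case: (@arg_minnP _ j0 (fun j => c j != 0) val cj0) => b cb bmin.
pose s := \sum_(j : 'I_n.+1 | (b <= j)%N) c j *: (v ^+ (j - b) * 'X_i ^+ (n - j)).
exists b, (n - b)%N, s; split.
- apply: rpred_sum => j bj; apply: rpredZ.
  have hj : (j <= n)%N by rewrite -ltnS.
  have := dhomogM (dhomogMn (j - b) hv) (Xn_homog K i (n - j)).
  by rewrite mul1n addnC addnBA // subnK.
- rewrite raddf_sum (bigD1 b) //= big1 ?addr0 => [|j /andP[bj jb]].
    by rewrite mevalZ subnn expr0 mul1r rmorphXn /= mevalXU mulf_neq0 // expf_neq0.
  rewrite mevalZ mevalM rmorphXn /= vp expr0n subn_eq0.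
  have -> : (j <= b)%N = false.
    by apply/negbTE; rewrite -ltnNge ltn_neqAle bj andbT eq_sym.
  by rewrite mul0r mulr0.
move: Jc; congr J; rewrite /s mulr_suml [RHS]big_mkcond; apply: eq_bigr => j _.
case: ifPn => bj; first by rewrite -scalerAl mulrAC -exprD subnK.
have [->|cj] := eqVneq (c j) 0; first by rewrite scale0r.
by move: bj; rewrite bmin.
Qed.

(** The homogenization of q of degree n, evaluated at (x, y). *)
Definition binary_form (x y : S) n (q : {poly K}) : S :=
  \sum_(i < n.+1) q`_i *: (x ^+ i * y ^+ (n - i)).

Lemma binary_form_homog x y n q :
  x \is 1.-homog -> y \is 1.-homog -> binary_form x y n q \is n.-homog.
Proof.
move=> hx hy; apply: rpred_sum => j _; apply: rpredZ.
have hj : (j <= n)%N by rewrite -ltnS.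
by have := dhomogM (dhomogMn j hx) (dhomogMn (n - j) hy); rewrite !mul1n subnKC.
Qed.

Lemma binary_form_small x y n (q : {poly K}) :
  (size q <= n.+1)%N -> binary_form x y n.+1 q = y * binary_form x y n q.
Proof.
move=> sq; rewrite /binary_form big_ord_recr /= nth_default // scale0r addr0 mulr_sumr.
apply: eq_bigr => i _; have hi : (i <= n)%N by rewrite -ltnS.
by rewrite subSn // exprS -scalerAr mulrCA.
Qed.

Lemma binary_form_mulXsubC x y n (q : {poly K}) r : (size q <= n.+1)%N ->
  binary_form x y n.+1 (q * ('X - r%:P)) = (x - r *: y) * binary_form x y n q.
Proof.
move=> sq; rewrite mulrBl -[_ *: y * _]scalerAl -(binary_form_small x y sq) mulrBr /binary_form.
under eq_bigr do rewrite coefB coefMC scalerBl [q`__ * r]mulrC -scalerA.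
rewrite sumrB -scaler_sumr; congr (_ - _).
rewrite big_ord_recl coefMX scale0r add0r mulr_sumr; apply: eq_bigr => i _.
by rewrite coefMX lift0 /= subSS exprS -scalerAr mulrA.
Qed.

(** The binary form factors into linear ones; multiply F by these factors one
    after the other and stop just before the product enters J. *)
Lemma binary_split (x y F : S) n (q : {poly K}) :
  x \is 1.-homog -> y \is 1.-homog ->
  q != 0 -> (size q <= n.+1)%N -> ~ J F -> J (binary_form x y n q * F) ->
  exists a b m c, [/\ (a != 0) || (b != 0), c \is m.-homog, ~ J (c * F) &
    J ((a *: x + b *: y) * (c * F))].
Proof.
move=> hx hy; elim: n q => [|n IH] q q0 sq JF.
  rewrite /binary_form big_ord1 expr0 mul1r -scalerAl mul1r => Jq; case: JF.
  have q00 : q`_0 != 0.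
    have sq1 : size q = 1%N by apply/eqP; rewrite eqn_leq sq lt0n size_poly_eq0.
    by move: q0; rewrite -lead_coef_eq0 lead_coefE sq1.
  have := @lin_closedZ _ J (q`_0)^-1 _ Jcl Jq.
  by rewrite scalerA mulVf // scale1r.
have [sq'|sq'] := leqP (size q) n.+1.
  rewrite binary_form_small // -mulrA => Jq.
  have [JH|JH] := pselect (J (binary_form x y n q * F)); first exact: (IH q).
  exists 0, 1, n, (binary_form x y n q); split=> //; first by rewrite oner_neq0 orbT.
    exact: binary_form_homog.
  by rewrite scale0r add0r scale1r.
have /closed_rootP[r /factor_theorem[q1 qE]] : size q != 1 by rewrite gtn_eqF // (leq_trans _ sq').
have q10 : q1 != 0 by apply: contraNneq q0 => q10; rewrite qE q10 mul0r.
have sq1 : (size q1 <= n.+1)%N by move: sq; rewrite qE size_Mmonic ?monicXsubC // size_XsubC addn2.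
rewrite qE binary_form_mulXsubC // -mulrA => Jq.
have [JH|JH] := pselect (J (binary_form x y n q1 * F)); first exact: (IH q1).
exists 1, (- r), n, (binary_form x y n q1); split=> //; first by rewrite oner_neq0.
  exact: binary_form_homog.
by rewrite scale1r scaleNr.
Qed.

Lemma killed_by_combination (x y F : S) k :
  x \is 1.-homog -> y \is 1.-homog -> (k0 <= k)%N -> F \is k.-homog -> ~ J F ->
  exists a b m c, [/\ (a != 0) || (b != 0), c \is m.-homog, ~ J (c * F) &
    J ((a *: x + b *: y) * (c * F))].
Proof.
move=> hx hy kk hF JF.
have h (j : 'I_tau.+1) : x ^+ j * y ^+ (tau - j) * F \is (tau + k).-homog.
  have hj : (j <= tau)%N by rewrite -ltnS.
  have := dhomogM (dhomogM (dhomogMn j hx) (dhomogMn (tau - j) hy)) hF.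
  by rewrite !mul1n subnKC.
have [||c [j0 cj0] Jc] := dependent _ _ h; [exact: (leq_trans kk (leq_addl _ _)) | exact: ltnSn |].
pose q := \poly_(i < tau.+1) c (inord i).
have qE (j : 'I_tau.+1) : q`_j = c j by rewrite coef_poly ltn_ord inord_val.
apply: (@binary_split x y F tau q) => //.
- by apply: contraNneq cj0 => q0; rewrite -qE q0 coef0.
- exact: size_poly.
move: Jc; congr J; rewrite /binary_form mulr_suml; apply: eq_bigr => j _.
by rewrite qE scalerAl.
Qed.

(** Suppose F is not in J.  Two applications of killed_by_combination give a
    multiple G of F, not in J, which is annihilated modulo J by two independent
    linear forms; let p be their common zero.  Then a form Q acts on G as the
    scalar Q(p), up to powers of a variable, which never bring G into J because
    there is no socle.  So all elements of J vanish at p, which is a singular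
    point, and a form s with s F in J vanishes at p as well. *)
Lemma zero_lemma k F : (k0 <= k)%N -> F \is k.-homog ->
  (forall p, singular_point f p -> exists m s, [/\ s \is m.-homog, s.@[p] != 0 & J (s * F)]) ->
  J F.
Proof.
move=> kk hF Fp; apply: contrapT => JF.
have X1 (i : 'I_3) : ('X_i : S) \is 1.-homog by rewrite dhomogX /= mdeg1.
have [a [b [m1 [c1 [ab hc1 JG1 JlG1]]]]] := killed_by_combination (X1 0) (X1 1) kk hF JF.
set G1 := c1 * F in JG1 JlG1.
have hG1 : G1 \is (m1 + k).-homog by apply: dhomogM.
have kk1 : (k0 <= m1 + k)%N by rewrite (leq_trans kk) // leq_addl.
(* The choice of j makes the second linear form independent of the first. *)
pose j : 'I_3 := if a == 0 then 0 else 1.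
have [a' [b' [m2 [c2 [ab' hc2 JG2 JlG2]]]]] := killed_by_combination (X1 j) (X1 2%:R) kk1 hG1 JG1.
set G := c2 * G1 in JG2 JlG2.
have hG : G \is (m2 + (m1 + k)).-homog by apply: dhomogM.
have kk2 : (k0 <= m2 + (m1 + k))%N by rewrite (leq_trans kk1) // leq_addl.
pose u : 'rV[K]_3 := a *: delta_mx 0 0 + b *: delta_mx 0 1.
pose v : 'rV[K]_3 := a' *: delta_mx 0 j + b' *: delta_mx 0 2%:R.
have lu : lform u = a *: 'X_0 + b *: 'X_1 by rewrite linearD !linearZ /= !lformX.
have lv : lform v = a' *: 'X_j + b' *: 'X_(2%:R) by rewrite linearD !linearZ /= !lformX.
have uG : J (lform u * G).
  by rewrite lu /G mulrCA; apply: jac_mul.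
have vG : J (lform v * G) by rewrite lv.
have uE : [/\ u 0 0 = a, u 0 1 = b & u 0 2%:R = 0].
  by split; rewrite !mxE /= ?(mulr0, mulr1, add0r, addr0).
have vE : [/\ v 0 0 = (if a == 0 then a' else 0), v 0 1 = (if a == 0 then 0 else a')
            & v 0 2%:R = b'].
  by split; rewrite !mxE /j; case: ifP => _ /=; rewrite ?(mulr0, mulr1, add0r, addr0).
case: uE => u_0 u_1 u_2; case: vE => v_0 v_1 v_2.
have u0 : u != 0.
  apply/eqP => u0; move: ab; rewrite -u_0 -u_1 u0 !mxE eqxx //.
have vu c : v != c *: u.
  apply/eqP => vu.
  have w_0 : v 0 0 = c * a by rewrite vu mxE u_0.
  have w_1 : v 0 1 = c * b by rewrite vu mxE u_1.
  have w_2 : v 0 2%:R = 0 by rewrite vu mxE u_2 mulr0.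
  move: ab'; rewrite -v_2 w_2 eqxx orbF => /eqP; apply.
  move: w_0 w_1; rewrite v_0 v_1; case: eqP => [->|a0]; first by rewrite mulr0.
  move=> /esym/eqP; rewrite mulf_eq0 => /orP[/eqP->|/eqP//].
  by rewrite mul0r.
have [p [[i pi0] vp up]] := pencil_zero v u.
have ptG l : J (pt_form p i l * G).
  have hl := meval_pt_form p i l; rewrite pt_formE in hl *.
  have [c [c' ->]] := pencil_span vu u0 (ex_intro _ i pi0) vp up hl.
  rewrite mulrDl -!scalerAl; exact: (lin_closedD Jcl (lin_closedZ c Jcl vG) (lin_closedZ c' Jcl uG)).
have XG m : ~ J ('X_i ^+ m * G).
  elim: m => [|m IH]; first by rewrite expr0 mul1r.
  move=> JX; apply: IH; apply: (@socle (m + (m2 + (m1 + k)))%N).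
  - by rewrite (leq_trans kk2) // leq_addl.
  - by apply: dhomogM => //; exact: Xn_homog.
  move=> l; have := @lin_closedZ _ J (p i)^-1 _ Jcl (lin_closedD Jcl (jac_mul ('X_i ^+ m) (ptG l)) (lin_closedZ (p l) Jcl JX)).
  congr J; rewrite /pt_form exprS; apply: (scalerI pi0); rewrite scalerA mulfV // scale1r.
  rewrite -!mul_mpolyC; ring.
have evG m Q : Q \is m.-homog -> J (Q * G) -> Q.@[p] = 0.
  move=> hQ JQ; have [c hc] := homog_mod_pt p i hQ.
  apply: contrapT => /eqP Qp; apply: (XG m).
  have : J ((p i ^+ m *: Q - \sum_l c l * pt_form p i l) * G).
    rewrite mulrBl -scalerAl; apply: (lin_closedD Jcl (lin_closedZ _ Jcl JQ)).
    rewrite -scaleN1r; apply: (lin_closedZ (-1) Jcl); rewrite mulr_suml.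
    elim/big_ind: _ => [||l _]; [exact: (proj1 Jcl) | by move=> y z; exact: (lin_closedD Jcl) |].
    by rewrite -mulrA; apply: jac_mul.
  rewrite -hc opprB addrCA subrr addr0 -scalerAl => /(lin_closedZ (Q.@[p]^-1) Jcl).
  by rewrite scalerA mulVf // scale1r.
have sing : singular_point f p.
  split; first by exists i.
    by apply: (evG d) => //; rewrite mulrC; apply: jac_mul; exact: (jac_f d_neq0).
  move=> l; apply: (evG d.-1); first exact: mderiv_homog.
  by rewrite mulrC; apply: jac_mul; exact: jac_deriv.
have [m [s [hs sp JsF]]] := Fp p sing.
have /eqP[] := sp; apply: (evG m) => //.
by rewrite /G /G1 mulrCA; apply: jac_mul; rewrite mulrCA; apply: jac_mul.
Qed.
Lemma eval0_coords (a : A) : exists b c, a = a.@[fun=> 0]%:MP + 'X_0 * b + 'X_1 * c.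
Proof.
elim/mpoly_ring_ind: a => [c|i|a b [x [y Ea]] [z [t Eb]]|a b [x [y Ea]] [z [t Eb]]].
- by exists 0, 0; rewrite mevalC !mulr0 !addr0.
- case: i => -[|[|//]] hi.
    exists 1, 0; rewrite mevalXU mpolyC0 add0r mulr0 mulr1 addr0.
    by rewrite (_ : Ordinal hi = 0) //; apply: val_inj.
  exists 0, 1; rewrite mevalXU mpolyC0 add0r mulr0 mulr1 add0r.
  by rewrite (_ : Ordinal hi = 1) //; apply: val_inj.
- by exists (x + z), (y + t); rewrite mevalD mpolyCD {1}Ea {1}Eb; ring.
exists (a.@[fun=> 0]%:MP * z + x * b), (a.@[fun=> 0]%:MP * t + y * b).
rewrite mevalM mpolyCM {1}Ea {1}Eb.
set al := _%:MP; set be := _%:MP; have -> : b = be + 'X_0 * z + 'X_1 * t by [].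
ring.
Qed.

(** By local_nilpotent, the B-th powers of the two affine coordinates lie in the
    Tjurina ideal, hence so does m^(2 B) for m vanishing at the point.  So modulo
    this ideal the units 1 - m of the local ring have polynomial inverses, and
    polynomials are combinations of monomials of degree at most 2 B, which come
    from forms of any degree k >= 2 B. *)
Lemma local_artinian (p : 'I_3 -> K) (i : 'I_3) : p i != 0 ->
  exists N,
    (forall m : A, m.@[fun=> 0] = 0 ->
       tjurina_ideal (local_equation f p i) (tofrac (m ^+ N))) /\
    (forall k x, (N <= k)%N -> local_ring x ->
      exists2 F, F \is k.-homog &
        tjurina_ideal (local_equation f p i) (x - tofrac (local_equation F p i))).
Proof.
move=> pi0; set T := tjurina_ideal _.
have T_A := @tjurina_idealMpoly K f p i.
have T_D := @tjurina_idealD K f p i.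
have nil (k : 'I_2) : exists b, T (tofrac ('X_k ^+ b : A)).
  have hv : pt_form p i (lift i k) \is 1.-homog by exact: pt_form_homog.
  have [b [m [s [hs sp Js]]]] := local_nilpotent pi0 hv (meval_pt_form p i _).
  exists b; have hvb := dhomogMn b hv.
  have /(tjurina_idealP d_gt0 d_neq0 f_homog pi0 hvb) : exists m s, [/\ s \is m.-homog, s.@[p] != 0 & J (s * pt_form p i (lift i k) ^+ b)].
    by exists m, s.
  rewrite chartXn chart_pt_form // exprZn -mul_mpolyC => /(T_A (p i ^- b)%:MP).
  by rewrite -rmorphM mulrA -mpolyCM mulVf ?expf_neq0 // mpolyC1 mul1r.
have [b0 Tb0] := nil 0; have [b1 Tb1] := nil 1.
pose B := (b0 + b1)%N.
have TX (k : 'I_2) n : (B <= n)%N -> T (tofrac ('X_k ^+ n : A)).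
  move=> Bn; have [b [Tb bB]] : exists b, T (tofrac ('X_k ^+ b : A)) /\ (b <= B)%N.
    case: k => -[|[|//]] hk.
      exists b0; split; last exact: leq_addr.
      by rewrite (_ : Ordinal hk = 0) //; apply: val_inj.
    exists b1; split; last exact: leq_addl.
    by rewrite (_ : Ordinal hk = 1) //; apply: val_inj.
  by rewrite -(subnK (leq_trans bB Bn)) exprD rmorphM; apply: (T_A).
have TN m : m.@[fun=> 0] = 0 -> T (tofrac (m ^+ (2 * B))).
  move=> m0; have [x [y ->]] := eval0_coords m; rewrite m0 mpolyC0 add0r.
  rewrite exprDn rmorph_sum; elim/big_ind: _ => [||j _]; [exact: tjurina_ideal0 | exact: (T_D) |].
  rewrite -mulr_natl rmorphM; apply: (T_A); rewrite !exprMn.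
  have [Bj|jB] := leqP B j.
    by rewrite [X in _ * X]mulrC mulrA rmorphM; apply: (T_A); exact: (TX).
  rewrite -mulrA mulrC rmorphM; apply: (T_A); apply: (TX).
  by apply: leq_trans (leq_sub2l _ (ltnW jB)); rewrite mul2n -addnn addnK.
have stepA (a : A) : exists2 a1, liftable p i (2 * B) a1 & T (tofrac a - tofrac a1).
  elim/mpolyind: a => [|c m a _ _ [a1 la1 Ta1]].
    by exists 0; [exact: liftable0 | rewrite rmorph0 subr0; exact: tjurina_ideal0].
  have [a2 la2 Ta2] : exists2 a2, liftable p i (2 * B) a2 & T (tofrac 'X_[m] - tofrac a2).
    have [B0|B0] := leqP B (m 0).
      exists 0; first exact: liftable0.
      by rewrite rmorph0 subr0 monomial2 mulrC rmorphM; apply: (T_A); exact: (TX).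
    have [B1|B1] := leqP B (m 1).
      exists 0; first exact: liftable0.
      by rewrite rmorph0 subr0 monomial2 rmorphM; apply: (T_A); exact: (TX).
    exists 'X_[m]; last by rewrite subrr; exact: tjurina_ideal0.
    apply: (@liftable_le _ _ _ pi0 (mdeg m)); last exact: liftable_monomial.
    rewrite mdegE sum2 mul2n -addnn; apply: leq_add; exact: ltnW.
  exists (c *: a2 + a1); first by apply: liftableD => //; exact: liftableZ.
  rewrite !rmorphD -!mul_mpolyC !rmorphM /= opprD addrACA -mulrBr.
  by apply: (T_D) => //; exact: (T_A).
exists (2 * B)%N; split=> // k x Nk [a [s [s0 ->]]].
pose s1 := s.@[fun=> 0]^-1 *: s; pose m := 1 - s1.
have m0 : m.@[fun=> 0] = 0 by rewrite mevalB meval1 mevalZ mulVf // subrr.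
pose g := \sum_(j < 2 * B) m ^+ j.
have s1g : s1 * g = 1 - m ^+ (2 * B).
  have -> : s1 = - (m - 1) by rewrite /m addrAC subrr add0r opprK.
  by rewrite mulNr -subrX1 opprB.
have [a1 [F hF FE] Ta1] := stepA (s.@[fun=> 0]^-1 *: (a * g)).
have [F' hF' F'E] := liftable_le pi0 Nk (ex_intro2 _ _ F hF FE).
exists F' => //; rewrite F'E.
pose y := tofrac (s.@[fun=> 0]^-1 *: (a * g)).
have -> : tofrac a / tofrac s - tofrac a1 = (tofrac a / tofrac s - y) + (y - tofrac a1).
  by rewrite addrA subrK.
apply: (T_D) => //; rewrite /y.
have -> : tofrac a / tofrac s - tofrac (s.@[fun=> 0]^-1 *: (a * g)) =
  (tofrac (s.@[fun=> 0]^-1 *: a) / tofrac s1) * tofrac (m ^+ (2 * B)).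
  have c0 : tofrac (s.@[fun=> 0]^-1)%:MP != 0 :> Frac by rewrite tofrac_eq0 mpolyC_eq0 invr_eq0.
  have sF := den_neq0 s0.
  have -> : m ^+ (2 * B) = 1 - s1 * g by rewrite s1g opprB addrCA subrr addr0.
  rewrite /s1 -!mul_mpolyC rmorphB !rmorphM rmorph1 /=.
  move: (tofrac (_^-1)%:MP) (tofrac a) (tofrac s) (tofrac g) c0 sF => c1 a2 s2 g1 c0 sF.
  by rewrite (geometric_identity _ _ c0 sF).
apply: tjurina_idealMl; last exact: TN.
have e : s1.@[fun=> 0] != 0 by rewrite mevalZ mulVf // oner_neq0.
by apply: local_ringM; [exact: local_ring_frac | exact: local_ring_inv].
Qed.

Lemma separate (p q : 'I_3 -> K) : nonzero_vec p -> nonzero_vec q -> ~ proportional q p ->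
  exists2 v : S, v \is 1.-homog & v.@[p] = 0 /\ v.@[q] != 0.
Proof.
move=> [i pi0] qn pq.
have [a ha] : exists a, (pt_form p i a).@[q] != 0.
  apply: contrapT => hn; apply: pq.
  have E a : p i * q a = p a * q i.
    apply/eqP; rewrite -subr_eq0; apply/negPn/negP => h; apply: hn; exists a.
    by rewrite mevalB !mevalZ !mevalXU.
  have qE a : q a = (q i / p i) * p a.
    by apply: (mulfI pi0); rewrite E mulrA [p i * _]mulrC divfK // mulrC.
  exists (q i / p i) => //; rewrite mulf_neq0 ?invr_eq0 //.
  case: qn => a; rewrite qE; apply: contraNneq => ->; by rewrite !mul0r.
exists (pt_form p i a); first exact: pt_form_homog.
by split=> //; exact: meval_pt_form.
Qed.

Section Points.
Variables (n : nat) (P : 'I_n -> 'I_3 -> K) (ch : 'I_n -> 'I_3).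
Hypothesis Pch : forall j, P j (ch j) != 0.
Hypothesis Pinj : forall i j, proportional (P i) (P j) -> i = j.
Local Notation chart j F := (local_equation F (P j) (ch j)).
Local Notation T j := (tjurina_ideal (local_equation f (P j) (ch j))).
Local Notation E k := (dhomog 3 K k).

(** F' is the product of F / u with u, where u is a product of powers of linear
    forms separating P_j from the other points, high enough to lie in the other
    ideals, and F / u stands for a form representing this element of the local
    ring at P_j. *)
Lemma chinese_remainder : exists k1, forall k, (k1 <= k)%N ->
  (forall j x, local_ring x -> exists2 F, F \is k.-homog & T j (x - tofrac (chart j F))) /\
  (forall j F, F \is k.-homog -> exists F', [/\ F' \is k.-homog,
      T j (tofrac (chart j (F - F'))) & forall l, l != j -> T l (tofrac (chart l F'))]).
Proof.
have /choice[N hN] j := local_artinian (Pch j).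
have /choice[v hv] (lj : 'I_n * 'I_n) : exists v : S, v \is 1.-homog /\
    (lj.1 != lj.2 -> v.@[P lj.1] = 0 /\ v.@[P lj.2] != 0).
  have [e|ne] := eqVneq lj.1 lj.2; first by exists 0; rewrite rpred0.
  have [|||v hv1 hv2] := @separate (P lj.1) (P lj.2).
  - by exists (ch lj.1).
  - by exists (ch lj.2).
  - by move=> /Pinj e; move: ne; rewrite e eqxx.
  by exists v.
exists (\sum_j N j)%N => k kN.
have Nk j : (N j <= k)%N.
  by apply: leq_trans kN; rewrite (bigD1 j) //= leq_addr.
split=> [j x lx|j F hF]; first exact: (hN j).2 (Nk j) lx.
pose D := (\sum_(l | l != j) N l)%N.
pose u := \prod_(l | l != j) v (l, j) ^+ N l.
have hu : u \is D.-homog.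
  rewrite /u /D; elim/big_rec2: _ => [|l m x lj hx]; first by rewrite -mpolyC1 mpolyC1 dhomog1.
  have [h1 _] := hv (l, j).
  by apply: dhomogM => //; have := dhomogMn (N l) h1; rewrite mul1n.
have uj : (chart j u).@[fun=> 0] != 0.
  rewrite chart_eval0 rmorph_prod; apply/prodf_neq0 => l lj; rewrite rmorphXn expf_neq0 //.
  by have [_ /(_ lj)[]] := hv (l, j).
have DN : (N j <= k - D)%N.
  rewrite leq_subRL; first by apply: leq_trans kN; rewrite (bigD1 j) //= addnC.
  by apply: leq_trans kN; rewrite [X in (_ <= X)%N](bigD1 j) //= leq_addl.
have Dk : (D <= k)%N.
  by apply: leq_trans kN; rewrite [X in (_ <= X)%N](bigD1 j) //= leq_addl.
have lx : local_ring (tofrac (chart j F) * (tofrac (chart j u))^-1).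
  by apply: local_ringM; [exact: local_ring_frac | exact: local_ring_inv].
have [G hG TG] := (hN j).2 _ _ DN lx.
exists (u * G); split.
- by have := dhomogM hu hG; rewrite subnKC.
- have -> : tofrac (chart j (F - u * G)) = tofrac (chart j u) * (tofrac (chart j F) * (tofrac (chart j u))^-1 - tofrac (chart j G)) :> Frac.
    rewrite chartB chartM rmorphB rmorphM /= mulrBr mulrCA mulfV ?mulr1 //.
    exact: den_neq0.
  exact: tjurina_idealMpoly.
move=> l lj; rewrite chartM rmorphM mulrC; apply: tjurina_idealMpoly.
have -> : u = (\prod_(l' | (l' != j) && (l' != l)) v (l', j) ^+ N l') * v (l, j) ^+ N l.
  by rewrite /u (bigD1 l lj) mulrC.
rewrite chartM rmorphM; apply: tjurina_idealMpoly.
rewrite chartXn; apply: (hN l).1; rewrite chart_eval0.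
by have [_ /(_ lj)[]] := hv (l, j).
Qed.

Let Tcl j := @tjurina_lin_closed K f (P j) (ch j).
Let U k j := graded_piece (Tcl j) k.

Lemma local_dim k :
  (forall j x, local_ring x -> exists2 F, F \is k.-homog & T j (x - tofrac (chart j F))) ->
  forall j, dim_quot (fun c : K => tofrac (c%:MP : A)) (@local_ring K) (T j)
     (\dim {:E k} - \dim (U k j)).
Proof.
move=> hS j.
have phiA : additive (fun F : E k => tofrac (chart j (val F)) : Frac).
  by move=> x y; rewrite /= chartB rmorphB.
pose phiM := GRing.isAdditive.Build (E k) Frac _ phiA.
pose phi : {additive E k -> Frac} := HB.pack (fun F : E k => tofrac (chart j (val F)) : Frac) phiM.
apply: (@dim_quot_vspace K Frac _ (E k) phi fullv (U k j)).
- by move=> c x; rewrite /= chartZ -mul_mpolyC rmorphM.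
- exact: tjurina_ideal0.
- exact: tjurina_idealD.
- by move=> c x; exact: tjurina_idealMpoly.
- by move=> v _; exact: local_ring_frac.
- by move=> x /(hS j)[F hF TF]; exists (DHomog hF); first exact: memvf.
- move=> v; split=> [/graded_pieceP Tv|[_ Tv]]; last exact/graded_pieceP.
  by split=> //; exact: memvf.
by rewrite subnK // dimvS // subvf.
Qed.

(** By chinese_remainder, U_j and the intersection of the others span S_k. *)
Lemma codim_sum k :
  (forall j F, F \is k.-homog -> exists F', [/\ F' \is k.-homog,
      T j (tofrac (chart j (F - F'))) & forall l, l != j -> T l (tofrac (chart l F'))]) ->
  (\sum_j (\dim {:E k} - \dim (U k j)) + \dim (\bigcap_j U k j) = \dim {:E k})%N.
Proof.
move=> hC; suff H (s : seq 'I_n) : uniq s ->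
    (\sum_(j <- s) (\dim {:E k} - \dim (U k j)) + \dim (\bigcap_(j <- s) U k j) = \dim {:E k})%N.
  by have := H _ (index_enum_uniq _).
elim: s => [|j s IH] /=; first by rewrite !big_nil add0n.
move=> /andP[js us]; rewrite !big_cons -[RHS](IH us).
set W := (\bigcap_(j0 <- s) U k j0)%VS; set Sm := \sum_(j0 <- s) _.
have full : (U k j + W = fullv)%VS.
  apply/eqP; rewrite eqEsubv subvf /=; apply/subvP => v _.
  have [F' [hF' T1 T2]] := hC j (val v) (dhomog_is_dhomog v).
  rewrite -[v](subrK (DHomog hF')); apply: memv_add; first exact/graded_pieceP.
  rewrite /W; elim: s us js {IH W Sm} => [|l s IHs] /=; first by rewrite big_nil memvf.
  move=> /andP[_ us]; rewrite inE negb_or => /andP[jl js]; rewrite big_cons memv_cap IHs // andbT.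
  by apply/graded_pieceP; apply: T2; rewrite eq_sym.
have := dimv_sum_cap (U k j) W; rewrite full.
have : (\dim (U k j) <= \dim {:E k})%N by apply/dimvS/subvf.
move: (\dim _) (\dim _) (\dim _) (\dim _) Sm => a b c e g; clear; lia.
Qed.

Lemma codim_jac k : (k0 <= k)%N -> (\dim {:E k} = tau + \dim (graded_piece Jcl k))%N.
Proof.
move=> kk; rewrite dim_dhomog -(dim_graded_pieceT K k).
apply/(graded_dimE (lin_closedT K) Jcl) => //; exact: dimJ.
Qed.

Lemma jac_sub_cap k : (graded_piece Jcl k <= \bigcap_j U k j)%VS.
Proof.
apply/subv_bigcapP => j _; apply/subvP => v /graded_pieceP Jv; apply/graded_pieceP.
by apply: (tjurina_ideal_jac f_homog (Pch j)).
Qed.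

(** The constant 1 is not in the Tjurina ideal of a singular point, so each point
    contributes at least 1 to a sum of codimensions bounded by tau. *)
Lemma points_bound : (forall j, singular_point f (P j)) -> (n <= tau)%N.
Proof.
move=> sing; have [k1 h1] := chinese_remainder.
pose k := (k0 + k1)%N; have [hS hC] := h1 k (leq_addl _ _).
have := codim_sum hC; have := codim_jac (leq_addr k1 k0); rewrite -/k.
have := dimvS (jac_sub_cap k).
suff : (n <= \sum_j (\dim {:E k} - \dim (U k j)))%N.
  move: (\dim _) (\dim _) (\dim _) => a b c; lia.
rewrite -[X in (X <= _)%N](card_ord n) -sum1_card; apply: leq_sum => j _.
rewrite subn_gt0 ltn_neqAle dimvS ?subvf // andbT.
apply/negP => /eqP e; have /eqP full : U k j == fullv.
  by rewrite -(geq_leqif (dimv_leqif_eq (subvf _))) e.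
have hX := Xn_homog K (ch j) k.
have : DHomog hX \in U k j by rewrite full memvf.
move=> /graded_pieceP/(tjurina_idealP d_gt0 d_neq0 f_homog (Pch j) hX)[m [s [hs sp Js]]].
have [_ _ dz] := sing j.
have : (s * 'X_(ch j) ^+ k).@[P j] = 0.
  case: Js => a ->; rewrite raddf_sum big1 // => i _ /=.
  by rewrite mevalM dz mulr0.
rewrite mevalM rmorphXn /= mevalXU => /eqP; rewrite mulf_eq0 expf_eq0.
by rewrite (negbTE sp) (negbTE (Pch j)) andbF.
Qed.

(** The list and the charts are arbitrary, which yields at once the existence of the
    total Tjurina number and its independence of choices. *)
Lemma tjurina_sum : (forall p, singular_point f p -> exists i, proportional p (P i)) ->
  exists t : 'I_n -> nat,
   (forall j, dim_quot (fun c : K => tofrac (c%:MP : A)) (@local_ring K) (T j) (t j)) /\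
   (\sum_j t j = tau)%N.
Proof.
move=> compl; have [k1 h1] := chinese_remainder.
pose k := (k0 + k1)%N; have [hS hC] := h1 k (leq_addl _ _).
exists (fun j => \dim {:E k} - \dim (U k j))%N; split; first exact: local_dim.
suff capE : (\bigcap_j U k j = graded_piece Jcl k)%VS.
  have := codim_sum hC; rewrite capE (codim_jac (leq_addr k1 k0)) -/k => /eqP.
  by rewrite eqn_add2r => /eqP.
apply/eqP; rewrite eqEsubv jac_sub_cap andbT; apply/subvP => v.
move=> vU; apply/graded_pieceP; have hv := dhomog_is_dhomog v.
apply: (zero_lemma (leq_addr k1 k0) hv) => p /[dup] sing /compl[j [c c0 pc]].
have : v \in U k j.
  by apply: (subvP _ _ vU); apply: bigcapv_inf (subvv _).
move=> /graded_pieceP/(tjurina_idealP d_gt0 d_neq0 f_homog (Pch j) hv)[m [s [hs sp Js]]].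
exists m, s; split=> //.
rewrite (meval_eq _ pc) (meval_homog _ _ hs) mulf_neq0 // expf_neq0 //.
Qed.

End Points.
Theorem total_tjurina_uniq tau' : total_tjurina f tau' -> tau' = tau.
Proof.
move=> [n [P [t [sing Pinj compl loct ->]]]].
have /choice[ch hch] j : exists i, P j i != 0 /\
    dim_quot (fun c : K => tofrac (c%:MP : A)) (@local_ring K)
      (tjurina_ideal (local_equation f (P j) i)) (t j).
  by have [i ? ?] := loct j; exists i.
have Pch j : P j (ch j) != 0 by have [] := hch j.
have [t' [ht' <-]] := tjurina_sum Pch Pinj compl.
apply: eq_bigr => j _; have [_ htj] := hch j.
move: (ht' j) htj; apply: dim_quot_uniq.
- exact: tjurina_ideal0.
- exact: tjurina_idealD.
- by move=> c x; exact: tjurina_idealMpoly.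
- by move=> c c'; rewrite mpolyCD rmorphD.
- by move=> c c'; rewrite mpolyCM rmorphM.
Qed.

(** A list of singular points of maximal length exists by points_bound, and it is
    complete. *)
Theorem total_tjurina_ex : total_tjurina f tau.
Proof.
pose Q n := `[< exists P : 'I_n -> 'I_3 -> K,
   (forall j, singular_point f (P j)) /\ forall i j, proportional (P i) (P j) -> i = j >].
have Qb n : Q n -> (n <= tau)%N.
  move=> /asboolP[P [sing Pinj]].
  have /choice[ch Pch] j : exists i, P j i != 0 by have [] := sing j.
  exact: (points_bound Pch Pinj sing).
have Q0 : exists n, Q n.
  exists 0%N; apply/asboolP; exists (fun _ _ => 0); split; first by case.
  by case.
case: (ex_maxnP Q0 Qb) => n /asboolP[P [sing Pinj]] nmax.
have compl p : singular_point f p -> exists i, proportional p (P i).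
  move=> sp; apply: contrapT => np.
  suff /nmax : Q n.+1 by rewrite ltnn.
  apply/asboolP; exists (fun j => if unlift ord0 j is Some i then P i else p); split.
    by move=> j; case: unliftP.
  have psym q : proportional q p -> proportional p q.
    move=> [c c0 hc]; exists c^-1; first by rewrite invr_eq0.
    by move=> l; rewrite hc mulKf.
  move=> i j; case: unliftP => [i' ->|->]; case: unliftP => [j' ->|->] //.
  - by move=> /Pinj ->.
  - by move=> /psym h; case: np; exists i'.
  - by move=> h; case: np; exists j'.
have /choice[ch Pch] j : exists i, P j i != 0 by have [] := sing j.
have [t [ht tE]] := tjurina_sum Pch Pinj compl.
exists n, P, t; split=> // j; first by exists (ch j).
Qed.
End TotalTjurina.

(** * Linear vector fields on smooth curves *)

Lemma char_poly_trmx (R : comNzRingType) n (A : 'M[R]_n) : char_poly A^T = char_poly A.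
Proof.
by rewrite /char_poly /char_poly_mx -det_tr linearB /= tr_scalar_mx map_trmx trmxK.
Qed.

Section LinearVectorField.
Variables (K : numClosedFieldType) (d : nat).
Local Notation S := {mpoly K[3]}.
Variables (f : S) (B : 'M[K]_3).
Hypothesis d_gt2 : (2 < d)%N.
Hypothesis f_homog : f \is d.-homog.
Hypothesis f_smooth : smooth_curve f.

Local Notation pt v := (fun i : 'I_3 => (v : 'cV[K]_3) i 0).
Definition dderiv (w : 'cV[K]_3) (F : S) : S := \sum_j w j 0 *: F^`M(j).
(** The derivation given by the linear vector field x -> B x. *)
Definition vfield (F : S) : S := \sum_i lform (row i B) * F^`M(i).
Hypothesis f_inv : vfield f = 0.

Lemma dderiv_homog w e F : F \is e.-homog -> dderiv w F \is e.-1.-homog.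
Proof. by move=> hF; apply: rpred_sum => j _; apply/rpredZ/mderiv_homog. Qed.

Lemma dderivD u w F : dderiv (u + w) F = dderiv u F + dderiv w F.
Proof. by rewrite /dderiv -big_split; apply: eq_bigr => j _; rewrite mxE scalerDl. Qed.

Lemma dderivZ c w F : dderiv (c *: w) F = c *: dderiv w F.
Proof. by rewrite /dderiv scaler_sumr; apply: eq_bigr => j _; rewrite mxE scalerA. Qed.

Lemma dderiv_0 F : dderiv 0 F = 0.
Proof. by rewrite /dderiv big1 // => j _; rewrite mxE scale0r. Qed.

Lemma dderiv_mderiv w i F : dderiv w F^`M(i) = (dderiv w F)^`M(i).
Proof.
by rewrite /dderiv raddf_sum; apply: eq_bigr => j _ /=; rewrite mderivZ mderiv_comm.
Qed.

Lemma dderiv_comm u w F : dderiv u (dderiv w F) = dderiv w (dderiv u F).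
Proof.
change (\sum_j u j 0 *: (dderiv w F)^`M(j) = \sum_i w i 0 *: (dderiv u F)^`M(i)).
under eq_bigr => j _ do rewrite -dderiv_mderiv /dderiv scaler_sumr.
rewrite exchange_big; apply: eq_bigr => i _ /=.
rewrite /dderiv (raddf_sum (mderiv i)) scaler_sumr; apply: eq_bigr => j _ /=.
by rewrite mderivZ !scalerA mulrC.
Qed.

Lemma dderiv_add w F G : dderiv w (F + G) = dderiv w F + dderiv w G.
Proof. by rewrite /dderiv -big_split; apply: eq_bigr => j _; rewrite mderivD scalerDr. Qed.

Lemma dderiv_zero w : dderiv w 0 = 0.
Proof. by rewrite /dderiv big1 // => j _; rewrite mderiv0 scaler0. Qed.

Lemma dderiv_sum w (F : 'I_3 -> S) : dderiv w (\sum_i F i) = \sum_i dderiv w (F i).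
Proof. by rewrite (big_morph _ (dderiv_add w) (dderiv_zero w)). Qed.

Lemma dderivM w F G : dderiv w (F * G) = dderiv w F * G + F * dderiv w G.
Proof.
rewrite /dderiv mulr_suml mulr_sumr -big_split; apply: eq_bigr => j _ /=.
by rewrite mderivM scalerDr scalerAl scalerAr.
Qed.

Lemma dderiv_lform w i : dderiv w (lform (row i B)) = ((B *m w) i 0)%:MP.
Proof.
rewrite /dderiv mxE rmorph_sum; apply: eq_bigr => j _ /=.
have -> : (lform (row i B))^`M(j) = (B i j)%:MP.
  rewrite /lform raddf_sum (bigD1 j) //= big1 => [|k kj].
    rewrite addr0 mderivZ mderivX mnm1E eqxx scale1r mxE -mul_mpolyC.
    rewrite (_ : (U_(j) - U_(j))%MM = 0%MM) ?mpolyX0 ?mulr1 //.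
    by apply/mnmP => l; rewrite mnmBE subnn mnm0E.
  by rewrite mderivZ mderivX mnm1E (negbTE kj) scale0r scaler0.
by rewrite -mul_mpolyC -mpolyCM mulrC.
Qed.

(** The commutator of a constant vector field w with the linear field B is the
    constant field B w.  At a point v, the field B is itself the constant field
    B v (vfield_eval).  These two rules give all the identities below. *)
Lemma dderiv_vfield w F : dderiv w (vfield F) = dderiv (B *m w) F + vfield (dderiv w F).
Proof.
rewrite dderiv_sum /vfield [in RHS]/dderiv -big_split; apply: eq_bigr => i _ /=.
by rewrite dderivM dderiv_lform mul_mpolyC dderiv_mderiv.
Qed.

Lemma vfield_eval v F : (vfield F).@[pt v] = (dderiv (B *m v) F).@[pt v].
Proof.
rewrite !raddf_sum; apply: eq_bigr => i _ /=.
rewrite mevalM mevalZ meval_lform mxE; congr (_ * _).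
by apply: eq_bigr => j _; rewrite mxE.
Qed.

Lemma dderiv_euler v e F : F \is e.-homog -> (dderiv v F).@[pt v] = e%:R * F.@[pt v].
Proof.
move=> hF; rewrite -mevalZ -(euler hF) !raddf_sum; apply: eq_bigr => j _ /=.
by rewrite mevalZ mevalM mevalXU.
Qed.

Lemma gradient_neq0 v : v != 0 -> exists u, (dderiv u f).@[pt v] != 0.
Proof.
move=> v0; apply: contrapT => hn; apply: (f_smooth (p := pt v)).
have gr0 i : (f^`M(i)).@[pt v] = 0.
  apply: contrapT => /eqP h; apply: hn; exists (delta_mx i 0).
  rewrite /dderiv (bigD1 i) //= big1 ?addr0 ?mxE ?eqxx ?scale1r // => j /negbTE ji.
  by rewrite mxE ji scale0r.
split=> //; first by case/cV0Pn: v0 => i vi; exists i.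
have d0 : d%:R != 0 :> K by rewrite pnatr_eq0 -lt0n (ltn_trans _ d_gt2).
apply: (mulfI d0); rewrite -(dderiv_euler v f_homog) mulr0 raddf_sum big1 // => j _ /=.
by rewrite mevalZ gr0 mulr0.
Qed.

Lemma inv1 w : dderiv (B *m w) f + vfield (dderiv w f) = 0.
Proof. by rewrite -dderiv_vfield f_inv dderiv_zero. Qed.

Lemma inv2 u w : dderiv u (dderiv (B *m w) f) + dderiv (B *m u) (dderiv w f)
  + vfield (dderiv u (dderiv w f)) = 0.
Proof. by rewrite -addrA -dderiv_vfield -dderiv_add inv1 dderiv_zero. Qed.

Lemma inv3 t u w :
  dderiv t (dderiv u (dderiv (B *m w) f))
  + dderiv t (dderiv (B *m u) (dderiv w f))
  + dderiv (B *m t) (dderiv u (dderiv w f)) + vfield (dderiv t (dderiv u (dderiv w f))) = 0.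
Proof. by rewrite -addrA -dderiv_vfield -!dderiv_add inv2 dderiv_zero. Qed.

(** Differentiate the invariance of f at an eigenvector v: by Euler's formula the
    gradient of f at v is an eigenvector of B acting on rows. *)
Lemma eigen_step (l : K) : root (char_poly B) l -> root (char_poly B) (- (d - 1)%:R * l).
Proof.
move=> rl; have : root (char_poly B^T) l by rewrite char_poly_trmx.
rewrite -eigenvalue_root_char => /eigenvalueP[r rE r0].
pose v := r^T; have Bv : B *m v = l *: v.
  by rewrite -[B]trmxK -trmx_mul rE linearZ.
have v0 : v != 0 by rewrite trmx_eq0.
pose g : 'rV[K]_3 := \row_i (f^`M(i)).@[pt v].
have gE w : (dderiv w f).@[pt v] = (g *m w) 0 0.
  by rewrite raddf_sum mxE; apply: eq_bigr => i _ /=; rewrite mevalZ mxE mulrC.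
rewrite -eigenvalue_root_char; apply/eigenvalueP; exists g.
  apply/rowP => j; have := congr1 (meval (pt v)) (inv1 (delta_mx j 0)).
  rewrite mevalD vfield_eval Bv dderivZ mevalZ (dderiv_euler v (dderiv_homog _ f_homog)) gE meval0.
  rewrite mulmxA -colE mxE => /eqP; rewrite addr_eq0 => /eqP ->.
  by rewrite gE -colE !mxE subn1; ring.
apply/eqP => g0; have [u] := gradient_neq0 v0.
by rewrite gE g0 mul0mx mxE eqxx.
Qed.

(** A nonzero eigenvalue would have infinitely many successive multiples by
    - (d - 1), all distinct since d > 2. *)
Lemma eigen_zero (l : K) : root (char_poly B) l -> l = 0.
Proof.
move=> rl; apply: contrapT => /eqP l0.
pose c : K := - (d - 1)%:R.
have rn n : root (char_poly B) (c ^+ n * l).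
  elim: n => [|n IH]; first by rewrite expr0 mul1r.
  by rewrite exprS -mulrA; exact: eigen_step.
have d1 : (1 < d - 1)%N by rewrite ltn_subRL.
have cinj : injective (fun n => c ^+ n * l).
  move=> m n /(mulIf l0) /(congr1 Num.norm); rewrite !normrX normrN normr_nat.
  by apply: ieexprIn; rewrite ?ltr0n ?(ltn_trans _ d1) // pnatr_eq1 gtn_eqF.
have : (size [seq (c ^+ n * l)%R | n <- iota 0 4] < size (char_poly B))%N.
  apply: max_poly_roots; first by rewrite monic_neq0 ?char_poly_monic.
    by apply/allP => x /mapP[n _ ->].
  by rewrite map_inj_uniq ?iota_uniq.
by rewrite size_char_poly size_map size_iota.
Qed.

Lemma nilpotent : B *m (B *m B) = 0.
Proof.
have [r rE] := closed_field_poly_normal (char_poly B).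
have r0 : all (pred1 0) r.
  apply/allP => z zr /=; apply/eqP/eigen_zero.
  by rewrite rE rootZ ?lead_coef_eq0 ?monic_neq0 ?char_poly_monic // root_prod_XsubC.
have cX : char_poly B = 'X^3.
  have sr : size r = 3%N.
    have := size_char_poly B; rewrite rE (monicP (char_poly_monic B)) scale1r.
    by rewrite size_prod_XsubC => -[].
  rewrite rE (monicP (char_poly_monic B)) scale1r -sr.
  elim: {rE sr} r r0 => [|z r IH] /=; first by rewrite big_nil expr0.
  by move=> /andP[/eqP -> /IH h]; rewrite big_cons h subr0 exprS.
have := Cayley_Hamilton B; rewrite cX rmorphXn /= horner_mx_X !exprS expr0 mulr1.
by [].
Qed.

Lemma basis_gradient_contra (v x y z : 'cV[K]_3) : v != 0 ->
  (forall c : 'I_3 -> K, c 0 *: x + c 1 *: y + c 2%:R *: z = 0 -> forall i, c i = 0) ->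
  (dderiv x f).@[pt v] = 0 -> (dderiv y f).@[pt v] = 0 -> (dderiv z f).@[pt v] = 0 -> False.
Proof.
move=> v0 hfree hx hy hz; have [u] := gradient_neq0 v0; apply/negP; rewrite negbK.
pose N : 'M[K]_3 := \matrix_(i, j) tnth [tuple x; y; z] i j 0.
have comb (c : 'rV_3) : (c *m N)^T = c 0 0 *: x + c 0 1 *: y + c 0 2%:R *: z.
  by apply/colP => i; rewrite !mxE sum3 !mxE /tnth /=.
have uN : N \in unitmx.
  rewrite -row_free_unit; apply: inj_row_free => c cN; apply/rowP => i; rewrite mxE.
  apply: (hfree (fun i => c 0 i)); by rewrite -comb cN trmx0.
have -> : u = (u^T *m invmx N *m N)^T by rewrite mulmxKV // trmxK.
by rewrite comb !dderivD !dderivZ !mevalD !mevalZ hx hy hz !mulr0 !addr0.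
Qed.

(** Otherwise take x with v = B (B x) nonzero and put w = B x.  The third
    derivative of the invariance along w shows that D_w D_w f vanishes at v, and
    then the second one along w and x that D_x f vanishes at v.  As D_w f and D_v f
    vanish at v by the first one, f is singular at v. *)
Lemma square_zero : B *m B = 0.
Proof.
apply/eqP/negPn/negP => /matrix0Pn[i0 [j0 BB]].
pose x : 'cV[K]_3 := delta_mx j0 0; pose w := B *m x; pose v := B *m w.
have Bv : B *m v = 0 by rewrite /v /w mulmxA mulmxA -[B *m B *m B]mulmxA nilpotent mul0mx.
have v0 : v != 0.
  by apply/cV0Pn; exists i0; rewrite /v /w mulmxA -colE mxE.
have vf F : (vfield F).@[pt v] = 0 by rewrite vfield_eval Bv dderiv_0 meval0.
have g1 u : (dderiv (B *m u) f).@[pt v] = 0.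
  by have := congr1 (meval (pt v)) (inv1 u); rewrite mevalD vf addr0 meval0.
have E2 := congr1 (meval (pt v)) (inv2 w x).
have E3 := congr1 (meval (pt v)) (inv3 w w w).
rewrite !mevalD vf addr0 meval0 -/w -/v in E2.
rewrite !mevalD vf addr0 meval0 -/v in E3.
have hw2 : dderiv w (dderiv w f) \is (d.-2).-homog by do 2!apply: dderiv_homog.
have c1 : dderiv w (dderiv v (dderiv w f)) = dderiv v (dderiv w (dderiv w f)).
  exact: dderiv_comm.
rewrite -/w (dderiv_comm w v f) c1 !(dderiv_euler v hw2) in E3.
have d20 : d.-2%:R != 0 :> K by rewrite pnatr_eq0 -lt0n -subn2 subn_gt0.
have d10 : d.-1%:R != 0 :> K by rewrite pnatr_eq0 -lt0n -subn1 subn_gt0 ltnW.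
have q0 : (dderiv w (dderiv w f)).@[pt v] = 0.
  apply: (mulfI d20); rewrite mulr0; apply: (@mulfI _ 3%:R); first by rewrite pnatr_eq0.
  by rewrite mulr0 -[RHS]E3; ring.
have gx : (dderiv x f).@[pt v] = 0.
  apply: (mulfI d10); rewrite mulr0 -[RHS]E2 q0 add0r.
  by rewrite (dderiv_euler v (dderiv_homog x f_homog)).
apply: (@basis_gradient_contra v x w v v0) => //; [| exact: g1 | exact: g1].
move=> c Ec.
have B0 (c' : K) : c' *: v = 0 -> c' = 0.
  by move=> /eqP; rewrite scaler_eq0 (negbTE v0) orbF => /eqP.
have c0 : c 0 = 0.
  apply: B0; have := congr1 (fun u => B *m (B *m u)) Ec.
  rewrite !mulmxDr -!scalemxAr -/w -/v Bv !mulmx0 !scaler0 !addr0 //.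
have c1' : c 1 = 0.
  apply: B0; have := congr1 (mulmx B) Ec.
  by rewrite c0 scale0r add0r !mulmxDr -!scalemxAr -/v Bv mulmx0 scaler0 addr0.
have c2 : c 2%:R = 0.
  by apply: B0; move: Ec; rewrite c0 c1' !scale0r !add0r.
exact: ord3P.
Qed.

(** Since B^2 = 0, B has rank at most 1.  For x with v = B x nonzero, the second
    derivatives of the invariance show that D_u f vanishes at v for u = x and for u
    in the kernel of B; these directions span the space. *)
Theorem vfield_trivial : B = 0.
Proof.
apply/eqP/negPn/negP => /matrix0Pn[i0 [j0 B0]].
pose x : 'cV[K]_3 := delta_mx j0 0; pose v := B *m x.
have Bv : B *m v = 0 by rewrite /v mulmxA square_zero mul0mx.
have v0 : v != 0 by apply/cV0Pn; exists i0; rewrite /v -colE mxE.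
have vf F : (vfield F).@[pt v] = 0 by rewrite vfield_eval Bv dderiv_0 meval0.
have d10 : d.-1%:R != 0 :> K by rewrite pnatr_eq0 -lt0n -subn1 subn_gt0 ltnW.
have g2 u w : (dderiv u (dderiv (B *m w) f)).@[pt v] + (dderiv (B *m u) (dderiv w f)).@[pt v] = 0.
  by have := congr1 (meval (pt v)) (inv2 u w); rewrite !mevalD vf addr0 meval0.
have gx : (dderiv x f).@[pt v] = 0.
  have := g2 x x; rewrite -/v dderiv_comm (dderiv_euler v (dderiv_homog x f_homog)).
  rewrite -mulrDr => /eqP; rewrite mulf_eq0 (negbTE d10) /= -mulr2n -mulr_natr.
  by rewrite mulf_eq0 pnatr_eq0 orbF => /eqP.
have gker u : B *m u = 0 -> (dderiv u f).@[pt v] = 0.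
  move=> Bu; have := g2 u x; rewrite Bu dderiv_0 meval0 addr0 -/v dderiv_comm.
  rewrite (dderiv_euler v (dderiv_homog u f_homog)) => /eqP.
  by rewrite mulf_eq0 (negbTE d10) => /eqP.
have rB : (\rank B <= 1)%N.
  have := mulmx0_rank_max square_zero; lia.
have [u] := gradient_neq0 v0; apply/negP; rewrite negbK.
have vB : (v^T <= B^T)%MS by rewrite /v trmx_mul submxMl.
have Bsub : (B^T <= v^T)%MS.
  rewrite -(mxrank_leqif_sup vB) eqn_leq mxrankS //= mxrank_tr.
  by rewrite (leq_trans rB) // lt0n mxrank_eq0 trmx_eq0.
have /sub_rVP[c uc] : ((B *m u)^T <= v^T)%MS.
  by rewrite trmx_mul; apply: submx_trans Bsub; exact: submxMl.
have {}uc : B *m u = c *: v by rewrite -[B *m u]trmxK uc linearZ /= trmxK.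
rewrite -[u](subrK (c *: x)) dderivD dderivZ mevalD mevalZ gx mulr0 addr0.
by apply/eqP/gker; rewrite mulmxBr -scalemxAr uc subrr.
Qed.
End LinearVectorField.

(** * The Jacobian ideal in its first two degrees *)

Section LowDegrees.
Variables (K : fieldType) (d : nat).
Local Notation S := {mpoly K[3]}.
Local Notation E := (dhomog 3 K).
Variable F : S.
Hypothesis F_homog : F \is d.-homog.
Local Notation J := (jacobian_ideal F).
Let Jcl : lin_closed J := jac_closed F.

Definition syz_form (B : 'M[K]_3) : S := \sum_i lform (row i B) * F^`M(i).

Lemma jac_homogP k G : G \is k.-homog -> J G ->
  exists2 a : 'I_3 -> S, (forall i, a i \is (k - d.-1).-homog) & G = \sum_i a i * F^`M(i).
Proof.
move=> hG [a GE].
have /choice[a' ha'] i : exists a', a' \is (k - d.-1).-homog /\ pihomog mdeg k (a i * F^`M(i)) = a' * F^`M(i).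
  by have [a' h1 h2] := pihomog_mulr k (a i) (mderiv_homog i F_homog); exists a'.
exists a'; first by move=> i; have [] := ha' i.
rewrite -(pihomog_dE hG) GE raddf_sum; apply: eq_bigr => i _.
by have [] := ha' i.
Qed.

Lemma jac_low k G : (k < d.-1)%N -> G \is k.-homog -> J G -> G = 0.
Proof.
move=> kd hG [a GE]; rewrite -(pihomog_dE hG) GE raddf_sum big1 // => i _ /=.
by rewrite (pihomogMr_small _ (mderiv_homog i F_homog)).
Qed.

Lemma dim_jac_low k : (k < d.-1)%N -> \dim (graded_piece Jcl k) = 0%N.
Proof.
move=> kd; apply/eqP; rewrite dimv_eq0 -subv0; apply/subvP => v /graded_pieceP Jv.
rewrite memv0; apply/eqP/val_inj; exact: jac_low kd (dhomog_is_dhomog v) Jv.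
Qed.

Lemma dim_graded_piece_param (V : vectType K) k (P : S -> Prop) (hP : lin_closed P)
    (phi : {linear V -> E k}) :
  (forall v, P (val (phi v))) ->
  (forall G, G \is k.-homog -> P G -> exists v, val (phi v) = G) ->
  (\dim (graded_piece hP k) + \dim (lker (linfun phi)) = \dim {:V})%N.
Proof.
move=> h1 h2; rewrite addnC -(limg_ker_dim (linfun phi) fullv) capfv.
congr (_ + \dim _)%N; apply/vspaceP => v; apply/idP/idP.
  move=> /graded_pieceP Pv; have [u uE] := h2 _ (dhomog_is_dhomog v) Pv.
  by apply/memv_imgP; exists u; [exact: memvf | rewrite lfunE; apply: val_inj].
by move=> /memv_imgP[u _ ->]; apply/graded_pieceP; rewrite lfunE.
Qed.

Lemma dim_jac_gens :
  (forall c : 'I_3 -> K, \sum_i c i *: F^`M(i) = 0 -> forall i, c i = 0) ->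
  \dim (graded_piece Jcl d.-1) = 3%N.
Proof.
move=> free.
have hphi (c : 'rV[K]_3) : \sum_i c 0 i *: F^`M(i) \is d.-1.-homog.
  by apply: rpred_sum => i _; apply/rpredZ/mderiv_homog.
pose phi (c : 'rV[K]_3) : E d.-1 := DHomog (hphi c).
have phil : linear phi.
  move=> c x y; apply: val_inj; rewrite /= scaler_sumr -big_split; apply: eq_bigr => i _.
  by rewrite /= !mxE scalerA scalerDl.
pose phiL := GRing.isLinear.Build K 'rV[K]_3 (E d.-1) _ phi phil.
pose phi' : {linear 'rV[K]_3 -> E d.-1} := HB.pack phi phiL.
have := @dim_graded_piece_param _ _ _ Jcl phi'.
have -> : lker (linfun phi') = 0%VS.
  apply/eqP/lker0P => x y; rewrite !lfunE => /(congr1 val) /= /eqP.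
  rewrite -subr_eq0 -sumrB => /eqP h; apply/rowP => i; apply/eqP; rewrite -subr_eq0; apply/eqP.
  apply: (free (fun i => x 0 i - y 0 i)); rewrite -[RHS]h.
  by apply: eq_bigr => j _; rewrite scalerBl.
rewrite dimv0 addn0 dimvf dim_matrix; apply.
  by move=> v; exists (fun i => (v 0 i)%:MP); apply: eq_bigr => i _; rewrite mul_mpolyC.
move=> G hG /(jac_homogP hG)[a ha ->].
exists (\row_i (a i)@_0%MM); rewrite /=; apply: eq_bigr => i _.
by rewrite mxE -mul_mpolyC -homog0_const //; have := ha i; rewrite subnn.
Qed.

(** s is the dimension of the space of linear syzygies. *)
Lemma dim_jac_next : (0 < d)%N -> exists2 s : nat, (\dim (graded_piece Jcl d) + s = 9)%N &
  (s == 0%N <-> forall B, syz_form B = 0 -> B = 0).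
Proof.
move=> d0.
have hphi B : syz_form B \is d.-homog.
  apply: rpred_sum => i _; have := dhomogM (lform_homog (row i B)) (mderiv_homog i F_homog).
  by rewrite add1n prednK.
pose phi B : E d := DHomog (hphi B).
have phil : linear phi.
  move=> c x y; apply: val_inj; rewrite /= /syz_form scaler_sumr -big_split; apply: eq_bigr => i _.
  rewrite /= scalerAl -mulrDl -linearP; congr (lform _ * _).
  by apply/rowP => j; rewrite !mxE.
pose phiL := GRing.isLinear.Build K 'M[K]_3 (E d) _ phi phil.
pose phi' : {linear 'M[K]_3 -> E d} := HB.pack phi phiL.
exists (\dim (lker (linfun phi'))).
  have := @dim_graded_piece_param _ _ _ Jcl phi'; rewrite dimvf dim_matrix; apply.
    by move=> B; exists (fun i => lform (row i B)).
  move=> G hG /(jac_homogP hG)[a ha ->].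
  have ha1 i : a i \is 1.-homog.
    by have := ha i; rewrite -{1}(prednK d0) subSnn.
  exists (\matrix_(i, j) (a i)@_U_(j)); rewrite /= /syz_form; apply: eq_bigr => i _.
  rewrite [in RHS](homog1_lform (ha1 i)); congr (lform _ * _).
  by apply/rowP => j; rewrite !mxE.
rewrite dimv_eq0; split.
  move=> /eqP ker0 B sB; have : B \in lker (linfun phi').
    by rewrite memv_ker lfunE; apply/eqP/val_inj.
  by rewrite ker0 memv0 => /eqP.
move=> h; rewrite -subv0; apply/subvP => B; rewrite memv_ker lfunE memv0 => /eqP /(congr1 val) /= sB.
by rewrite (h B sB).
Qed.

End LowDegrees.

(** * Invariants of the curve *)

Section Main.
Variables (K : numClosedFieldType) (d : nat).
Local Notation S := {mpoly K[3]}.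
Variable f : S.
Hypothesis d_ge2 : (2 <= d)%N.
Hypothesis f_homog : f \is d.-homog.
Local Notation J := (jacobian_ideal f).
Variables (a b : 'rV[K]_3) (h g : S) (e : 'I_3 -> K) (i0 : 'I_3).
Hypothesis ab : forall c, a != c *: b.
Hypothesis b0 : b != 0.
Hypothesis ei0 : e i0 != 0.
Hypothesis ae : (lform a).@[e] = 0.
Hypothesis be : (lform b).@[e] = 0.
Hypothesis hh : h \is (d - 2).-homog.
Hypothesis hg : g \is (d - 1).-homog.
Hypothesis h_neq0 : h != 0.
Hypothesis ge : g.@[e] != 0.
Hypothesis gh_coprime : forall u v, g * u = h * v -> exists w, u = h * w.
Hypothesis JE : forall F, J F <->
  exists A B C, F = lform a * h * A + lform b * h * B + g * C.

Let d_gt0 : (0 < d)%N := ltnW d_ge2.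
Let d_neq0 : d%:R != 0 :> K. Proof. by rewrite pnatr_eq0 -lt0n. Qed.
Let tau := ((d - 1) * (d - 2))%N.

Lemma dimM_stable k : (2 * d - 3 <= k)%N -> graded_dim (fun _ => True) J k tau.
Proof.
move=> kd.
have kd' : (2 * d - 4 <= k)%N by apply: leq_trans kd; rewrite leq_sub2l.
have := dim_quot_high d_ge2 ab b0 ei0 ae be hh hg h_neq0 ge gh_coprime JE kd'.
have -> : (k <= 2 * d - 4)%N = false by apply/negbTE; rewrite -ltnNge; move: kd d_ge2; clear; lia.
by rewrite addn0.
Qed.

Lemma pencil_socle k F : (2 * d - 3 <= k)%N -> F \is k.-homog ->
  (forall i, J ('X_i * F)) -> J F.
Proof. exact: (pencil_ideal_socle d_ge2 ab b0 ei0 ae be hh hg h_neq0 ge gh_coprime JE). Qed.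

Lemma tjurina_ex : total_tjurina f tau.
Proof. exact: (total_tjurina_ex d_gt0 d_neq0 f_homog dimM_stable pencil_socle). Qed.

Lemma tjurina_uniq tau' : total_tjurina f tau' -> tau' = tau.
Proof. exact: (total_tjurina_uniq d_gt0 d_neq0 f_homog dimM_stable pencil_socle). Qed.

Lemma dimN_one k : (d - 2 <= k <= 2 * d - 4)%N -> dim_N f k 1.
Proof. exact: (dim_sat_quot1 d_ge2 ab b0 ei0 ae be hh hg h_neq0 ge gh_coprime JE). Qed.

Lemma dimN_zero k : ~~ (d - 2 <= k <= 2 * d - 4)%N -> dim_N f k 0.
Proof. exact: (dim_sat_quot0 d_ge2 ab b0 ei0 ae be hh hg h_neq0 ge gh_coprime JE). Qed.

Lemma curve_nearly_free : nearly_free f.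
Proof.
split; first exact: (saturation_proper d_ge2 ab b0 ei0 ae be hg h_neq0 ge gh_coprime JE).
move=> k; have [hk|hk] := boolP (d - 2 <= k <= 2 * d - 4)%N.
  by exists 1%N; split=> //; exact: dimN_one.
by exists 0%N; split=> //; exact: dimN_zero.
Qed.

Lemma curve_stability : stability_threshold f (2 * d - 3).
Proof.
split=> [k kd|q hq]; first by exists tau; split; [exact: tjurina_ex | exact: dimM_stable].
rewrite leqNgt; apply/negP => qd.
have qd' : (q <= 2 * d - 4)%N by move: qd d_ge2; clear; lia.
have [t [/tjurina_uniq -> ht]] := hq _ qd'.
have := dim_quot_high d_ge2 ab b0 ei0 ae be hh hg h_neq0 ge gh_coprime JE (leqnn _).
have Jcl := jac_closed f.
move/(graded_dimE (lin_closedT K) Jcl _ (fun _ _ _ => I)) => h1.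
move/(graded_dimE (lin_closedT K) Jcl _ (fun _ _ _ => I)): ht => h2.
by move: h1; rewrite h2 leqnn => /eqP; rewrite eqn_add2r -[X in (X == _)]addn0 eqn_add2l.
Qed.

Lemma gen_deriv F : F \is (d - 1).-homog -> J F ->
  exists c : 'rV[K]_3, F = \sum_i c 0 i *: f^`M(i).
Proof.
move=> hF /(jac_homogP f_homog hF)[c hc ->]; exists (\row_i (c i)@_0%MM).
apply: eq_bigr => i _; rewrite mxE -mul_mpolyC -homog0_const //.
by have := hc i; rewrite subn1 subnn.
Qed.

Lemma gens_coef : exists A : 'M[K]_3,
  [/\ lform a * h = \sum_i A 0 i *: f^`M(i), lform b * h = \sum_i A 1 i *: f^`M(i)
    & g = \sum_i A 2%:R i *: f^`M(i)].
Proof.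
have dE : (d - 1 = 1 + (d - 2))%N by move: d_ge2; clear; lia.
have hl (l : 'rV[K]_3) : lform l * h \is (d - 1).-homog.
  by rewrite dE; apply: dhomogM => //; exact: lform_homog.
have [|c1 E1] := gen_deriv (hl a); first by apply/JE; exists 1, 0, 0; ring.
have [|c2 E2] := gen_deriv (hl b); first by apply/JE; exists 0, 1, 0; ring.
have [|c3 E3] := gen_deriv hg; first by apply/JE; exists 0, 0, 1; ring.
exists (\matrix_i tnth [tuple c1; c2; c3] i).
by split; [rewrite {1}E1 | rewrite {1}E2 | rewrite {1}E3]; apply: eq_bigr => i _; rewrite mxE.
Qed.

Lemma gens_free3 c1 c2 c3 : c1 *: (lform a * h) + c2 *: (lform b * h) + c3 *: g = 0 ->
  [/\ c1 = 0, c2 = 0 & c3 = 0].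
Proof.
move=> E; have c30 : c3 = 0.
  have := congr1 (meval e) E; rewrite !mevalD !mevalZ !mevalM ae be meval0 !mul0r !mulr0 !add0r.
  by move=> /eqP; rewrite mulf_eq0 (negbTE ge) orbF => /eqP.
have : (c1 *: lform a + c2 *: lform b) * h = 0.
  by rewrite mulrDl -!scalerAl -[RHS]E c30 scale0r addr0.
move=> /eqP; rewrite mulf_eq0 (negbTE h_neq0) orbF -!linearZ -linearD lform_eq0 => /eqP.
by move=> /(pencil_free ab b0)[].
Qed.

(** The three independent generators are combinations of the partial derivatives. *)
Lemma partials_free (c : 'I_3 -> K) : \sum_i c i *: f^`M(i) = 0 -> forall i, c i = 0.
Proof.
have [A [E1 E2 E3]] := gens_coef.
have comb (u : 'rV_3) : \sum_i (u *m A) 0 i *: f^`M(i) =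
   u 0 0 *: (lform a * h) + u 0 1 *: (lform b * h) + u 0 2%:R *: g.
  rewrite E1 E2 E3 !scaler_sumr -!big_split; apply: eq_bigr => i _ /=.
  by rewrite mxE sum3 !scalerA !scalerDl.
have uA : A \in unitmx.
  rewrite -row_free_unit; apply: inj_row_free => u uA.
  have := comb u; rewrite uA big1 => [/esym/gens_free3[h0 h1 h2]|i _]; last by rewrite mxE scale0r.
  by apply/rowP => i; rewrite mxE; move: i; apply: ord3P.
move=> cf; pose u := (\row_i c i) *m invmx A.
have uAE : u *m A = \row_i c i by rewrite /u mulmxKV.
have := comb u; rewrite uAE; under eq_bigr do rewrite mxE; rewrite cf.
move=> /esym/gens_free3[h0 h1 h2].
have u0 : u = 0 by apply/rowP => i; rewrite [RHS]mxE; move: i; apply: ord3P.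
by move=> i; have /rowP/(_ i) := uAE; rewrite u0 mul0mx !mxE.
Qed.

(** Rewrite b (a h) - a (b h) = 0 on the partial derivatives. *)
Lemma linear_syzygy : exists2 B : 'M[K]_3, B != 0 & syz_form f B = 0.
Proof.
have [A [E1 E2 _]] := gens_coef.
exists (\matrix_i (A 0 i *: b - A 1 i *: a)).
  apply/eqP => B0.
  have A00 i : A 0 i = 0.
    have /(congr1 (row i)) := B0; rewrite rowK row0 => E.
    have [|] := @pencil_free _ _ a b (- A 1 i) (A 0 i) ab b0; last by [].
    by rewrite scaleNr addrC.
  have : lform a * h != 0.
    by rewrite mulf_neq0 // lform_eq0; have := ab 0; rewrite scale0r.
  by rewrite E1 big1 ?eqxx // => i _; rewrite A00 scale0r.
have : lform b * (lform a * h) - lform a * (lform b * h) = 0 by ring.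
rewrite E1 E2 !mulr_sumr -sumrB => <-; apply: eq_bigr => i _.
have -> : lform (row i (\matrix_i (A 0 i *: b - A 1 i *: a))) = A 0 i *: lform b - A 1 i *: lform a.
  by rewrite rowK linearB !linearZ.
by rewrite mulrBl -!scalerAl -!scalerAr.
Qed.

Lemma curve_mdr : (2 < d)%N -> mdr f 1.
Proof.
move=> d2; split; last first.
  case=> // [[x [y [z [[hx hy hz] E []]]]]].
  have fr := @partials_free (fun i => tnth [tuple x@_0%MM; y@_0%MM; z@_0%MM] i).
  have {}E : \sum_i (tnth [tuple x@_0%MM; y@_0%MM; z@_0%MM] i) *: f^`M(i) = 0.
    rewrite sum3 /tnth /= -!mul_mpolyC -!homog0_const //.
  have x0 : x = 0 by rewrite (homog0_const hx) (fr E 0 : x@_0%MM = 0) mpolyC0.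
  have y0 : y = 0 by rewrite (homog0_const hy) (fr E 1 : y@_0%MM = 0) mpolyC0.
  have z0 : z = 0 by rewrite (homog0_const hz) (fr E 2%:R : z@_0%MM = 0) mpolyC0.
  by exists 0, 0, 0; rewrite x0 y0 z0 !(mul0r, oppr0, addr0).
have [B B0 BE] := linear_syzygy.
exists (lform (row 0 B)), (lform (row 1 B)), (lform (row 2%:R B)); split.
- by split; exact: lform_homog.
- by rewrite -[RHS]BE /syz_form sum3.
case=> u [v [w [E0 E1 E2]]]; case/eqP: B0.
have d1 : (1 < d.-1)%N by rewrite -subn1 ltn_subRL.
have small (p : S) i : pihomog mdeg 1 (p * f^`M(i)) = 0.
  exact: pihomogMr_small (mderiv_homog i f_homog) d1.
have z (i : 'I_3) : pihomog mdeg 1 (lform (row i B)) = 0 -> row i B = 0.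
  by rewrite pihomog_dE ?lform_homog // => /eqP; rewrite lform_eq0 => /eqP.
apply/row_matrixP => i; rewrite row0; apply: z; move: i; apply: ord3P.
- by rewrite E0 pihomogD !small addr0.
- by rewrite E1 pihomogD pihomogN !small oppr0 addr0.
- by rewrite E2 pihomogB pihomogN !small !oppr0 addr0.
Qed.

(** In degrees up to d - 1 both Jacobian ideals are spanned by independent partial
    derivatives; in degree d they differ by the linear syzygy of f. *)
Lemma curve_ct : (2 < d)%N -> coincidence_threshold d f (d - 1).
Proof.
move=> d2 fs hfs smooth.
have fs_syz B : syz_form fs B = 0 -> B = 0 by exact: (vfield_trivial d2 hfs smooth).
have fs_free (c : 'I_3 -> K) : \sum_i c i *: fs^`M(i) = 0 -> forall i, c i = 0.
  move=> cf i; have : syz_form fs (\matrix_i (c i *: delta_mx 0 0)) = 0.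
    rewrite -[RHS](mulr0 (lform (delta_mx 0 (0 : 'I_3)))) -cf mulr_sumr; apply: eq_bigr => j _.
    by rewrite rowK linearZ /= -scalerAl -scalerAr.
  by move=> /fs_syz/matrixP/(_ i 0); rewrite !mxE !eqxx mulr1.
have dM (F : S) k : dim_M F k ('C(k.+2, 2) - \dim (graded_piece (jac_closed F) k)).
  rewrite /dim_M; apply/(graded_dimE (lin_closedT K) (jac_closed F) _ (fun _ _ _ => I)).
  by rewrite dim_graded_pieceT subnK // -(dim_graded_pieceT K); apply/dimvS/subvP => v _; apply/graded_pieceP.
split=> [k kd|q hq].
  exists ('C(k.+2, 2) - \dim (graded_piece (jac_closed f) k))%N; split; first exact: dM.
  have -> : \dim (graded_piece (jac_closed f) k) = \dim (graded_piece (jac_closed fs) k); last exact: dM.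
  have [kd'|kd'] := ltnP k d.-1; first by rewrite !(@dim_jac_low _ d).
  have -> : k = d.-1 by apply/eqP; rewrite eqn_leq kd' -subn1 kd.
  rewrite !(@dim_jac_gens _ d) //; exact: partials_free.
rewrite leqNgt; apply/negP => qd.
have dq : (d <= q)%N by move: qd; rewrite subn1; case: (d).
have [n [hf hs]] := hq d dq.
have [sf sfE sf0] := dim_jac_next f_homog d_gt0.
have [ss ssE ss0] := dim_jac_next hfs d_gt0.
have /eqP ss0' : ss == 0%N by apply/ss0.
have sfn : sf != 0%N.
  by apply/negP => /sf0 hB; have [B /eqP B0 /hB] := linear_syzygy.
move/(graded_dimE (lin_closedT K) (jac_closed f) _ (fun _ _ _ => I)): hf => e1.
move/(graded_dimE (lin_closedT K) (jac_closed fs) _ (fun _ _ _ => I)): hs => e2.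
have {}e1 : \dim (graded_piece (jac_closed f) d) = \dim (graded_piece (jac_closed fs) d).
  by apply/eqP; rewrite -(eqn_add2l n) -e1 -e2.
move: sfE; rewrite e1 -ssE ss0' => /eqP; rewrite eqn_add2l => /eqP sf0'.
by move: sfn; rewrite sf0'.
Qed.
End Main.

(** Excludes lines: for d = 1 a minimal resolution would give J_f = 0. *)
Lemma constant_gens_trivial (K : fieldType) (I : {mpoly K[3]} -> Prop)
    (phi1 : 'M[{mpoly K[3]}]_(3, 1)) :
  (forall i, phi1 i 0 \is 0.-homog /\ (phi1 i 0).@[fun _ => 0] = 0) ->
  (forall h, I h <-> exists w : 'rV_3, h%:M = w *m phi1) -> forall h, I h -> h = 0.
Proof.
move=> hphi ex0 h /ex0[w /matrixP/(_ 0 0)]; rewrite mxE eqxx mulr1n mxE => ->.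
apply: big1 => i _; have [/homog0_const E] := hphi i.
by rewrite E mevalC => ->; rewrite mpolyC0 mulr0.
Qed.

Theorem corollary3p4 (R : realType) (d : nat) (f : {mpoly R[i][3]})
    (b : int) (d1 d2 d3 : nat)
    (d_gt0 : (0 < d)%N)
    (f_homog : f \is d.-homog)
    (f_reduced : reduced_curve f)
    (f_lines : ~ union_of_concurrent_lines f)
    (d1E : d1 = 1%N) (d2E : d2 = (d - 1)%N) (d3E : d3 = (d - 1)%N)
    (resM : minimal_resolution (jacobian_ideal f)
              (b + (2 * (d - 1))%N%:Z)
              (fun i : 'I_3 => (tnth [tuple d1; d2; d3] i + (d - 1))%N%:Z)
              (fun _ : 'I_3 => (d - 1)%N%:Z)) :
  nearly_free f /\
  (forall k : nat, (d - 2 <= k <= 2 * d - 4)%N -> dim_N f k 1) /\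
  (forall k : nat, ~~ (d - 2 <= k <= 2 * d - 4)%N -> dim_N f k 0) /\
  b = 1 /\
  total_tjurina f ((d - 1) * (d - 2))%N /\
  ((2 < d)%N -> mdr f 1) /\
  ((2 < d)%N -> coincidence_threshold d f (d - 1)) /\
  stability_threshold f (2 * d - 3).
Proof.
subst d1 d2 d3.
case: resM => phi3 [phi2 [phi1 [[hphi3 hphi2 hphi1] _ ex2 ex1 ex0]]].
have F_homog i : phi1 i 0 \is (d - 1).-homog.
  by have [] := hphi1 i 0; rewrite subr0.
(* For d = 1, Euler's formula would put f in the zero ideal. *)
have d_ge2 : (2 <= d)%N.
  rewrite ltn_neqAle d_gt0 andbT; apply/eqP => d1.
  have Jf : jacobian_ideal f f.
    by apply: (jac_f _ f_homog); rewrite -d1 oner_neq0.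
  case: f_reduced => /eqP f0 _; apply: f0.
  apply: (constant_gens_trivial _ ex0 Jf) => i; split; last by have [] := hphi1 i 0.
  by have := F_homog i; rewrite -d1.
have phi2_homog i j : phi2 i j \is (tnth [tuple 1%N; (d - 1)%N; (d - 1)%N] i).-homog.
  by have [] := hphi2 i j; rewrite PoszD addrK.
have phi2_homog0 j : phi2 0 j \is 1.-homog by exact: phi2_homog.
have phi2_homog1 i j : i != 0 -> phi2 i j \is (d - 1).-homog.
  by move=> i0; have := phi2_homog i j; move: (i) i0; apply: ord3P.
have phi3_homog i : i != 0 -> is_form b (phi3 0 i).
  move=> i0; have [] := hphi3 0 i.
  suff -> : b + (2 * (d - 1))%N - (tnth [tuple 1%N; (d - 1)%N; (d - 1)%N] i + (d - 1))%N%:Z = b by [].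
  suff -> : tnth [tuple 1%N; (d - 1)%N; (d - 1)%N] i = (d - 1)%N by rewrite mul2n addnn addrK.
  by move: i i0; apply: ord3P.
have [a [c [h [g [e [i0 [[ac c0 ei0 ae ce] [hh hg h0 ge cop] JE bE]]]]]]] :=
  pencil_structure d_ge2 F_homog phi2_homog0 phi2_homog1 phi3_homog
    (fun i j => (hphi2 i j).2) (fun j => (hphi3 0 j).2) ex2 ex1 ex0.
split; first exact: (curve_nearly_free d_ge2 ac c0 ei0 ae ce hh hg h0 ge cop JE).
split; first exact: (dimN_one d_ge2 ac c0 ei0 ae ce hh hg h0 ge cop JE).
split; first exact: (dimN_zero d_ge2 ac c0 ei0 ae ce hh hg h0 ge cop JE).
split; first exact: bE.
split; first exact: (tjurina_ex d_ge2 f_homog ac c0 ei0 ae ce hh hg h0 ge cop JE).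
split; first exact: (curve_mdr d_ge2 f_homog ac c0 ae ce hh hg h0 ge JE).
split; first exact: (curve_ct d_ge2 f_homog ac c0 ae ce hh hg h0 ge JE).
exact: (curve_stability d_ge2 f_homog ac c0 ei0 ae ce hh hg h0 ge cop JE).
Qed.
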